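(* For each $n$ there is a constant $C_n$, depending only on $n$, such that for any nilpotent Lie bracket $\mu_0\in\mathcal{N}_n$ the Ricci flow $g(t)$ with $g(0)=g_{\mu_0}$ is a type-III solution with constant $C_n$; that is, $g(t)$ is defined for all $t\in[0,\infty)$ and $$\|\operatorname{Rm}(g(t))\|\le\frac{C_n}{t}\qquad\text{for all } t\in(0,\infty).$$
   Context: $\mathcal{N}_n$ is the set of skew-symmetric bilinear maps $\mu:\mathbb{R}^n\times\mathbb{R}^n\to\mathbb{R}^n$ that satisfy the Jacobi identity and are nilpotent. For $\mu\in\mathcal{N}_n$, $(\mathbb{R}^n,\cdot_\mu)$ is the simply connected nilpotent Lie group with Lie algebra $(\mathbb{R}^n,\mu)$, identified with $\mathbb{R}^n$ via its exponential map (so $\cdot_\mu$ is given by the Baker-Campbell-Hausdorff formula), and $g_\mu$ is the left-invariant Riemannian metric on $(\mathbb{R}^n,\cdot_\mu)$ whose value at $0$ is the canonical inner product of $\mathbb{R}^n$. The Ricci flow is $\frac{\partial}{\partial t}g(t)=-2\operatorname{Rc}(g(t))$ with $\operatorname{Rc}$ the Ricci tensor; the solution considered is the one that is $(\mathbb{R}^n,\cdot_{\mu_0})$-invariant for all $t$ (equivalently the unique complete solution with bounded curvature). $\operatorname{Rm}$ is the Riemann curvature tensor and its norm is taken with respect to $g(t)$ (it is constant on $\mathbb{R}^n$ by homogeneity). *)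

(* Defs.v *)
From HB Require Import structures.
From mathcomp Require Export all_boot all_order all_algebra.
From mathcomp Require Export all_classical all_reals all_analysis.
Set Implicit Arguments.
Unset Strict Implicit.
Unset Printing Implicit Defensive.
Export Order.TTheory GRing.Theory Num.Theory.
Export numFieldNormedType.Exports.
Local Open Scope classical_set_scope.
Local Open Scope ring_scope.

(* Points and tangent vectors of R^n are row vectors; a (0,2)-tensor field is a
   function x |-> (G x) with G_x(u, v) = u *m G x *m v^T. *)

Section Riemannian.
Variables (R : realType) (n : nat).
Local Notation V := 'rV[R]_n.

Definition partial (i : 'I_n) (f : V -> R) : V -> R :=
  fun x => 'D_(delta_mx 0 i) f x.

Definition iter_partial (s : seq 'I_n) (f : V -> R) : V -> R :=
  foldr partial f s.

Definition smooth (f : V -> R) : Prop :=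
  forall s : seq 'I_n, continuous (iter_partial s f) /\
    forall (i : 'I_n) (x : V), derivable (iter_partial s f) x (delta_mx 0 i).

Definition is_metric (G : V -> 'M[R]_n) : Prop :=
  [/\ forall i j : 'I_n, smooth (fun x => G x i j),
      forall x, (G x)^T = G x
    & forall (x v : V), v != 0 -> 0 < (v *m G x *m v^T) 0 0].

(* The differential of phi at x is u |-> u *m 'J phi x on row vectors. *)
Definition pullback (phi : V -> V) (G : V -> 'M[R]_n) : V -> 'M[R]_n :=
  fun x => jacobian phi x *m G (phi x) *m (jacobian phi x)^T.

(* nabla_(d_i) d_j = \sum_k (christoffel G k i j) d_k *)
Definition christoffel (G : V -> 'M[R]_n) (k i j : 'I_n) : V -> R := fun x =>
  2^-1 * \sum_(l < n) invmx (G x) k l *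
    (partial i (fun z => G z j l) x + partial j (fun z => G z i l) x
     - partial l (fun z => G z i j) x).

(* R(d_i, d_j) d_k = \sum_l (curvature G i j k l) d_l, with
   R(X, Y) Z = nabla_X nabla_Y Z - nabla_Y nabla_X Z - nabla_[X,Y] Z *)
Definition curvature (G : V -> 'M[R]_n) (i j k l : 'I_n) : V -> R := fun x =>
  partial i (christoffel G l j k) x - partial j (christoffel G l i k) x
  + \sum_(m < n) (christoffel G m j k x * christoffel G l i m x
                  - christoffel G m i k x * christoffel G l j m x).

(* Rc(Y, Z) is the trace of X |-> R(X, Y) Z. *)
Definition Rc (G : V -> 'M[R]_n) : V -> 'M[R]_n := fun x =>
  \matrix_(j, k) \sum_(i < n) curvature G i j k i x.

Definition Rm (G : V -> 'M[R]_n) (i j k l : 'I_n) : V -> R := fun x =>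
  \sum_(m < n) curvature G i j k m x * G x m l.

Definition norm_Rm (G : V -> 'M[R]_n) (x : V) : R :=
  let H := invmx (G x) in
  Num.sqrt
    (\sum_(i < n) \sum_(j < n) \sum_(k < n) \sum_(l < n)
     \sum_(a < n) \sum_(b < n) \sum_(c < n) \sum_(d < n)
       H i a * H j b * H k c * H l d * Rm G i j k l x * Rm G a b c d x).

(* The time derivative at t = 0 is one-sided: the limit is taken as s -> t with
   s != t and 0 <= s.  Values of g at negative times are irrelevant. *)
Definition is_ricci_flow (g : R -> V -> 'M[R]_n) : Prop :=
  forall t : R, 0 <= t -> is_metric (g t) /\
    forall x : V,
      (s - t)^-1 *: (g s x - g t x) @[s --> within [set s | 0 <= s] t^']
        --> (- 2) *: Rc (g t) x.

End Riemannian.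

Section NilpotentLie.
Variables (R : realType) (n : nat).
Local Notation V := 'rV[R]_n.

(* lcs mu k x: x belongs to C^k, where C^0 = R^n and C^(k+1) is the linear span
   of mu(R^n, C^k). *)
Inductive lcs (mu : V -> V -> V) : nat -> V -> Prop :=
| lcs_full x : lcs mu 0 x
| lcs_bracket k x y : lcs mu k y -> lcs mu k.+1 (mu x y)
| lcs_zero k : lcs mu k 0
| lcs_linear k a x y : lcs mu k x -> lcs mu k y -> lcs mu k (a *: x + y).

Definition nilpotent_bracket (mu : {bilinear V -> V -> V}) : Prop :=
  [/\ forall x y, mu x y = - mu y x,
      forall x y z, mu x (mu y z) + mu y (mu z x) + mu z (mu x y) = 0
    & exists k, forall x, lcs mu k x -> x = 0].

(* [a_1, [a_2, ... [a_(m-1), a_m]]] *)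
Fixpoint nested (mu : V -> V -> V) (w : seq V) : V :=
  match w with
  | [::] => 0
  | [:: a] => a
  | a :: w' => mu a (nested mu w')
  end.

(* Baker-Campbell-Hausdorff product in Dynkin's form,
     \sum_k (-1)^(k-1)/k \sum_(r_i + s_i > 0)
        [x^r_1 y^s_1 ... x^r_k y^s_k]
          / (\sum_i (r_i + s_i) * \prod_i r_i! s_i!).
   The nilpotency class of a nilpotent bracket on R^n is at most n, so nested
   brackets of more than n letters vanish and the sums may be restricted to
   k, r_i, s_i <= n. *)
Definition bch (mu : V -> V -> V) (x y : V) : V :=
  \sum_(1 <= k < n.+1) ((-1) ^+ k.-1 / k%:R) *:
    \sum_(p : k.-tuple ('I_n.+1 * 'I_n.+1) |
          all (fun q : 'I_n.+1 * 'I_n.+1 => 0 < q.1 + q.2)%N p)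
      ((\sum_(q <- p) (q.1 + q.2))%N%:R
         * \prod_(q <- p) (q.1`! * q.2`!)%N%:R)^-1 *:
      nested mu (flatten [seq nseq q.1 x ++ nseq q.2 y | q : 'I_n.+1 * 'I_n.+1 <- p]).

Definition left_invariant (mu : V -> V -> V) (G : V -> 'M[R]_n) : Prop :=
  forall y : V, pullback (bch mu y) G = G.

(* The inverse of x is - x, so left translation by - x carries x to 0, where the
   metric is the canonical inner product. *)
Definition nil_metric (mu : V -> V -> V) : V -> 'M[R]_n :=
  fun x => pullback (bch mu (- x)) (fun=> 1%:M) x.

Definition invariant_ricci_flow_from (mu : V -> V -> V) (g : R -> V -> 'M[R]_n) :
    Prop :=
  [/\ is_ricci_flow g,
      g 0 = nil_metric mu
    & forall t, 0 <= t -> left_invariant mu (g t)].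

End NilpotentLie.

(* Main.v *)
(* In the exponential chart the left-invariant metrics of (R^n, mu) are the
   E A E^T with A a constant positive matrix, where E x, the series of
   (1 - exp (- ad x)) / ad x, is the matrix of the left Maurer-Cartan form; it is
   polynomial in x with polynomial inverse.  That E is
   invariant under left translation in Dynkin's series is proved formally, by
   comparing the equations that both sides satisfy in a scaling parameter.

   For A = P P^T the curvature at every point is that of the bracket nu obtained
   from mu by the change of basis P.  As mu is nilpotent, tr ad and the Killing
   form vanish, and
   Rc(b, b) = - 1/2 sum |nu(b, e_i)|^2 + 1/4 sum <nu(e_i, e_j), b>^2.
   Hence tr Rc = - |nu|^2 / 4, and along the Ricci flow A' = - 2 Rc one has
   (|nu|^2)' = - 8 |Rc|^2 <= - |nu|^4 / (2 (n + 1)).  Therefore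
   |nu|^2 <= 2 (n + 1) / t, while |Rm| <= 10 n^3 |nu|^2.

   Existence: nu itself solves an ordinary differential equation (the bracket
   flow) that decreases |nu|, hence is global; the change of basis P is recovered
   from P' = - P Rc(nu). *)
From HB Require Import structures.
From mathcomp Require Import ring lra zify.
Require Import Defs.
Local Open Scope ring_scope.
Set Implicit Arguments.
Unset Strict Implicit.
Unset Printing Implicit Defensive.

(** * Exponential generating functions of matrices *)

(** The bound is proved for an arbitrary invariant solution, independently of the one constructed.
    There |nu|^2 is written through A = [g t 0] and its inverse, which are differentiable in t; the
    factor P comes from a Cholesky decomposition made separately at each time, and is never
    differentiated. The Ricci form is used in a symmetrized shape, [ric_sym], for which the energy
    identity is pure algebra, valid for arbitrary structure matrices. It therefore controls the
    bracket flow, even after a cut-off has made the field bounded and Lipschitz, before the solution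
    is known to consist of Lie brackets. That comes at the end: transport back by P shows that nu(t)
    is the initial bracket in another basis. The formal part keeps the scalars in an integral domain
    in which positive integers are invertible, because the same identities serve over the reals,
    over polynomials in a variable that moves x along a line, and over polynomials in the scaling
    parameter on top of these. Derivatives of the group law then become derivations of polynomial
    rings, and uniqueness for differential equations becomes a comparison of coefficients. *)

Section PolynomialMatrices.
Variable S : idomainType.
Implicit Types m n p : nat.

Definition dM m n : 'M[{poly S}]_(m, n) -> 'M[{poly S}]_(m, n) := map_mx (@deriv S).
Definition cM m n : 'M[S]_(m, n) -> 'M[{poly S}]_(m, n) := map_mx (@polyC S).

Lemma dMD m n (A B : 'M[{poly S}]_(m, n)) : dM (A + B) = dM A + dM B.
Proof. by apply/matrixP => i j; rewrite !mxE derivD. Qed.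

Lemma dMN m n (A : 'M[{poly S}]_(m, n)) : dM (- A) = - dM A.
Proof. by apply/matrixP => i j; rewrite !mxE derivN. Qed.

Lemma dMB m n (A B : 'M[{poly S}]_(m, n)) : dM (A - B) = dM A - dM B.
Proof. by rewrite dMD dMN. Qed.

Lemma dM0 m n : dM (0 : 'M[{poly S}]_(m, n)) = 0.
Proof. by apply/matrixP => i j; rewrite !mxE derivC. Qed.

Lemma dM_sum m n I (r : seq I) (P : pred I) (F : I -> 'M[{poly S}]_(m, n)) :
  dM (\sum_(i <- r | P i) F i) = \sum_(i <- r | P i) dM (F i).
Proof. exact: (big_morph _ (@dMD m n) (dM0 m n)). Qed.

Lemma dMZ m n (q : {poly S}) (A : 'M[{poly S}]_(m, n)) :
  dM (q *: A) = q^`() *: A + q *: dM A.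
Proof. by apply/matrixP => i j; rewrite !mxE derivM. Qed.

Lemma dMM m n p (A : 'M[{poly S}]_(m, n)) (B : 'M[{poly S}]_(n, p)) :
  dM (A *m B) = dM A *m B + A *m dM B.
Proof.
apply/matrixP => i j; rewrite !mxE raddf_sum -big_split /=.
by apply: eq_bigr => k _; rewrite !mxE derivM.
Qed.

Lemma dMC m n (A : 'M[S]_(m, n)) : dM (cM A) = 0.
Proof. by apply/matrixP => i j; rewrite !mxE derivC. Qed.

Definition low (k : nat) (q : {poly S}) := forall i, (i < k)%N -> q`_i = 0.
Definition lowM k m n (A : 'M[{poly S}]_(m, n)) := forall i j, low k (A i j).

Lemma low_sum k I (r : seq I) (P : pred I) (F : I -> {poly S}) :
  (forall i, P i -> low k (F i)) -> low k (\sum_(i <- r | P i) F i).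
Proof. by move=> h j jk; rewrite coef_sum big1 // => i Pi; rewrite h. Qed.

Lemma lowMl k (q r : {poly S}) : low k q -> low k (q * r).
Proof.
move=> h i ik; rewrite coefM big1 // => j _.
by rewrite h ?mul0r // (leq_ltn_trans _ ik) // -ltnS.
Qed.

Lemma lowMr k (q r : {poly S}) : low k r -> low k (q * r).
Proof. by rewrite mulrC; apply: lowMl. Qed.

Lemma lowMD k m n (A B : 'M[{poly S}]_(m, n)) : lowM k A -> lowM k B -> lowM k (A + B).
Proof. by move=> a b i j l lk; rewrite mxE coefD a ?b ?addr0. Qed.

Lemma lowMN k m n (A : 'M[{poly S}]_(m, n)) : lowM k A -> lowM k (- A).
Proof. by move=> a i j l lk; rewrite mxE coefN a ?oppr0. Qed.

Lemma lowMZ k m n q (A : 'M[{poly S}]_(m, n)) : lowM k A -> lowM k (q *: A).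
Proof. by move=> a i j; rewrite mxE; apply: lowMr. Qed.

Lemma lowM_sum k m n I (r : seq I) (P : pred I) (F : I -> 'M[{poly S}]_(m, n)) :
  (forall i, P i -> lowM k (F i)) -> lowM k (\sum_(i <- r | P i) F i).
Proof. by move=> h i j; rewrite summxE; apply: low_sum => l Pl; apply: h. Qed.

Lemma lowM_mull k m n p (A : 'M[{poly S}]_(m, n)) (B : 'M[{poly S}]_(n, p)) :
  lowM k A -> lowM k (A *m B).
Proof. by move=> a i j; rewrite mxE; apply: low_sum => l _; apply: lowMl. Qed.

Lemma lowM_mulr k m n p (A : 'M[{poly S}]_(m, n)) (B : 'M[{poly S}]_(n, p)) :
  lowM k B -> lowM k (A *m B).
Proof. by move=> a i j; rewrite mxE; apply: low_sum => l _; apply: lowMr. Qed.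

Hypothesis natU : forall k, k.+1%:R \is a @GRing.unit S.

(** The second hypothesis is what an equation U' = F(U) gives, linear or not, when F(U) vanishes to
    the same order as [U]. The coefficient of ['X^k] in [dM U] is [k.+1] times that of ['X^k.+1] in
    [U], so the order of vanishing keeps rising. *)
Lemma formal_ode_uniq m n (U : 'M[{poly S}]_(m, n)) :
  lowM 1 U -> (forall k, lowM k U -> lowM k (dM U)) -> U = 0.
Proof.
move=> U0 h; suff H k : lowM k U.
  by apply/matrixP => i j; apply/polyP => k; rewrite mxE coef0 (H k.+1).
elim: k => [//|[|k] IH] // i j l; rewrite ltnS leq_eqVlt => /orP[/eqP->|]; last exact: IH.
have /(_ k (leqnn _)) := h _ IH i j; rewrite mxE coef_deriv -mulr_natr => /eqP.
by rewrite mulf_eq0 => /orP[/eqP//|/eqP u0]; have := natU k; rewrite u0 unitr0.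
Qed.

End PolynomialMatrices.
Arguments dM {S m n}. Arguments cM {S m n}.

Section Egf.
Variable (S : idomainType).
Hypothesis natU : forall k, k.+1%:R \is a @GRing.unit S.

Lemma factU k : k`!%:R \is a @GRing.unit S.
Proof. by have := natU (k`!).-1; rewrite prednK // fact_gt0. Qed.

Lemma poly_natU k : k.+1%:R \is a @GRing.unit {poly S}.
Proof.
rewrite -polyC_natr poly_unitE size_polyC coefC eqxx natU andbT.
by apply/eqP; case: eqP => //= k0; have := natU k; rewrite k0 unitr0.
Qed.

(* The polynomial sum_(k < K) 'X^k a_k / k!; on sequences that vanish from K on,
   differentiation is the shift. *)
Definition egf m n K (a : nat -> 'M[S]_(m, n)) : 'M[{poly S}]_(m, n) :=
  \sum_(k < K) ('X^k * (k`!%:R^-1)%:P) *: cM (a k).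

Lemma egf_deriv m n K (a : nat -> 'M[S]_(m, n)) :
  a K = 0 -> dM (egf K a) = egf K (fun k => a k.+1).
Proof.
move=> aK; transitivity (dM (egf K.+1 a)).
  by rewrite /egf big_ord_recr /= aK /cM map_mx0 scaler0 addr0.
rewrite /egf big_ord_recl dMD dMZ dMC scaler0 addr0 expr0 mul1r derivC scale0r add0r.
rewrite dM_sum; apply: eq_bigr => k _; rewrite dMZ dMC scaler0 addr0 lift0.
rewrite derivM derivC mulr0 addr0 derivXn -mulr_natr -mulrA -polyC_natr -polyCM factS.
by rewrite natrM invrM ?natU ?factU// mulrCA mulrV ?natU// mulr1.
Qed.

Lemma egfD m n K (a b : nat -> 'M[S]_(m, n)) :
  egf K (fun k => a k + b k) = egf K a + egf K b.
Proof. by rewrite -big_split; apply: eq_bigr => k _; rewrite /cM map_mxD scalerDr. Qed.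

Lemma egf_mulr m n p K (a : nat -> 'M[S]_(m, n)) (B : 'M[S]_(n, p)) :
  egf K (fun k => a k *m B) = egf K a *m cM B.
Proof. by rewrite /egf mulmx_suml; apply: eq_bigr => k _; rewrite /cM map_mxM scalemxAl. Qed.

Lemma egf_mull m n p K (a : nat -> 'M[S]_(m, n)) (B : 'M[S]_(p, m)) :
  egf K (fun k => B *m a k) = cM B *m egf K a.
Proof. by rewrite /egf mulmx_sumr; apply: eq_bigr => k _; rewrite /cM map_mxM scalemxAr. Qed.

Lemma eq_egf m n K (a b : nat -> 'M[S]_(m, n)) : a =1 b -> egf K a = egf K b.
Proof. by move=> e; apply: eq_bigr => k _; rewrite e. Qed.

Lemma egf_delta m n K (B : 'M[S]_(m, n)) :
  egf K.+1 (fun k => if k is 0%N then B else 0) = cM B.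
Proof.
rewrite /egf big_ord_recl /= expr0 mul1r fact0 invr1 scale1r big1 ?addr0// => i _.
by rewrite /cM map_mx0 scaler0.
Qed.

Lemma egf_low m n K (a : nat -> 'M[S]_(m, n)) : a 0%N = 0 -> lowM 1 (egf K a).
Proof.
move=> a0; apply: lowM_sum => -[[|k] kK] _ i j [|//] _.
  by rewrite !mxE /= a0 mxE mulr0 coef0.
by rewrite !mxE /= -mulrA coefXnM.
Qed.

Definition at1 m n : 'M[{poly S}]_(m, n) -> 'M[S]_(m, n) := map_mx (horner_eval 1).

Lemma at1_egf m n K (a : nat -> 'M[S]_(m, n)) :
  at1 (egf K a) = \sum_(k < K) k`!%:R^-1 *: a k.
Proof.
apply/matrixP => i j; rewrite mxE !summxE /horner_eval horner_sum.
by apply: eq_bigr => k _; rewrite !mxE !hornerE expr1n mul1r.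
Qed.

End Egf.

(** * The adjoint representation and the differential of the exponential *)

Section Structure.
Variables (S : idomainType) (n : nat).
Implicit Type C : 'I_n -> 'M[S]_n.

Definition ad C (z : 'rV[S]_n) : 'M[S]_n := \sum_i z 0 i *: C i.

Lemma ad_is_linear C : linear (ad C).
Proof.
move=> a u v; rewrite /ad scaler_sumr -big_split /=; apply: eq_bigr => i _.
by rewrite !mxE scalerDl scalerA.
Qed.
HB.instance Definition _ C := GRing.isLinear.Build _ _ _ _ (ad C) (ad_is_linear C).

Lemma ad_delta C i : ad C (delta_mx 0 i) = C i.
Proof.
rewrite /ad (bigD1 i) //= mxE !eqxx scale1r big1 ?addr0 // => j /negPf ji.
by rewrite mxE ji andbF scale0r.
Qed.

(* The bracket with structure matrices C is [u, v] = v *m ad C u, so that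
   composition of operators is multiplication of matrices in the opposite order. *)
Definition nil_lie C :=
  [/\ forall i j, row j (C i) = - row i (C j),
      forall i j, ad C (row j (C i)) = C j *m C i - C i *m C j
    & forall s : seq 'I_n, size s = n -> foldr (fun i M => C i *m M) 1%:M s = 0].

Section Theory.
Variable C : 'I_n -> 'M[S]_n.
Hypothesis hC : nil_lie C.
Local Notation adC := (ad C).

Lemma mul_ad u v : v *m adC u = \sum_i \sum_j (u 0 i * v 0 j) *: row j (C i).
Proof.
rewrite /ad mulmx_sumr; apply: eq_bigr => i _.
rewrite -scalemxAr mulmx_sum_row scaler_sumr.
by apply: eq_bigr => j _; rewrite scalerA.
Qed.

Lemma ad_skew u v : v *m adC u = - (u *m adC v).
Proof.
have [h _ _] := hC; rewrite !mul_ad exchange_big /= -sumrN; apply: eq_bigr => j _.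
by rewrite -sumrN; apply: eq_bigr => i _; rewrite h scalerN mulrC.
Qed.

Lemma ad_alt u : (forall k, k.+1%:R \is a @GRing.unit S) -> u *m adC u = 0.
Proof.
move=> natU; have /eqP := ad_skew u u; rewrite -addr_eq0 -mulr2n => /eqP h.
apply/matrixP => i j; have /matrixP/(_ i j) := h.
rewrite !mulmxnE [in X in _ = X -> _]mxE => /eqP; rewrite -mulr_natr mulf_eq0.
by case/orP => /eqP // u0; [rewrite u0 mxE | have := natU 1%N; rewrite u0 unitr0].
Qed.

Lemma ad_bracket u v : adC (v *m adC u) = adC v *m adC u - adC u *m adC v.
Proof.
have [_ h _] := hC; rewrite mul_ad linear_sum /=.
transitivity (\sum_i \sum_j (u 0 i * v 0 j) *: (C j *m C i - C i *m C j)).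
  by apply: eq_bigr => i _; rewrite linear_sum; apply: eq_bigr => j _; rewrite linearZ /= h.
rewrite {2 3}/ad mulmx_sumr mulmx_suml -sumrB; apply: eq_bigr => i _.
rewrite -scalemxAr -scalemxAl !(mulmx_suml, mulmx_sumr) -scalerBr -sumrB scaler_sumr.
apply: eq_bigr => j _.
by rewrite -scalemxAl -scalemxAr -scalerBr scalerA.
Qed.

(** By multilinearity the word reduces to words in the [C i]. The letters are expanded one by one;
    in [H] the prefix [w t] collects the indices already chosen. *)
Lemma ad_word_eq0 (s : seq 'rV[S]_n) :
  (n <= size s)%N -> foldr (fun z M => adC z *m M) 1%:M s = 0.
Proof.
have [_ _ nilC] := hC.
pose w (t : seq 'I_n) := foldr (fun i M => C i *m M) 1%:M t.
have wcat t1 t2 : w (t1 ++ t2) = w t1 *m w t2.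
  by elim: t1 => [|a t IH] /=; rewrite ?mul1mx // IH mulmxA.
have nilw t : (n <= size t)%N -> w t = 0.
  move=> h; rewrite -(cat_take_drop n t) wcat [w (take _ _)]nilC ?mul0mx //.
  by rewrite size_takel.
have H s' t : (n <= size t + size s')%N ->
    w t *m foldr (fun z M => adC z *m M) 1%:M s' = 0.
  elim: s' t => [|z s' IH] t /=; first by rewrite addn0 mulmx1 => /nilw.
  rewrite mulmxA /ad mulmx_sumr mulmx_suml => h; apply: big1 => i _.
  rewrite -scalemxAr -scalemxAl (_ : w t *m C i = w (rcons t i)) ?IH ?scaler0 //.
    by rewrite size_rcons addSnnS.
  by rewrite -cats1 wcat /w /= mulmx1.
by move=> h; have := H s [::] h; rewrite /w /= mul1mx.
Qed.

Lemma ad_expn_eq0 z k : (n <= k)%N -> adC z ^+ k = 0.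
Proof.
move=> h; rewrite -[RHS](ad_word_eq0 (s := nseq k z)) ?size_nseq //.
by elim: k {h} => [|k IH] /=; rewrite ?expr0 // exprS IH mulmxE.
Qed.

End Theory.
End Structure.

Section LiftStructure.
Variables (S T : idomainType) (f : {rmorphism S -> T}) (n : nat) (C : 'I_n -> 'M[S]_n).

Definition lift_str : 'I_n -> 'M[T]_n := fun i => map_mx f (C i).

Lemma map_ad z : map_mx f (ad C z) = ad lift_str (map_mx f z).
Proof.
rewrite /ad raddf_sum; apply: eq_bigr => i _ /=.
by apply/matrixP => a b; rewrite !mxE rmorphM.
Qed.

Lemma nil_lie_lift : nil_lie C -> nil_lie lift_str.
Proof.
case=> h1 h2 h3; split => [i j|i j|s /h3 hs].
- by rewrite -!map_row h1 map_mxN.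
- by rewrite -map_row -map_ad h2 map_mxB !map_mxM.
- have := congr1 (map_mx f) hs; rewrite map_mx0 => <-.
  by elim: s {hs} => [|i s IH] /=; rewrite ?map_mx1 // map_mxM IH.
Qed.

End LiftStructure.

Section ExpDerivative.
Variables (S : idomainType) (n : nat).
Hypothesis natU : forall k, k.+1%:R \is a @GRing.unit S.
Variable C : 'I_n -> 'M[S]_n.
Hypothesis hC : nil_lie C.
Local Notation adC := (ad C).

(* The differential of A |-> A ^+ k in the direction B. *)
Fixpoint dpow (A B : 'M[S]_n) k : 'M[S]_n :=
  if k is k'.+1 then dpow A B k' *m A + A ^+ k' *m B else 0.

(** For [A ^+ n = 0] these are exp A and (exp A - 1) / A. The extra top term of [expm] makes exp A =
    1 + A phi(A) an identity of the truncations themselves. *)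
Definition expm (A : 'M[S]_n) : 'M[S]_n := \sum_(k < n.+1) k`!%:R^-1 *: A ^+ k.
Definition phim (A : 'M[S]_n) : 'M[S]_n := \sum_(k < n) k.+1`!%:R^-1 *: A ^+ k.

Lemma mulSX (A : 'M[S]_n) k : A ^+ k.+1 = A ^+ k *m A.
Proof. by rewrite exprSr mulmxE. Qed.

(** This is a sum of words of length [k] in which one letter is [u] and the others are [z], so
    nilpotency kills it. Truncation is thus compatible with differentiation. *)
Lemma dpow_ad_eq0 z u k : (n <= k)%N -> dpow (adC z) (adC u) k = 0.
Proof.
pose w (t : seq 'rV[S]_n) := foldr (fun z M => adC z *m M) 1%:M t.
have wS x s : adC x *m w s = w (x :: s) by [].
have zw l : adC z ^+ l = w (nseq l z).
  by elim: l => [|l IH] /=; rewrite ?expr0 // exprS IH mulmxE.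
have wr s x : w s *m adC x = w (rcons s x).
  elim: s => [|a s IH] /=; first by rewrite mul1mx mulmx1.
  by rewrite -IH !mulmxA.
have H l s : dpow (adC z) (adC u) l *m w s =
    \sum_(i < l) w (nseq i z ++ u :: nseq (l - i).-1 z ++ s).
  elim: l s => [|l IH] s /=; first by rewrite mul0mx big_ord0.
  rewrite mulmxDl -!mulmxA !wS IH big_ord_recr /=.
  rewrite subSnn /= zw; congr (_ + _); last first.
    by elim: l {IH} => [|l IH] /=; rewrite ?mul1mx // -mulmxA IH.
  apply: eq_bigr => i _; congr (w (_ ++ _ :: _)).
  have li : (0 < l - i)%N by rewrite subn_gt0.
  rewrite subSn ?(ltnW (ltn_ord i)) //=; case: (l - i)%N li => // d _ /=.
  by elim: d => //= d ->.
move=> nk; have := H k [::]; rewrite {1}/w /= mulmx1 => ->; apply: big1 => i _.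
apply: (ad_word_eq0 hC); rewrite size_cat /= size_cat !size_nseq addn0.
by rewrite prednK ?subn_gt0 // subnKC // ltnW.
Qed.

Local Notation Cp := (lift_str (@polyC S) C).
Local Notation adp := (ad Cp).
Let hCp : nil_lie Cp. Proof. exact: nil_lie_lift. Qed.
Let pnatU := poly_natU natU.

Lemma cM_ad z : cM (adC z) = adp (cM z). Proof. exact: map_ad. Qed.

Section OneParameter.
Variable z : 'rV[S]_n.
Let A := adC z.

(* The exponential, its differential in the direction u and the (right)
   Maurer-Cartan form and its differential, at s *: z, as polynomials in s. *)
Let E := egf n.+1 (fun k => A ^+ k).
Let DE u := egf n.+1 (dpow A (adC u)).
Let bk (u : 'rV[S]_n) k := if k is k'.+1 then u *m A ^+ k' else 0.
Let b u := egf n.+1 (bk u).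
Let dbk v (u : 'rV[S]_n) k := if k is k'.+1 then u *m dpow A (adC v) k' else 0.
Let DB v u := egf n.+1 (dbk v u).

Let Xn0 : A ^+ n.+1 = 0. Proof. exact: ad_expn_eq0. Qed.
Let dpow0 u : dpow A (adC u) n.+1 = 0. Proof. exact: dpow_ad_eq0. Qed.

Let dE : dM E = E *m cM A.
Proof.
by rewrite /E egf_deriv // (eq_egf _ (mulSX A)) egf_mulr.
Qed.

Let dDE u : dM (DE u) = DE u *m cM A + E *m cM (adC u).
Proof. by rewrite /DE /E egf_deriv // -!egf_mulr -egfD. Qed.

Let db u : dM (b u) = cM u + b u *m cM A.
Proof.
rewrite /b egf_deriv //=; last by rewrite ad_expn_eq0 ?mulmx0.
rewrite -egf_mulr -(egf_delta n u) -egfD; apply: eq_egf => -[|k] /=.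
  by rewrite expr0 mulmx1 mul0mx addr0.
by rewrite add0r mulSX mulmxA.
Qed.

Let dDB v u : dM (DB v u) = DB v u *m cM A + b u *m cM (adC v).
Proof.
rewrite /DB egf_deriv //=; last by rewrite dpow_ad_eq0 ?mulmx0.
rewrite -!egf_mulr -egfD; apply: eq_egf => -[|k] /=; first by rewrite mulmx0 !mul0mx addr0.
by rewrite mulmxDr !mulmxA.
Qed.

Lemma dad (p : 'rV[{poly S}]_n) : dM (adp p) = adp (dM p).
Proof.
rewrite /ad dM_sum; apply: eq_bigr => i _.
by rewrite dMZ dMC scaler0 addr0 mxE.
Qed.

(** The form of d exp. Both sides solve the same equation in the parameter, because the Jacobi
    identity turns ad of [b u *m cM A] into a commutator; the difference U satisfies U' = U A and
    vanishes at 0. *)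
Let DEE u : DE u = E *m adp (b u).
Proof.
apply/eqP; rewrite -subr_eq0; apply/eqP; apply: (formal_ode_uniq natU).
  apply: lowMD; first exact: egf_low.
  apply: lowMN; apply: lowM_mulr; apply: lowM_sum => i _ ? ?; rewrite mxE.
  by apply: lowMl; apply: egf_low.
move=> k lk; rewrite dMB dMM dDE dE dad db [adp (_ + _)]linearD /= -cM_ad [cM A]cM_ad (ad_bracket hCp) -cM_ad.
have -> : DE u *m cM A + E *m cM (adC u) - (E *m cM A *m adp (b u) +
   E *m (cM (adC u) + (adp (b u) *m cM A - cM A *m adp (b u)))) =
   (DE u - E *m adp (b u)) *m cM A.
  rewrite !mulmxDr mulmxN mulmxBl !mulmxA.
  move: (DE u *m _) (E *m _) (E *m _ *m _) (E *m _ *m _) => x1 x2 x3 x4.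
  by apply/matrixP => i j; rewrite !mxE; ring.
exact: lowM_mull.
Qed.

Lemma phim_at1 u : at1 (b u) = u *m phim A.
Proof.
rewrite /b at1_egf big_ord_recl /= scaler0 add0r /phim mulmx_sumr.
by apply: eq_bigr => i _; rewrite scalemxAr.
Qed.

Lemma at1_ad p : at1 (adp p) = adC (at1 p).
Proof.
rewrite /ad /at1 raddf_sum; apply: eq_bigr => i _ /=.
by apply/matrixP => a c; rewrite !mxE /horner_eval !hornerE.
Qed.

Lemma dexpm u :
  \sum_(k < n.+1) k`!%:R^-1 *: dpow A (adC u) k = expm A *m adC (u *m phim A).
Proof.
have := congr1 (@at1 S n n) (DEE u); rewrite at1_egf => ->.
by rewrite /at1 map_mxM -/(at1 E) -/(at1 _) at1_egf at1_ad phim_at1.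
Qed.

(** The same device: skew-symmetry and the Jacobi identity make the difference of the two sides a
    solution of U' = U A. *)
Let MC u v : DB v u - DB u v = b u *m adp (b v).
Proof.
apply/eqP; rewrite -subr_eq0; apply/eqP; apply: (formal_ode_uniq natU).
  do !apply: lowMD; do ?apply: lowMN; rewrite ?lowM_mull //; do ?exact: egf_low.
  by apply: lowM_mull; exact: egf_low.
move=> k lk; rewrite !dMB dMM !dDB dad !db [adp (_ + _)]linearD /= !(cM_ad u) !(cM_ad v).
rewrite [cM A]cM_ad (ad_bracket hCp) mulmxDl mulmxDr -[adp (cM z)]cM_ad.
rewrite (ad_skew hCp (b v) (cM u)).
have -> : forall x1 x2 y1 y2 c1 c2 : 'rV[{poly S}]_n,
   x1 + x2 - (y1 + y2) - (- y2 + c1 + (x2 + c2)) = x1 - y1 - (c1 + c2).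
  by move=> x1 x2 y1 y2 c1 c2; apply/matrixP => i j; rewrite !mxE; ring.
have -> : b u *m cM A *m adp (b v) + b u *m (adp (b v) *m cM A - cM A *m adp (b v))
    = b u *m adp (b v) *m cM A.
  by rewrite mulmxBr !mulmxA addrC subrK.
by rewrite -!mulmxBl; apply: lowM_mull.
Qed.

Lemma maurer_cartan u v :
  \sum_(k < n) k.+1`!%:R^-1 *: (u *m dpow A (adC v) k - v *m dpow A (adC u) k)
  = (u *m phim A) *m adC (v *m phim A).
Proof.
have := congr1 (@at1 S 1 n) (MC u v).
rewrite [in RHS]/at1 map_mxM -![map_mx _ _]/(at1 _) at1_ad !phim_at1 => <-.
rewrite /at1 map_mxB -![map_mx _ _]/(at1 _) !at1_egf !big_ord_recl /= !scaler0 !add0r.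
by rewrite -sumrB; apply: eq_bigr => i _; rewrite scalerBr.
Qed.

End OneParameter.
End ExpDerivative.

Lemma deriv_bigsum (S : nzRingType) (I : Type) (r : seq I) (P : pred I) (F : I -> {poly S}) :
  (\sum_(i <- r | P i) F i)^`() = \sum_(i <- r | P i) (F i)^`().
Proof. exact: (big_morph _ (@derivD S) (@deriv0 S)). Qed.

(** * Truncated exponential and logarithm *)

Section ExpLog.
Variable (S : idomainType).
Hypothesis natU : forall k, k.+1%:R \is a @GRing.unit S.
Variable m : nat.
Let n := m.+1.

(** The series of log W / (W - 1) in powers of [W - 1%:M]; its coefficients are the outer
    coefficients of Dynkin's series. *)
Definition psim n (W : 'M[S]_n) : 'M[S]_n :=
  \sum_(k < n) ((-1) ^+ k / k.+1%:R) *: (W - 1%:M) ^+ k.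

(** Scalar models. Relations between power series are proved modulo ['X^n] and then evaluated at
    [A], where ['X^n] becomes 0. Taking [c] to be 1 or -1 puts exp A and exp (- A) into one
    polynomial ring. *)
Let e (c : S) : {poly S} := \sum_(k < n.+1) k`!%:R^-1 *: (c *: 'X) ^+ k.
Let f (c : S) : {poly S} := \sum_(k < n) k.+1`!%:R^-1 *: (c *: 'X) ^+ k.
Let psi (p : {poly S}) := \sum_(k < n) ((-1) ^+ k / k.+1%:R) *: (p - 1) ^+ k.

Let eE c : e c = 1 + c *: 'X * f c.
Proof.
rewrite /e big_ord_recl; congr (_ + _); first by rewrite /= fact0 invr1 scale1r expr0.
by rewrite /f mulr_sumr; apply: eq_bigr => k _; rewrite lift0 -scalerAr -exprS.
Qed.

Let de c : (e c)^`() = c *: (e c - n`!%:R^-1 *: (c *: 'X) ^+ n).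
Proof.
rewrite [in RHS]/e big_ord_recr /= addrK /e big_ord_recl derivD.
rewrite derivZ expr0 derivC scaler0 add0r deriv_bigsum scaler_sumr.
apply: eq_bigr => k _; rewrite lift0 derivZ deriv_exp derivZ derivX /=.
rewrite -scaler_nat -scalerAl mul1r !scalerA; congr (_ *: _).
by rewrite factS natrM invrM ?natU ?factU// divrK ?natU// mulrC.
Qed.

Let lowXn (c : S) k p : (n <= k)%N -> low n ((c *: 'X) ^+ k * p).
Proof.
move=> nk i ik; rewrite exprZn -scalerAl coefZ coefXnM.
by rewrite (leq_trans ik nk) mulr0.
Qed.

Let low_deriv k (p : {poly S}) : low k p^`() -> low 1 p -> low k.+1 p.
Proof.
move=> h h0 [|i] ik; first exact: h0.
have := h i ik; rewrite coef_deriv -mulr_natr => /eqP.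
by rewrite mulf_eq0 => /orP[/eqP//|/eqP u0]; have := natU i; rewrite u0 unitr0.
Qed.

Let low_mulX k (p : {poly S}) : low k.+1 ('X * p) -> low k p.
Proof. by move=> h i ik; have := h i.+1 ik; rewrite coefXM. Qed.

Let lowD k (p q : {poly S}) : low k p -> low k q -> low k (p + q).
Proof. by move=> h1 h2 i ik; rewrite coefD h1 ?h2 ?addr0. Qed.

Let lowN k (p : {poly S}) : low k p -> low k (- p).
Proof. by move=> h1 i ik; rewrite coefN h1 ?oppr0. Qed.

Let lowZ k c (p : {poly S}) : low k p -> low k (c *: p).
Proof. by move=> h1 i ik; rewrite coefZ h1 ?mulr0. Qed.

(** Multiplied by ['X] this says log (exp 'X) = 'X. Its derivative is the relation q e' = 1, where
    [q] is the truncated geometric series of 1 / e and e' agrees with e below order [n]. *)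
Let psiP : low n (psi (e 1) * f 1 - 1).
Proof.
pose q : {poly S} := \sum_(k < n) (- (e 1 - 1)) ^+ k.
have eX : e 1 - 1 = 'X * f 1 by rewrite eE scale1r addrC addKr.
have qe : q * e 1 = 1 - (- (e 1 - 1)) ^+ n.
  have := subrXX (1 : {poly S}) (- (e 1 - 1)) n; rewrite expr1n => ->.
  rewrite mulrC; congr (_ * _); first by rewrite opprK addrC subrK.
  by apply: eq_bigr => i _; rewrite expr1n mul1r.
apply: low_mulX; rewrite mulrBr mulr1 mulrCA -eX; apply: low_deriv; last first.
  by move=> [|//] _; rewrite coefB mulrC eX -mulrA coefXM coefX subrr.
have -> : (psi (e 1) * (e 1 - 1) - 'X)^`() = q * (e 1)^`() - 1.
  rewrite derivB derivX /psi mulr_suml deriv_bigsum; congr (_ - _).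
  rewrite mulr_suml; apply: eq_bigr => k _.
  rewrite -scalerAl -exprSr derivZ deriv_exp derivB derivC subr0 /=.
  rewrite -scaler_nat scalerA divrK ?natU// [in RHS]exprNn -!(signr_odd _ k).
  by case: odd; rewrite ?expr1 ?expr0 ?scaleN1r ?scale1r ?mulN1r ?mul1r ?mulNr mulrC.
rewrite de !scale1r mulrBr qe eX (_ : - ('X * f 1) = 'X * - f 1) ?mulrN// -mulrN exprMn.
rewrite (_ : _ - _ = - ('X ^+ n * (- f 1) ^+ n) - n`!%:R^-1 *: ('X ^+ n * q)).
  rewrite -['X]scale1r; apply: lowD; apply: lowN; first exact: lowXn.
  by apply: lowZ; apply: lowXn.
by rewrite -scalerAr [q * _]mulrC; ring.
Qed.

Let expNP : low n.+1 (1 - e 1 * e (-1)).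
Proof.
apply: low_deriv; last first.
  move=> [|//] _; rewrite !eE coefB coef1 coef0M !coefD !coef1 -!scalerAl !coefZ !coefXM.
  by rewrite !mulr0 !addr0 mulr1 subrr.
rewrite derivB derivC derivM !de sub0r; apply: lowN.
rewrite !scale1r !scaleN1r.
rewrite (_ : _ + _ = n`!%:R^-1 *: ((-1 *: 'X) ^+ n * e 1) - n`!%:R^-1 *: ((1 *: 'X) ^+ n * e (-1))).
  by apply: lowD; last apply: lowN; apply: lowZ; apply: lowXn.
rewrite !scale1r !scaleN1r mulrBl mulrN mulrBr -!scalerAl -!scalerAr opprB.
by rewrite [e 1 * (-_)^+ _]mulrC; ring.
Qed.

Let phiNP : low n (e 1 * f (-1) - f 1).
Proof.
apply: low_mulX; rewrite (_ : _ * _ = 1 - e 1 * e (-1)) //.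
have E1 : 'X * f 1 = e 1 - 1 by rewrite eE scale1r addrC addKr.
by rewrite (eE (-1)) scaleN1r mulrBr E1; move: (e 1) (f (-1)) => x y; ring.
Qed.

Variable A : 'M[S]_n.
Hypothesis An0 : A ^+ n = 0.
Local Notation H := (horner_mx A).

Let H_low p : low n p -> H p = 0.
Proof.
move=> h; rewrite -(poly_take_drop n p) (_ : take_poly n p = 0).
  by rewrite add0r rmorphM rmorphXn /= horner_mx_X An0 mulr0.
by apply/polyP => i; rewrite coef_take_poly coef0; case: ifP => // /h.
Qed.

Let H_pow c k : H ((c *: 'X) ^+ k) = (c *: A) ^+ k.
Proof. by rewrite rmorphXn /= horner_mxZ horner_mx_X. Qed.

Let He c : H (e c) = expm (c *: A).
Proof. by rewrite rmorph_sum; apply: eq_bigr => k _ /=; rewrite horner_mxZ H_pow. Qed.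

Let Hf c : H (f c) = phim (c *: A).
Proof. by rewrite rmorph_sum; apply: eq_bigr => k _ /=; rewrite horner_mxZ H_pow. Qed.

Let Hpsi p : H (psi p) = psim (H p).
Proof.
rewrite rmorph_sum; apply: eq_bigr => k _.
by rewrite /= horner_mxZ rmorphXn rmorphB rmorph1.
Qed.

Lemma psim_phim_S : psim (expm A) *m phim A = 1%:M.
Proof.
by have /eqP := H_low psiP; rewrite rmorphB rmorphM rmorph1 /= Hpsi He Hf scale1r subr_eq0 => /eqP.
Qed.

Lemma expmN_S : expm A *m expm (- A) = 1%:M.
Proof.
have /H_low/eqP : low n (1 - e 1 * e (-1)) by move=> i h; apply: expNP; apply: ltnW.
by rewrite rmorphB rmorphM rmorph1 /= !He scale1r scaleN1r subr_eq0 => /eqP.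
Qed.

Lemma expm_phimN_S : phim (- A) *m expm A = phim A.
Proof.
by have /eqP := H_low phiNP; rewrite mulrC rmorphB rmorphM /= !He !Hf scale1r scaleN1r subr_eq0 => /eqP.
Qed.

End ExpLog.

Section ExpLogAll.
Variable (S : idomainType).
Hypothesis natU : forall k, k.+1%:R \is a @GRing.unit S.
Variables (n : nat) (A : 'M[S]_n).
Hypothesis An0 : A ^+ n = 0.

Lemma psim_phim : psim (expm A) *m phim A = 1%:M.
Proof. by case: n A An0 => [|m] B Bn; [rewrite [LHS]flatmx0 [RHS]flatmx0 | apply: psim_phim_S]. Qed.

Lemma expmN : expm A *m expm (- A) = 1%:M.
Proof. by case: n A An0 => [|m] B Bn; [rewrite [LHS]flatmx0 [RHS]flatmx0 | apply: expmN_S]. Qed.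

Lemma expm_phimN : phim (- A) *m expm A = phim A.
Proof. by case: n A An0 => [|m] B Bn; [rewrite [LHS]flatmx0 [RHS]flatmx0 | apply: expm_phimN_S]. Qed.

End ExpLogAll.

(** * The Maurer-Cartan equation and the Dynkin series *)

Section Derivations.
Variables (T : idomainType) (n : nat).
Hypothesis natU : forall k, k.+1%:R \is a @GRing.unit T.
Variable C : 'I_n -> 'M[T]_n.
Hypothesis hC : nil_lie C.

(** Kept abstract because it is applied to d/d'X and to a derivation of the scalars extended to
    coefficients, and these two commute. Killing the structure constants lets it pass through
    [ad]. *)
Definition derivation (d : T -> T) :=
  [/\ forall x y, d (x + y) = d x + d y,
      forall x y, d (x * y) = d x * y + x * d y
    & forall i a b, d (C i a b) = 0].

Section OneDerivation.
Variable d : T -> T.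
Hypothesis hd : derivation d.
Local Notation D := (map_mx d).

Let dD x y : d (x + y) = d x + d y. Proof. by case: hd. Qed.
Let dMul x y : d (x * y) = d x * y + x * d y. Proof. by case: hd. Qed.
Let d0 : d 0 = 0.
Proof. by have := dD 0 0; rewrite addr0 => /eqP; rewrite -subr_eq subrr => /eqP. Qed.
Let d1 : d 1 = 0.
Proof. by have := dMul 1 1; rewrite !mulr1 mul1r => /eqP; rewrite -subr_eq subrr => /eqP. Qed.
Let dnat k : d k%:R = 0.
Proof. by elim: k => [|k IH]; rewrite ?d0 // -addn1 natrD dD IH d1 addr0. Qed.
Let dinv k : d k`!%:R^-1 = 0.
Proof.
have u := factU natU k; have := dMul k`!%:R k`!%:R^-1.
rewrite divrr // d1 dnat mul0r add0r => /esym/eqP; rewrite mulf_eq0 => /orP[/eqP k0|/eqP//].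
by move: u; rewrite k0 unitr0.
Qed.
Let dN x : d (- x) = - d x.
Proof. by apply/eqP; rewrite -addr_eq0 -dD addNr d0. Qed.
Let dsum I (r : seq I) (P : pred I) F : d (\sum_(i <- r | P i) F i) = \sum_(i <- r | P i) d (F i).
Proof. exact: (big_morph _ dD d0). Qed.

Lemma mxderD m p (A B : 'M[T]_(m, p)) : D (A + B) = D A + D B.
Proof. by apply/matrixP => i j; rewrite !mxE dD. Qed.

Lemma mxderN m p (A : 'M[T]_(m, p)) : D (- A) = - D A.
Proof. by apply/matrixP => i j; rewrite !mxE dN. Qed.

Lemma mxderM m p q (A : 'M[T]_(m, p)) (B : 'M[T]_(p, q)) : D (A *m B) = D A *m B + A *m D B.
Proof.
apply/matrixP => i j; rewrite !mxE dsum -big_split /=.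
by apply: eq_bigr => k _; rewrite !mxE dMul.
Qed.

Lemma mxder_fact m p k (A : 'M[T]_(m, p)) : D (k`!%:R^-1 *: A) = k`!%:R^-1 *: D A.
Proof. by apply/matrixP => i j; rewrite !mxE dMul dinv mul0r add0r. Qed.

Lemma mxder_sum m p I (r : seq I) (P : pred I) (F : I -> 'M[T]_(m, p)) :
  D (\sum_(i <- r | P i) F i) = \sum_(i <- r | P i) D (F i).
Proof.
apply: (big_morph D); first exact: mxderD.
by apply/matrixP => i j; rewrite !mxE d0.
Qed.

Lemma mxder_exp (A : 'M[T]_n) k : D (A ^+ k) = dpow A (D A) k.
Proof.
elim: k => [|k IH] /=; last by rewrite exprSr -mulmxE mxderM IH.
by apply/matrixP => i j; rewrite expr0 !mxE; case: (i == j); rewrite ?dnat.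
Qed.

Lemma mxder_ad z : D (ad C z) = ad C (D z).
Proof.
rewrite /ad mxder_sum; apply: eq_bigr => i _; apply/matrixP => a b.
by case: hd => _ _ dC; rewrite !mxE dMul dC mulr0 addr0.
Qed.

Lemma mxder_expm z : D (expm (ad C z)) = expm (ad C z) *m ad C (D z *m phim (ad C z)).
Proof.
rewrite -dexpm // /expm mxder_sum; apply: eq_bigr => k _.
by rewrite mxder_fact mxder_exp mxder_ad.
Qed.

Lemma dpowN (A B : 'M[T]_n) k : dpow A (- B) k = - dpow A B k.
Proof. by elim: k => [|k IH] /=; rewrite ?oppr0 // IH mulNmx mulmxN opprD. Qed.

Lemma mxder_phimN z (u : 'rV[T]_n) : D (u *m phim (- ad C z)) = D u *m phim (- ad C z)
  - \sum_(k < n) k.+1`!%:R^-1 *: (u *m dpow (- ad C z) (ad C (D z)) k).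
Proof.
rewrite mxderM; congr (_ + _); rewrite /phim mxder_sum mulmx_sumr -[RHS]sumrN.
apply: eq_bigr => k _; rewrite mxder_fact mxder_exp mxderN mxder_ad dpowN.
by rewrite -scalemxAr mulmxN scalerN.
Qed.

End OneDerivation.

(* Here th d is the value on d of the form g^-1 dg at g = exp z. *)
Lemma maurer_cartan_left d1 d2 z : derivation d1 -> derivation d2 ->
  (forall x, d1 (d2 x) = d2 (d1 x)) ->
  let th d := map_mx d z *m phim (- ad C z) in
  map_mx d1 (th d2) - map_mx d2 (th d1) = - (th d2 *m ad C (th d1)).
Proof.
move=> h1 h2 comm th; rewrite /th !mxder_phimN //.
have -> : map_mx d1 (map_mx d2 z) = map_mx d2 (map_mx d1 z).
  by apply/matrixP => i j; rewrite !mxE.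
rewrite opprB addrC subrKA -sumrB.
have := maurer_cartan natU hC (- z) (map_mx d2 z) (map_mx d1 z).
rewrite linearN /= => <-; rewrite -[RHS]sumrN; apply: eq_bigr => k _.
by rewrite -scalerBr -scalerN opprB.
Qed.

End Derivations.

(** * Dynkin's series and its derivative in the scaling parameter *)

Section Dynkin.
Variables (S : idomainType) (n : nat).
Hypothesis natU : forall k, k.+1%:R \is a @GRing.unit S.
Variable C : 'I_n -> 'M[S]_n.

Fixpoint nest (w : seq 'rV[S]_n) : 'rV[S]_n :=
  match w with
  | [::] => 0
  | [:: a] => a
  | a :: w' => nest w' *m ad C a
  end.

Local Notation letter := ('I_n.+1 * 'I_n.+1)%type.

Definition dynkin_word (x y : 'rV[S]_n) (p : seq letter) :=
  flatten [seq nseq q.1 x ++ nseq q.2 y | q : letter <- p].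
Definition dynkin_len (p : seq letter) := (\sum_(q <- p) (q.1 + q.2))%N.
Definition dynkin_fact (p : seq letter) := (\prod_(q <- p) (q.1`! * q.2`!))%N.
Definition dynkin_ok (p : seq letter) := all (fun q : letter => 0 < q.1 + q.2)%N p.

(* The Dynkin series of 'X *: x and 'X *: y. *)
Definition dynkin (x y : 'rV[S]_n) : 'rV[{poly S}]_n :=
  \sum_(1 <= k < n.+1) ((-1) ^+ k.-1 / k%:R)%:P *:
    \sum_(p : k.-tuple letter | dynkin_ok p)
      ('X^(dynkin_len p) * (((dynkin_len p)%:R * (dynkin_fact p)%:R)^-1)%:P) *:
         cM (nest (dynkin_word x y p)).

Hypothesis hC : nil_lie C.
Local Notation Cp := (lift_str (@polyC S) C).
Let hCp : nil_lie Cp. Proof. exact: nil_lie_lift. Qed.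
Let pnatU := poly_natU natU.

Lemma nest_cat a s w : w != [::] -> nest (nseq s a ++ w) = nest w *m ad C a ^+ s.
Proof.
move=> w0; elim: s => [|s IH] /=; first by rewrite mulmx1.
rewrite mulSX mulmxA -IH; case: {IH}s => [|s] //=.
by case: w w0.
Qed.

Definition expmt (A : 'M[S]_n) := egf n.+1 (fun k => A ^+ k).

Lemma expmtE (A : 'M[S]_n) : expm ('X *: cM A) = expmt A.
Proof.
apply: eq_bigr => k _; rewrite mulrC -polyC_natr -polyCV -scalerA; congr (_ *: _).
elim: (k : nat) => [|j IH]; first by rewrite !expr0 scale1r /cM map_mx1.
by rewrite !exprS IH -!mulmxE /cM map_mxM -scalemxAl -scalemxAr scalerA.
Qed.

Lemma dM_expmt x : dM (expmt (ad C x)) = expmt (ad C x) *m cM (ad C x).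
Proof.
rewrite /expmt egf_deriv ?(ad_expn_eq0 hC) //.
by rewrite -egf_mulr; apply: eq_egf => k; rewrite mulSX.
Qed.

Section XY.
Variables x y : 'rV[S]_n.
Local Notation X := (ad C x).
Local Notation Y := (ad C y).
Local Notation eX := (expmt X).
Local Notation eY := (expmt Y).
Let W := eY *m eX.

Let mono (p : seq letter) : 'rV[{poly S}]_n :=
  ('X^((dynkin_len p).-1) * ((dynkin_fact p)%:R^-1)%:P) *: cM (nest (dynkin_word x y p)).
Let term k : 'rV[{poly S}]_n := \sum_(p : k.-tuple letter | dynkin_ok p) mono p.

Lemma dynkin_len_gt0 p : dynkin_ok p -> p != [::] -> (0 < dynkin_len p)%N.
Proof. by case: p => //= q p /andP[q0 _] _; rewrite /dynkin_len big_cons ltn_addr. Qed.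

Lemma dynkin_word_neq0 p : dynkin_ok p -> p != [::] -> dynkin_word x y p != [::].
Proof.
case: p => //= -[r s] p /andP[/= q0 _] _; rewrite /dynkin_word /= -size_eq0 !size_cat !size_nseq.
by rewrite -lt0n ltn_addr.
Qed.

Lemma dynkin_factU p : (dynkin_fact p)%:R \is a @GRing.unit S.
Proof.
elim: p => [|q p IH]; first by rewrite /dynkin_fact big_nil unitr1.
by rewrite /dynkin_fact big_cons natrM unitrM IH natrM unitrM !factU.
Qed.

(** Differentiating ['X^(dynkin_len p)] cancels the denominator [dynkin_len p], the only part of a
    coefficient that does not factor over the blocks of [p]. After that the sum over [p] can be
    built block by block. *)
Let dM_dynkin_term :
  dM (dynkin x y) = \sum_(1 <= k < n.+1) ((-1) ^+ k.-1 / k%:R)%:P *: term k.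
Proof.
rewrite /dynkin dM_sum !big_nat; apply: eq_bigr => k /andP[k1 _].
rewrite dMZ derivC scale0r add0r dM_sum; congr (_ *: _); apply: eq_bigr => p ok.
rewrite dMZ dMC scaler0 addr0 derivM derivC mulr0 addr0 derivXn /mono.
have : (0 < dynkin_len p)%N.
  by apply: dynkin_len_gt0; rewrite // -size_eq0 size_tuple -lt0n.
case: (dynkin_len p) => // l _ /=; congr (_ *: _); rewrite -mulr_natr -mulrA; congr (_ * _).
rewrite -polyC_natr -polyCM; congr (_%:P).
by rewrite invrM ?natU ?dynkin_factU // mulrCA mulrV ?mulr1.
Qed.

Let big_tupleS (k : nat) (P : pred (seq letter)) (F : seq letter -> 'rV[{poly S}]_n) :
  \sum_(p : k.+1.-tuple letter | P p) F p =
  \sum_(q : letter) \sum_(p : k.-tuple letter | P (q :: p)) F (q :: p).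
Proof.
rewrite pair_big_dep /= (reindex (fun qp : letter * k.-tuple letter => cons_tuple qp.1 qp.2)) //=.
exists (fun t : k.+1.-tuple letter => (thead t, behead_tuple t)) => [[q p] _|t _] /=.
  by rewrite theadE; congr (_, _); apply: val_inj.
by case/tupleP: t => q p; apply: val_inj; rewrite /= theadE.
Qed.

Let blk (q : letter) : 'M[{poly S}]_n :=
  ('X^(q.1 + q.2) * (((q.1`! * q.2`!)%N)%:R^-1)%:P) *: cM (Y ^+ q.2 *m X ^+ q.1).

Let W_blk : W - 1%:M = \sum_(q : letter | (0 < q.1 + q.2)%N) blk q.
Proof.
apply/eqP; rewrite subr_eq; apply/eqP.
transitivity (\sum_q blk q).
  rewrite -(pair_bigA _ (fun r s => blk (r, s))) exchange_big /=.
  rewrite /W /expmt /egf mulmx_suml; apply: eq_bigr => s _.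
  rewrite mulmx_sumr; apply: eq_bigr => r _.
  rewrite -scalemxAl -scalemxAr scalerA /blk /= /cM map_mxM; congr (_ *: _).
  rewrite natrM invrM ?factU // polyCM addnC exprD.
  by rewrite -!mulrA; congr (_ * _); rewrite mulrCA.
rewrite (bigD1 (ord0, ord0)) //= addrC; congr (_ + _).
  apply: eq_bigl => -[r s] /=; rewrite -[_ != _]negbK lt0n addn_eq0.
  by rewrite -[_ == _]/((r == 0 :> nat) && (s == 0 :> nat)) negbK.
by rewrite /blk /= !expr0 mul1r !fact0 muln1 invr1 scale1r mulmx1 /cM map_mx1.
Qed.

Let nest_nseq a k : nest (nseq k.+1 a) = a *m ad C a ^+ k.
Proof.
have -> : nseq k.+1 a = nseq k a ++ [:: a] by elim: k => //= k ->.
by rewrite nest_cat.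
Qed.

Let ad_alt_exp (a : 'rV[S]_n) k : a *m ad C a ^+ k.+1 = 0.
Proof. by rewrite exprS -mulmxE mulmxA ad_alt // mul0mx. Qed.

Let term1 : term 1 = cM x + cM y *m eX.
Proof.
have [n0|n0] := posnP n.
  by apply/matrixP => i [j jn]; exfalso; rewrite n0 in jn.
(* A nested bracket whose two innermost letters coincide vanishes, so a single block x^r y^s
   survives only if [s = 0] and [r = 1], or if [s = 1]. *)
pose F (r s : nat) : 'rV[{poly S}]_n :=
  (if s == 0%N then if r == 1%N then cM x else 0 else 0) +
  (if s == 1%N then ('X^r * (r`!%:R^-1)%:P) *: cM (y *m X ^+ r) else 0).
have FE r s : (0 < r + s)%N -> ('X^((r + s).-1) * ((r`! * s`!)%N%:R^-1)%:P) *: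
    cM (nest (nseq r x ++ nseq s y)) = F r s.
  rewrite /F; case: s => [|s].
    case: r => // r _; rewrite cats0 nest_nseq muln1 addn0 addr0.
    case: r => [|r]; first by rewrite !expr0 mulmx1 mul1r invr1 scale1r.
    by rewrite ad_alt_exp /cM map_mx0 scaler0.
  rewrite nest_cat // nest_nseq add0r => _.
  case: s => [|s]; first by rewrite addn1 muln1 !expr0 mulmx1.
  by rewrite ad_alt_exp mul0mx /cM map_mx0 scaler0.
rewrite /term (big_tupleS 0 dynkin_ok mono).
transitivity (\sum_(q : letter) F q.1 q.2).
  apply: eq_bigr => q _; rewrite big_mkcond (big_pred1 [tuple]); last first.
    by move=> t; apply/esym/eqP; apply: val_inj => /=; apply/size0nil; rewrite size_tuple.
  rewrite /dynkin_ok /= andbT; case: ltnP => [q0|].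
    by rewrite -FE // /mono /dynkin_word /dynkin_len /dynkin_fact /= !big_seq1 cats0.
  rewrite leqn0 addn_eq0 => /andP[/eqP q1 /eqP q2].
  by rewrite /F q1 q2 /= addr0.
rewrite -(pair_bigA _ (fun r s : 'I_n.+1 => F r s)) /= /F; under eq_bigr do rewrite big_split /=.
have n1 : (1 < n.+1)%N by [].
rewrite big_split /=; congr (_ + _).
  rewrite (bigD1 (Ordinal n1)) //= (bigD1 ord0) //= !big1 ?addr0 // => [r r1|s s0].
    apply: big1 => s _; case: eqP => // _; case: eqP => // r1'.
    by case/eqP: r1; apply: val_inj.
  by case: eqP => // s0'; case/eqP: s0; apply: val_inj.
rewrite -egf_mull; apply: eq_bigr => r _.
rewrite (bigD1 (Ordinal n1)) //= big1 ?addr0 // => s s1.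
by case: eqP => // s1'; case/eqP: s1; apply: val_inj.
Qed.

(** A block put in front of a nonempty word multiplies its nested bracket by [Y ^+ s *m X ^+ r];
    summed over all blocks with their coefficients this is [W - 1%:M]. *)
Let termS k : (0 < k)%N -> term k.+1 = term k *m (W - 1%:M).
Proof.
move=> k0; rewrite /term (big_tupleS k dynkin_ok mono) W_blk mulmx_sumr [RHS]big_mkcond /=.
apply: eq_bigr => q _; case: ifPn => [q0|/negPf q0]; last first.
  by rewrite big_pred0 // => p; rewrite /dynkin_ok /= q0.
rewrite mulmx_suml; apply: eq_big => [p|p /andP[_ ok]]; first by rewrite /dynkin_ok /= ?q0.
have p0 : (p : seq letter) != [::].
  by rewrite -size_eq0 size_tuple -lt0n.
rewrite /mono -scalemxAl -scalemxAr scalerA -[cM _ *m _]map_mxM.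
have := dynkin_len_gt0 ok p0; rewrite /dynkin_len big_cons -/(dynkin_len p).
case: (dynkin_len p) => // l _; rewrite addnS /=.
have -> : nest (dynkin_word x y (q :: p)) = nest (dynkin_word x y p) *m (Y ^+ q.2 *m X ^+ q.1).
  rewrite /dynkin_word /= -catA !nest_cat ?dynkin_word_neq0 ?mulmxA //.
  by have := dynkin_word_neq0 ok p0; rewrite -!size_eq0 !size_cat => w; rewrite addn_eq0 negb_and w orbT.
congr (_ *: _); rewrite /dynkin_fact big_cons natrM invrM ?dynkin_factU //; last first.
  by rewrite natrM unitrM !factU.
by rewrite polyCM addnC exprD; ring.
Qed.

(** The terms form a geometric progression of ratio [W - 1%:M], and Dynkin's outer coefficients sum
    it to [psim W]. *)
Lemma dM_dynkin : dM (dynkin x y) = (cM x + cM y *m eX) *m psim W.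
Proof.
have tE k : term k.+1 = (cM x + cM y *m eX) *m (W - 1%:M) ^+ k.
  elim: k => [|k IH]; first by rewrite term1 expr0 mulmx1.
  by rewrite termS // IH exprSr -mulmxE mulmxA.
rewrite dM_dynkin_term big_add1 /= big_mkord /psim mulmx_sumr; apply: eq_bigr => k _.
rewrite tE -scalemxAr; congr (_ *: _).
by rewrite polyCM polyC_exp polyCN -polyCV polyC_natr.
Qed.

End XY.
End Dynkin.

(** * The exponential of Dynkin's series and its left invariance *)

Section BCH.
Variables (S : idomainType) (n : nat).
Hypothesis natU : forall k, k.+1%:R \is a @GRing.unit S.
Variable C : 'I_n -> 'M[S]_n.
Hypothesis hC : nil_lie C.
Local Notation Cp := (lift_str (@polyC S) C).
Local Notation adp := (ad Cp).
Let hCp : nil_lie Cp. Proof. exact: nil_lie_lift. Qed.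
Let pnatU := poly_natU natU.

Lemma lowM_ad k p : lowM k p -> lowM k (adp p).
Proof.
move=> h; apply: lowM_sum => i _ a b; rewrite mxE; apply: lowMl; exact: h.
Qed.

Lemma expmt_low (A : 'M[S]_n) : lowM 1 (expmt A - 1%:M).
Proof.
have -> : 1%:M = egf n.+1 (fun k => if k is 0%N then 1%:M else 0 : 'M[S]_n).
  by rewrite egf_delta /cM map_mx1.
rewrite (_ : _ - _ = egf n.+1 (fun k => if k is 0%N then 0 else A ^+ k)); first exact: egf_low.
apply/eqP; rewrite subr_eq -egfD; apply/eqP; apply: eq_egf => -[|k].
  by rewrite add0r expr0.
by rewrite addr0.
Qed.

Lemma expm_low (A : 'M[{poly S}]_n) : lowM 1 A -> lowM 1 (expm A - 1%:M).
Proof.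
move=> h; rewrite /expm big_ord_recl /= fact0 invr1 scale1r expr0 addrAC subrr add0r.
apply: lowM_sum => i _; apply: lowMZ; rewrite /bump exprS -mulmxE.
exact: lowM_mull.
Qed.

Lemma derivation_deriv : derivation Cp (@deriv S).
Proof.
split; [exact: derivD | exact: derivM | by move=> i a b; rewrite !mxE derivC].
Qed.

(** exp (ad x) is an automorphism of the bracket, hence conjugates [ad C v] into ad of the image of
    [v]. *)
Lemma expmt_ad x v :
  expmt (ad C x) *m adp (cM v *m expmt (ad C x)) = cM (ad C v) *m expmt (ad C x).
Proof.
set eX := expmt _; set w := _ *m eX.
apply/eqP; rewrite -subr_eq0; apply/eqP; apply: (formal_ode_uniq natU).
  have -> : eX *m adp w - cM (ad C v) *m eX =
     (eX - 1%:M) *m adp w + adp (cM v *m (eX - 1%:M)) - cM (ad C v) *m (eX - 1%:M).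
    have -> : adp (cM v *m (eX - 1%:M)) = adp w - cM (ad C v).
      by rewrite mulmxBr mulmx1 [LHS]linearB /= cM_ad.
    rewrite mulmxBl mul1mx mulmxBr mulmx1.
    suff gen (a b c d : 'M[{poly S}]_n) : a - b = a - c + (c - d) - (b - d) by exact: gen.
    by apply/matrixP => i j; rewrite !mxE; ring.
  have low1 := expmt_low (ad C x).
  apply: lowMD; first apply: lowMD; first exact: lowM_mull.
    by apply: lowM_ad; apply: lowM_mulr.
  by apply: lowMN; apply: lowM_mulr.
have dw : dM w = w *m cM (ad C x) by rewrite /w dMM dMC mul0mx add0r dM_expmt // mulmxA.
move=> k lk; rewrite dMB !dMM dMC mul0mx add0r dad dw dM_expmt // -/eX.
rewrite [w *m cM _](congr1 (mulmx w) (cM_ad _ _)) (ad_bracket hCp) -cM_ad.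
rewrite (_ : _ - _ = (eX *m adp w - cM (ad C v) *m eX) *m cM (ad C x)); first exact: lowM_mull.
rewrite mulmxBl mulmxBr !mulmxA.
suff gen (a b c : 'M[{poly S}]_n) : a + (b - a) - c = b - c by exact: gen.
by rewrite [a + _]addrC subrK.
Qed.

Section Curve.
Variables x y : 'rV[S]_n.
Local Notation X := (ad C x).
Local Notation Y := (ad C y).
Local Notation eX := (expmt X).
Local Notation eY := (expmt Y).
Let W := eY *m eX.
Local Notation z := (dynkin C x y).
Let Z := expm (adp z).
Let a0 := cM x + cM y *m eX.

Lemma dynkin_low : lowM 1 z.
Proof.
apply: lowM_sum => k _ ; apply: lowMZ; apply: lowM_sum => p ok.
have [->|p0] := eqVneq (p : seq _) [::].
  by rewrite /dynkin_word /= /cM map_mx0 scaler0 => i j l _; rewrite mxE coef0.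
move=> i j; rewrite mxE -mulrA => -[|//] _; rewrite coefXnM.
by rewrite (dynkin_len_gt0 ok p0).
Qed.

Let dW : dM W = W *m adp a0.
Proof.
rewrite /W dMM !dM_expmt // /a0 linearD /= mulmxDr addrC -cM_ad mulmxA; congr (_ + _).
by rewrite -!mulmxA; congr (_ *m _); rewrite expmt_ad.
Qed.

Let lowW : lowM 1 (W - 1%:M).
Proof.
rewrite (_ : _ - _ = (eY - 1%:M) *m eX + (eX - 1%:M)).
  by apply: lowMD; [apply: lowM_mull|]; apply: expmt_low.
by rewrite mulmxBl mul1mx addrA subrK.
Qed.

Let lowM_expB k (A B : 'M[{poly S}]_n) j : lowM k (A - B) -> lowM k (A ^+ j - B ^+ j).
Proof.
move=> h; elim: j => [|j IH]; first by rewrite !expr0 subrr => a b l _; rewrite mxE coef0.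
rewrite (_ : _ - _ = (A - B) *m A ^+ j + B *m (A ^+ j - B ^+ j)).
  by apply: lowMD; [apply: lowM_mull | apply: lowM_mulr].
by rewrite !exprS -!mulmxE mulmxBl mulmxBr addrA subrK.
Qed.

(** Here W' = W ad a0, while Z' = Z ad (z' phim (ad z)) with z' = a0 psim W. If psim were taken at
    [Z], then [psim_phim] would give the equation of [W]. The error [psim W - psim Z] vanishes to
    the order of [Z - W], which [formal_ode_uniq] accepts although the equation is not linear. *)
Lemma expm_dynkin : Z = W.
Proof.
apply/eqP; rewrite -subr_eq0; apply/eqP; apply: (formal_ode_uniq natU).
  rewrite (_ : Z - W = (Z - 1%:M) - (W - 1%:M)); last by rewrite opprB addrA subrK.
  by apply: lowMD; [apply: expm_low; apply: lowM_ad; apply: dynkin_low | apply: lowMN; exact: lowW].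
have dZ : dM Z = Z *m adp (dM z *m phim (adp z)).
  exact: (mxder_expm pnatU hCp derivation_deriv).
move=> k lk; rewrite dMB dW dZ dM_dynkin // -/W -/a0.
have nz : (adp z) ^+ n = 0 by apply: ad_expn_eq0.
rewrite (_ : _ - _ = Z *m adp (a0 *m ((psim W - psim Z) *m phim (adp z))) + (Z - W) *m adp a0).
  apply: lowMD; last exact: lowM_mull.
  apply: lowM_mulr; apply: lowM_ad; apply: lowM_mulr; apply: lowM_mull.
  rewrite -sumrB; apply: lowM_sum => i _; rewrite -scalerBr; apply: lowMZ.
  apply: lowM_expB; rewrite opprB addrA subrK -opprB; exact: lowMN.
rewrite mulmxBl psim_phim // mulmxBr mulmx1 [adp (_ - _)]linearB /= mulmxBr mulmxBl.
by rewrite addrA subrK mulmxA.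
Qed.

Let nilX (u : 'rV[S]_n) : ('X *: cM (ad C u)) ^+ n = 0.
Proof.
have -> : 'X *: cM (ad C u) = adp ('X *: cM u) by rewrite linearZ /= cM_ad.
exact: ad_expn_eq0.
Qed.

Let expmtN u : expmt (ad C u) *m expmt (- ad C u) = 1%:M.
Proof. by rewrite -!expmtE /cM map_mxN -/(cM _) scalerN expmN //; exact: nilX. Qed.

Lemma expmt_fix u : cM u *m expmt (- ad C u) = cM u.
Proof.
rewrite -egf_mull -(egf_delta n u); apply: eq_egf => -[|k]; first by rewrite expr0 mulmx1.
by rewrite exprS -mulmxE mulmxA mulmxN ad_alt // oppr0 mul0mx.
Qed.

(** The left form of the curve exp (s x) exp (s y) is Ad (exp (- s y)) x + y. Since psim W inverts
    phim (ad z) and phim (- ad z) exp (ad z) = phim (ad z), the factor [psim W *m phim (- adp z)] is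
    the inverse of [W]. *)
Lemma dynkin_left_form : dM z *m phim (- adp z) = cM x *m expmt (- Y) + cM y.
Proof.
have nz : (adp z) ^+ n = 0 by apply: ad_expn_eq0.
have WV : W *m (expmt (- X) *m expmt (- Y)) = 1%:M.
  by rewrite /W mulmxA -[_ *m eX *m _]mulmxA expmtN mulmx1 expmtN.
have pW : psim W *m phim (- adp z) *m W = 1%:M.
  by rewrite -mulmxA -[in phim _ *m _]expm_dynkin expm_phimN // -expm_dynkin psim_phim.
have pV : psim W *m phim (- adp z) = expmt (- X) *m expmt (- Y).
  by rewrite -[LHS]mulmx1 -WV [LHS]mulmxA pW mul1mx.
rewrite dM_dynkin // -/W -mulmxA pV.
rewrite mulmxDl !mulmxA expmt_fix; congr (_ + _).
by rewrite -[_ *m eX *m _]mulmxA expmtN mulmx1 expmt_fix.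
Qed.

End Curve.

Lemma dynkinN x : dynkin C (- x) x = 0.
Proof.
apply: (formal_ode_uniq natU); first exact: dynkin_low.
move=> k _; rewrite dM_dynkin // linearN /= expmt_fix //.
rewrite {1}/cM map_mxN -/(cM x) addNr mul0mx => i j l _.
by rewrite mxE coef0.
Qed.

Section Invariance.
Variable dS : S -> S.
Hypothesis hdS : derivation C dS.
Let dS0 : dS 0 = 0.
Proof. by case: hdS => h _ _; have := h 0 0; rewrite addr0 => /eqP; rewrite -subr_eq subrr => /eqP. Qed.
Let dE := map_poly dS.
Let dEcoef p i : (dE p)`_i = dS p`_i. Proof. exact: coef_map_id0. Qed.

Let hdE : derivation Cp dE.
Proof.
have [dD dMu dC] := hdS; split => [p q|p q|i a b].
- by apply/polyP => i; rewrite !(coefD, dEcoef).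
- apply/polyP => i; rewrite coefD dEcoef !coefM (big_morph dS dD dS0) -big_split /=.
  by apply: eq_bigr => j _; rewrite dMu !dEcoef.
- by apply/polyP => j; rewrite dEcoef !mxE coefC coef0; case: eqP => // _; rewrite dC.
Qed.

Let dE_deriv p : dE p^`() = (dE p)^`().
Proof.
have [dD _ _] := hdS.
have dn a k : dS (a *+ k) = dS a *+ k by elim: k => [|k IH]; rewrite ?mulr0n // !mulrS dD IH.
by apply/polyP => i; rewrite !(coef_deriv, dEcoef) dn.
Qed.

Let dEC m k (v : 'M[S]_(m, k)) : map_mx dE (cM v) = cM (map_mx dS v).
Proof.
by apply/matrixP => i j; rewrite !mxE; apply/polyP => l; rewrite dEcoef !coefC; case: eqP.
Qed.

Let dEX (v : 'rV[S]_n) : map_mx dE ('X *: cM v) = 'X *: cM (map_mx dS v).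
Proof.
apply/matrixP => i j; rewrite !mxE; apply/polyP => l; rewrite dEcoef !coefXM.
by case: eqP => // _; rewrite !coefC; case: eqP.
Qed.

Let dE_low k m p (v : 'M[{poly S}]_(m, p)) : lowM k v -> lowM k (map_mx dE v).
Proof. by move=> h i j l lk; rewrite mxE dEcoef h. Qed.

(* By the Maurer-Cartan equation for the derivations dS and d/d'X both sides solve
   the same linear equation in 'X. *)
Lemma dynkin_invariant x y : map_mx dS x = 0 ->
  map_mx dE (dynkin C x y) *m phim (- adp (dynkin C x y)) =
  ('X *: cM (map_mx dS y)) *m phim (- adp ('X *: cM y)).
Proof.
move=> dx; set z := dynkin C x y; set u := map_mx dS y; set ty := 'X *: cM y.
set b := LHS; set b0 := RHS; set x' := cM x *m expmt (- ad C y).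
have mc w := maurer_cartan_left pnatU hCp w hdE derivation_deriv dE_deriv.
have ab : dM z *m phim (- adp z) = x' + cM y by apply: dynkin_left_form.
have dty : dM ty = cM y by rewrite /ty dMZ derivX dMC scaler0 addr0 scale1r.
have ab0 : dM ty *m phim (- adp ty) = cM y.
  rewrite dty /phim mulmx_sumr.
  have y0 : cM y *m - adp ty = 0.
    by rewrite /ty linearZ /= mulmxN -scalemxAr -cM_ad -map_mxM ad_alt // map_mx0 scaler0 oppr0.
  have [n0|n0] := posnP n; first by apply/matrixP => i [j jn]; exfalso; rewrite n0 in jn.
  rewrite (bigD1 (Ordinal n0)) //= expr0 invr1 scale1r mulmx1 big1 ?addr0 // => i i0.
  rewrite -scalemxAr (_ : nat_of_ord i = i.-1.+1); last by rewrite prednK // lt0n.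
  by rewrite exprS -mulmxE mulmxA y0 mul0mx scaler0.
have mcz : dM b = map_mx dE (x' + cM y) - b *m adp (x' + cM y).
  have := mc z; rewrite /= -/b -![map_mx deriv _]/(dM _) ab => h.
  by rewrite [b *m _](ad_skew hCp) -h opprB addrC subrK.
have mcy : dM b0 = cM u - b0 *m cM (ad C y).
  have := mc ty; rewrite /= -![map_mx deriv _]/(dM _) ab0 dEX -/u -/b0 dEC -/u => h.
  by rewrite cM_ad [b0 *m _](ad_skew hCp) -h opprB addrC subrK.
(* As [x] is constant for [dS], [x'] varies only through Ad (exp (- y)). The resulting term makes
   [mcz] and [mcy] subtract to an equation homogeneous in [b - b0]. *)
have dx' : map_mx dE x' = b0 *m adp x'.
  rewrite /x' (mxderM hdE) dEC dx /cM map_mx0 mul0mx add0r -/(cM _).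
  have -> : expmt (- ad C y) = expm (adp (- ty)).
    by rewrite -expmtE linearN linearZ /= -cM_ad /cM map_mxN scalerN.
  rewrite (mxder_expm pnatU hCp hdE) (mxderN hdE) dEX -/u !linearN /= mulNmx.
  by rewrite -/b0 linearN /= mulmxA mulmxN (ad_skew hCp b0) opprK.
apply/eqP; rewrite -subr_eq0; apply/eqP; apply: (formal_ode_uniq natU).
  apply: lowMD; first by apply: lowM_mull; apply: dE_low; apply: dynkin_low.
  apply: lowMN; apply: lowM_mull => i j; rewrite mxE; apply: lowMl.
  by move=> [|//] _; rewrite coefX.
move=> k lk; rewrite dMB mcz mcy (mxderD hdE) dEC -/u dx' [adp (x' + _)]linearD mulmxDr cM_ad.
rewrite (_ : _ - _ = - ((b - b0) *m adp x' + (b - b0) *m adp (cM y))).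
  by apply: lowMN; apply: lowMD; apply: lowM_mull.
rewrite !mulmxBl.
suff gen (a1 a2 a3 a4 a5 : 'rV[{poly S}]_n) :
    a3 + a5 - (a1 + a2) - (a5 - a4) = - (a1 - a3 + (a2 - a4)) by exact: gen.
by apply/matrixP => i j; rewrite !mxE; ring.
Qed.

End Invariance.
End BCH.

(** * Polynomial functions on R^n *)

Section PolynomialFunctions.
Variables (R : realType) (n : nat).
Local Notation V := 'rV[R]_n.

(** All invariant objects are polynomial in the exponential chart. An inductive class closed under
    directional derivatives yields smoothness and the symmetry of second derivatives by
    induction. *)
Inductive polyfun : (V -> R) -> Prop :=
| polyfun_cst c : polyfun (fun _ => c)
| polyfun_coord k : polyfun (fun x => x 0 k)
| polyfunD f g : polyfun f -> polyfun g -> polyfun (fun x => f x + g x)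
| polyfunM f g : polyfun f -> polyfun g -> polyfun (fun x => f x * g x).

Lemma polyfun_differentiable f x : polyfun f -> differentiable f x.
Proof.
elim => {f} [c|k|f g _ df _ dg|f g _ df _ dg].
- exact: differentiable_cst.
- exact: differentiable_coord.
- exact: (differentiableD df dg).
- exact: (differentiableM df dg).
Qed.

Lemma polyfun_derivable f x v : polyfun f -> derivable f x v.
Proof. by move=> pf; apply/diff_derivable/polyfun_differentiable. Qed.

Lemma polyfun_deriveD f g x v : polyfun f -> polyfun g ->
  'D_v (fun x => f x + g x) x = 'D_v f x + 'D_v g x.
Proof. by move=> pf pg; rewrite -deriveD //; apply: polyfun_derivable. Qed.

Lemma polyfun_deriveM f g x v : polyfun f -> polyfun g ->
  'D_v (fun x => f x * g x) x = 'D_v f x * g x + f x * 'D_v g x.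
Proof.
move=> pf pg; rewrite [RHS]addrC [_ * g x]mulrC.
by rewrite -[RHS]deriveM //; apply: polyfun_derivable.
Qed.

Lemma derive_coord x (v : V) k : 'D_v (fun x : V => x 0 k : R) x = v 0 k.
Proof.
have dx : derivable (@id V) x v by exact: derivable_id.
have := congr1 (fun M : V => M 0 k) (derive_mx dx).
by rewrite derive_id mxE => ->.
Qed.

Lemma polyfun_derive f v : polyfun f -> polyfun (fun x => 'D_v f x).
Proof.
elim => {f} [c|k|f g pf dpf pg dpg|f g pf dpf pg dpg].
- by under eq_fun do rewrite derive_cst; apply: polyfun_cst.
- by under eq_fun do rewrite derive_coord; apply: polyfun_cst.
- by under eq_fun do rewrite polyfun_deriveD //; apply: polyfunD.
- by under eq_fun do rewrite polyfun_deriveM //; apply: polyfunD; apply: polyfunM.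
Qed.

Lemma polyfun_smooth f : polyfun f -> smooth f.
Proof.
move=> pf s; have ps : polyfun (iter_partial s f).
  by elim: s => //= i s IH; apply: polyfun_derive.
split=> [x|i x]; last exact: polyfun_derivable.
by apply: differentiable_continuous; apply: polyfun_differentiable.
Qed.

Lemma polyfun_sum (I : Type) (r : seq I) (P : pred I) (F : I -> V -> R) :
  (forall i, polyfun (F i)) -> polyfun (fun x => \sum_(i <- r | P i) F i x).
Proof.
move=> pF; elim: r => [|i r IH].
  by under eq_fun do rewrite big_nil; apply: polyfun_cst.
under eq_fun do rewrite big_cons.
by case: (P i) => //; apply: polyfunD.
Qed.

Lemma polyfun_derive_sum (I : Type) (r : seq I) (F : I -> V -> R) x v :
  (forall i, polyfun (F i)) ->
  'D_v (fun x => \sum_(i <- r) F i x) x = \sum_(i <- r) 'D_v (F i) x.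
Proof.
move=> pF; elim: r => [|i r IH].
  by under eq_fun do rewrite big_nil; rewrite big_nil derive_cst.
under eq_fun do rewrite big_cons.
by rewrite big_cons -IH -polyfun_deriveD //; apply: polyfun_sum.
Qed.

Definition polymx m p (M : V -> 'M[R]_(m, p)) := forall i j, polyfun (fun x => M x i j).

Lemma polymx_cst m p (A : 'M[R]_(m, p)) : polymx (fun _ => A).
Proof. by move=> i j; apply: polyfun_cst. Qed.

Lemma polymx_id : polymx (fun x : V => x).
Proof. by move=> i j; rewrite (_ : i = 0) ?ord1 //; apply: polyfun_coord. Qed.

Lemma polymxD m p (M N : V -> 'M[R]_(m, p)) : polymx M -> polymx N -> polymx (fun x => M x + N x).
Proof. by move=> pM pN i j; under eq_fun do rewrite mxE; apply: polyfunD. Qed.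

Lemma polymxZ m p f (N : V -> 'M[R]_(m, p)) : polyfun f -> polymx N -> polymx (fun x => f x *: N x).
Proof. by move=> pM pN i j; under eq_fun do rewrite mxE; apply: polyfunM. Qed.

Lemma polymxN m p (N : V -> 'M[R]_(m, p)) : polymx N -> polymx (fun x => - N x).
Proof.
move=> pN; under eq_fun do rewrite -scaleN1r.
by apply: polymxZ => //; apply: polyfun_cst.
Qed.

Lemma polymxM m p q (M : V -> 'M[R]_(m, p)) (N : V -> 'M[R]_(p, q)) :
  polymx M -> polymx N -> polymx (fun x => M x *m N x).
Proof.
move=> pM pN i j; under eq_fun do rewrite mxE.
by apply: polyfun_sum => k; apply: polyfunM.
Qed.

Lemma polymxT m p (M : V -> 'M[R]_(m, p)) : polymx M -> polymx (fun x => (M x)^T).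
Proof. by move=> pM i j; under eq_fun do rewrite mxE. Qed.

Lemma polymx_sum m p (I : Type) (r : seq I) (P : pred I) (F : I -> V -> 'M[R]_(m, p)) :
  (forall i, polymx (F i)) -> polymx (fun x => \sum_(i <- r | P i) F i x).
Proof.
by move=> pF i j; under eq_fun do rewrite summxE; apply: polyfun_sum => k; apply: pF.
Qed.

Lemma polymxX (M : V -> 'M[R]_n) k : polymx M -> polymx (fun x => M x ^+ k).
Proof.
move=> pM; elim: k => [|k IH]; first exact: polymx_cst.
by under eq_fun do rewrite exprS; apply: polymxM.
Qed.

Lemma polymx_derivable m p (M : V -> 'M[R]_(m, p)) x v : polymx M -> derivable M x v.
Proof. by move=> pM; apply/derivable_mxP => i j; apply: polyfun_derivable. Qed.

Lemma polymx_derive m p (M : V -> 'M[R]_(m, p)) x v i j : polymx M ->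
  ('D_v M x) i j = 'D_v (fun x => M x i j) x.
Proof. by move=> pM; rewrite derive_mx ?mxE //; apply: polymx_derivable. Qed.

Lemma polymx_deriveM m p q (M : V -> 'M[R]_(m, p)) (N : V -> 'M[R]_(p, q)) x v :
  polymx M -> polymx N ->
  'D_v (fun x => M x *m N x) x = 'D_v M x *m N x + M x *m 'D_v N x.
Proof.
move=> pM pN; apply/matrixP => i j; rewrite polymx_derive; last exact: polymxM.
rewrite !mxE -big_split /=.
transitivity (\sum_k 'D_v (fun x => M x i k * N x k j) x).
  by under eq_fun do rewrite mxE; rewrite polyfun_derive_sum // => k; apply: polyfunM.
by apply: eq_bigr => k _; rewrite polyfun_deriveM // !polymx_derive.
Qed.

Lemma polymx_derive_exp (M : V -> 'M[R]_n) x v k : polymx M ->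
  'D_v (fun x => M x ^+ k) x = dpow (M x) ('D_v M x) k.
Proof.
move=> pM; elim: k => [|k IH] /=; first exact: derive_cst.
under eq_fun do rewrite exprSr.
rewrite (@polymx_deriveM _ _ _ (fun x => M x ^+ k) M) ?IH //.
exact: polymxX.
Qed.

Lemma polymx_derivable_comb m p (c : nat -> R) K (F : nat -> V -> 'M[R]_(m, p)) x v :
  (forall k, polymx (F k)) ->
  'D_v (fun x => \sum_(k < K) c k *: F k x) x = \sum_(k < K) c k *: 'D_v (F k) x.
Proof.
move=> pF; elim: K => [|K IH].
  rewrite big_ord0 (_ : (fun x => _) = fun=> 0) ?derive_cst //.
  by apply/funext => z; rewrite big_ord0.
rewrite big_ord_recr /= -IH -deriveZ; last exact: polymx_derivable.
rewrite -deriveD.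
- by congr ('D_v _ x); apply/funext => z; rewrite big_ord_recr.
- apply: polymx_derivable; apply: polymx_sum => k.
  by apply: polymxZ => //; apply: polyfun_cst.
- by apply: derivableZ; apply: polymx_derivable.
Qed.

Lemma polymx_differentiable m (M : V -> 'rV[R]_m) x : polymx M -> differentiable M x.
Proof.
move=> pM; have -> : M = \sum_j (fun y => M y 0 j *: delta_mx 0 j).
  by apply/funext => y; rewrite [LHS]row_sum_delta fct_sumE.
apply: differentiable_sum => j; apply: differentiableZl.
exact: polyfun_differentiable.
Qed.

End PolynomialFunctions.

(** * The Baker-Campbell-Hausdorff product in coordinates *)

Section StructureOfBracket.
Variables (R : realType) (n : nat).
Local Notation V := 'rV[R]_n.
Variable mu : {bilinear V -> V -> V}.

Definition str : 'I_n -> 'M[R]_n := fun i => \matrix_(j, k) mu (delta_mx 0 i) (delta_mx 0 j) 0 k.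

Lemma row_str i j : row j (str i) = mu (delta_mx 0 i) (delta_mx 0 j).
Proof. by apply/rowP => k; rewrite !mxE. Qed.

Lemma muE u v : mu u v = v *m ad str u.
Proof.
rewrite mul_ad {1}(row_sum_delta u) linear_sumlz; apply: eq_bigr => i _.
rewrite linearZl_LR /= {1}(row_sum_delta v) linear_sumr /= scaler_sumr; apply: eq_bigr => j _.
by rewrite linearZ_LR /= scalerA row_str.
Qed.

Fixpoint lcs_mx (k : nat) : 'M[R]_n :=
  if k is k'.+1 then (\sum_i <<lcs_mx k' *m str i>>)%MS else 1%:M.

Lemma lcsP k x : lcs mu k x <-> (x <= lcs_mx k)%MS.
Proof.
split.
  elim => {k x} [x|k x y _ IH|k|k a x y _ IHx _ IHy].
  - exact: submx1.
  - rewrite muE /ad mulmx_sumr /=; apply: summx_sub => i _.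
    rewrite -scalemxAr; apply: scalemx_sub; apply: (sumsmx_sup i) => //.
    by rewrite genmxE; apply: submxMr.
  - exact: sub0mx.
  - by apply: addmx_sub => //; apply: scalemx_sub.
have lcs_sum k' (r : seq 'I_n) F : (forall i, lcs mu k' (F i)) -> lcs mu k' (\sum_(i <- r) F i).
  move=> h; elim: r => [|i r IH]; first by rewrite big_nil; apply: lcs_zero.
  by rewrite big_cons -[F i]scale1r; apply: lcs_linear.
elim: k x => [|k IH] x; first by move=> _; apply: lcs_full.
case/sub_sumsmxP => u ->; apply: lcs_sum => i.
have : (u i *m <<lcs_mx k *m str i>> <= lcs_mx k *m str i)%MS.
  by rewrite (submx_trans (submxMl _ _)) // genmxE.
case/submxP => w ->; rewrite mulmxA.
have -> : w *m lcs_mx k *m str i = mu (delta_mx 0 i) (w *m lcs_mx k) by rewrite muE ad_delta.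
by apply: lcs_bracket; apply: IH; apply: submxMl.
Qed.

Lemma lcs_mxS k : (lcs_mx k.+1 <= lcs_mx k)%MS.
Proof.
elim: k => [|k IH]; first exact: submx1.
rewrite [X in (X <= _)%MS]/=; apply/sumsmx_subP => i _; rewrite genmxE.
by apply: (sumsmx_sup i) => //; rewrite genmxE; apply: submxMr.
Qed.

Lemma lcs_mx_stationary k j : (lcs_mx k <= lcs_mx k.+1)%MS -> (lcs_mx k <= lcs_mx (k + j))%MS.
Proof.
move=> h; elim: j => [|j IH]; first by rewrite addn0.
rewrite addnS; apply: (submx_trans h) => /=; apply/sumsmx_subP => i _; rewrite genmxE.
by apply: (sumsmx_sup i) => //; rewrite genmxE; apply: submxMr.
Qed.

Hypothesis hmu : nilpotent_bracket mu.

(** If the series stopped decreasing at a nonzero term it would be stationary, against nilpotency;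
    so the rank drops at each step until it is 0. This bounds the nilpotency class by [n], the order
    at which all series are truncated. *)
Lemma lcs_mx_eq0 : lcs_mx n = 0.
Proof.
have [_ _ [K hK]] := hmu.
have K0 j : lcs_mx (K + j) = 0.
  apply/row_matrixP => i; rewrite row0; apply: hK; apply/lcsP.
  apply: submx_trans (row_sub _ _) _.
  elim: j => [|j IH]; first by rewrite addn0.
  by rewrite addnS; apply: submx_trans (lcs_mxS _) IH.
suff H k : (\rank (lcs_mx k) <= n - k)%N.
  by apply/eqP; rewrite -mxrank_eq0 -leqn0 (leq_trans (H n)) // subnn.
elim: k => [|k IH]; first by rewrite subn0; apply: rank_leq_row.
have [z|nz] := eqVneq (lcs_mx k) 0.
  by have := mxrankS (lcs_mxS k); rewrite z mxrank0 leqn0 => /eqP ->.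
have : (\rank (lcs_mx k.+1) < \rank (lcs_mx k))%N.
  rewrite ltnNge; apply/negP => le; move/negP: nz; apply.
  have /(lcs_mx_stationary K) : (lcs_mx k <= lcs_mx k.+1)%MS.
    by have := mxrank_leqif_sup (lcs_mxS k) => -[_ <-]; rewrite eqn_leq le mxrankS // lcs_mxS.
  by rewrite addnC K0 submx0.
by move=> h; rewrite subnS -ltnS (leq_trans h) // (leq_trans IH) // leqSpred.
Qed.

Lemma nil_lie_str : nil_lie str.
Proof.
have [sk jac _] := hmu; split => [i j|i j|s ss].
- by rewrite !row_str sk.
- rewrite row_str; apply/row_matrixP => k; rewrite !rowE.
  move: (delta_mx 0 k) => w; rewrite mulmxBr.
  set ei : V := delta_mx 0 i; set ej : V := delta_mx 0 j.
  rewrite -(ad_delta str i) -(ad_delta str j) !mulmxA -!muE -/ei -/ej.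
  have /eqP := jac ei ej w; rewrite (sk w (mu ei ej)) subr_eq0 => /eqP <-.
  by rewrite (sk w ei) linearNr.
- have H (A : 'M[R]_n) k t : (A <= lcs_mx k)%MS ->
     (A *m foldr (fun i M => str i *m M) 1%:M t <= lcs_mx (k + size t))%MS.
    elim: t A k => [|i t IH] A k /=; first by rewrite mulmx1 addn0.
    move=> h; rewrite mulmxA addnS -addSn; apply: IH.
    by apply: (sumsmx_sup i) => //; rewrite genmxE; apply: submxMr.
  have := H 1%:M 0%N s (submx1 _); rewrite add0n ss lcs_mx_eq0 mul1mx.
  by rewrite submx0 => /eqP.
Qed.

End StructureOfBracket.

Section BchSeries.
Variables (S : idomainType) (n : nat).
Hypothesis natU : forall k, k.+1%:R \is a @GRing.unit S.

Definition bchs (C : 'I_n -> 'M[S]_n) (x y : 'rV[S]_n) : 'rV[S]_n :=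
  \sum_(1 <= k < n.+1) ((-1) ^+ k.-1 / k%:R) *:
    \sum_(p : k.-tuple ('I_n.+1 * 'I_n.+1) | dynkin_ok p)
      ((dynkin_len p)%:R * (dynkin_fact p)%:R)^-1 *: nest C (dynkin_word x y p).

Lemma at1_sum m p I (r : seq I) (P : pred I) (F : I -> 'M[{poly S}]_(m, p)) :
  at1 (\sum_(i <- r | P i) F i) = \sum_(i <- r | P i) at1 (F i).
Proof. by apply/matrixP => i j; rewrite !mxE /horner_eval !summxE horner_sum; apply: eq_bigr => k _; rewrite mxE. Qed.

Lemma at1Z m p q (F : 'M[{poly S}]_(m, p)) : at1 (q *: F) = q.[1] *: at1 F.
Proof. by apply/matrixP => i j; rewrite !mxE /horner_eval hornerM. Qed.

Lemma at1C m p (F : 'M[S]_(m, p)) : at1 (cM F) = F.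
Proof. by apply/matrixP => i j; rewrite !mxE /horner_eval hornerC. Qed.

Lemma at1N m p (F : 'M[{poly S}]_(m, p)) : at1 (- F) = - at1 F.
Proof. exact: map_mxN. Qed.

Lemma at1M m p q (F : 'M[{poly S}]_(m, p)) (G : 'M[{poly S}]_(p, q)) :
  at1 (F *m G) = at1 F *m at1 G.
Proof. exact: map_mxM. Qed.

Lemma at1_dynkin (C : 'I_n -> 'M[S]_n) x y : at1 (dynkin C x y) = bchs C x y.
Proof.
rewrite /dynkin at1_sum; apply: eq_bigr => k _; rewrite at1Z hornerC; congr (_ *: _).
rewrite at1_sum; apply: eq_bigr => p _.
by rewrite at1Z at1C hornerM hornerC hornerXn expr1n mul1r.
Qed.

Lemma at1_phimN (C : 'I_n -> 'M[S]_n) z :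
  at1 (phim (- ad (lift_str (@polyC S) C) z)) = phim (- ad C (at1 z)).
Proof.
rewrite /phim at1_sum; apply: eq_bigr => k _; rewrite at1Z; congr (_ *: _).
  by rewrite -polyC_natr polyCV hornerC.
elim: (k : nat) => [|j IH]; first by rewrite !expr0 /at1 map_mx1.
by rewrite !exprS -!mulmxE at1M IH at1N at1_ad.
Qed.

End BchSeries.

Section Morphism.
Variables (S T : idomainType) (f : {rmorphism S -> T}) (n : nat) (C : 'I_n -> 'M[S]_n).
Hypothesis natU : forall k, k.+1%:R \is a @GRing.unit S.
Local Notation Cf := (lift_str f C).

Lemma map_nest w : map_mx f (nest C w) = nest Cf [seq map_mx f x | x <- w].
Proof.
elim: w => [|a [|b w] IH]; [by rewrite /= map_mx0 | by [] |].
transitivity (map_mx f (nest C (b :: w) *m ad C a)) => //.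
by rewrite map_mxM map_ad IH.
Qed.

Lemma map_bchs x y : map_mx f (bchs C x y) = bchs Cf (map_mx f x) (map_mx f y).
Proof.
rewrite /bchs raddf_sum !big_nat; apply: eq_bigr => -[|k] //= _.
rewrite map_mxZ raddf_sum /= rmorphM rmorphXn rmorphN1 rmorphV ?natU // rmorph_nat.
congr (_ *: _); apply: eq_bigr => p ok; have [p0|p0] := eqVneq (p : seq _) [::].
  by have := size_tuple p; rewrite p0.
rewrite map_mxZ rmorphV ?rmorphM ?rmorph_nat; last first.
  have := dynkin_len_gt0 ok p0; case: (dynkin_len p) => // l _.
  by rewrite unitrM natU dynkin_factU.
congr (_ *: _); rewrite map_nest; congr nest; rewrite /dynkin_word map_flatten -map_comp.
by congr flatten; apply: eq_map => q /=; rewrite map_cat !map_nseq.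
Qed.

Lemma map_phimN z : map_mx f (phim (- ad C z)) = phim (- ad Cf (map_mx f z)).
Proof.
rewrite /phim raddf_sum; apply: eq_bigr => k _ /=.
rewrite map_mxZ rmorphV ?factU // rmorph_nat; congr (_ *: _).
elim: (k : nat) => [|j IH]; first by rewrite !expr0 map_mx1.
by rewrite !exprS -!mulmxE map_mxM IH map_mxN map_ad.
Qed.

End Morphism.

(** * Left translations and the Maurer-Cartan form *)

Section Translation.
Variables (R : realType) (n : nat).
Local Notation V := 'rV[R]_n.
Variable mu : {bilinear V -> V -> V}.
Hypothesis hmu : nilpotent_bracket mu.
Local Notation C := (str mu).
Let hC := nil_lie_str hmu.

Lemma nat_unit k : k.+1%:R \is a @GRing.unit R.
Proof. by rewrite unitfE pnatr_eq0. Qed.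
Let C1 := lift_str (@polyC R) C.
Let hC1 : nil_lie C1. Proof. exact: nil_lie_lift. Qed.

Lemma bchE x y : bch mu x y = bchs C x y.
Proof.
rewrite /bch /bchs; apply: eq_bigr => k _; congr (_ *: _); apply: eq_bigr => p _.
congr (_ *: _); first by rewrite /dynkin_fact natr_prod.
rewrite -/(dynkin_word x y p); elim: (dynkin_word x y p) => [|a [|b w] IH] //.
by rewrite -[LHS]/(mu a (nested mu (b :: w))) muE IH.
Qed.

Definition mcform (x : V) : 'M[R]_n := phim (- ad C x).

Lemma mcform0 : mcform 0 = 1%:M.
Proof.
rewrite /mcform linear0 oppr0 /phim; case: n => [|m]; first by rewrite [LHS]flatmx0 [RHS]flatmx0.
rewrite big_ord_recl expr0 /= invr1 scale1r big1 ?addr0 // => i _.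
by rewrite exprS mul0r scaler0.
Qed.

Lemma polymx_ad : polymx (ad C).
Proof. by apply: polymx_sum => i; apply: polymxZ; [apply: polyfun_coord | apply: polymx_cst]. Qed.

Lemma polymx_mcform : polymx mcform.
Proof.
apply: polymx_sum => k; apply: polymxZ; first exact: polyfun_cst.
by apply: polymxX; apply: polymxN; apply: polymx_ad.
Qed.

Lemma derive_adN x v : 'D_v (fun x => - ad C x) x = - ad C v.
Proof.
apply/matrixP => i j; rewrite polymx_derive; last by apply: polymxN; apply: polymx_ad.
under eq_fun do rewrite mxE summxE -sumrN.
have pF k : polyfun (fun y : V => - (y 0 k *: C k) i j).
  under eq_fun do rewrite mxE -mulN1r.
  apply: polyfunM; first exact: polyfun_cst.
  by apply: polyfunM; [exact: polyfun_coord | exact: polyfun_cst].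
rewrite polyfun_derive_sum // mxE summxE -sumrN; apply: eq_bigr => k _.
under eq_fun do rewrite mxE mulrC -mulNr.
rewrite polyfun_deriveM; [|exact: polyfun_cst|exact: polyfun_coord].
by rewrite derive_cst mul0r add0r derive_coord [in RHS]mxE mulNr mulrC.
Qed.

Lemma derive_mcform (x v u : V) : u *m 'D_v mcform x =
  - \sum_(k < n) k.+1`!%:R^-1 *: (u *m dpow (- ad C x) (ad C v) k).
Proof.
rewrite /mcform /phim (@polymx_derivable_comb _ _ _ _ (fun k => k.+1`!%:R^-1) n (fun k x => (- ad C x) ^+ k)); last first.
  by move=> k; apply: polymxX; apply: polymxN; apply: polymx_ad.
rewrite mulmx_sumr -[RHS]sumrN; apply: eq_bigr => k _.
rewrite polymx_derive_exp; last by apply: polymxN; apply: polymx_ad.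
by rewrite derive_adN dpowN -scalemxAr mulmxN scalerN.
Qed.

Lemma mcform_structure (x u v : V) : u *m 'D_v mcform x - v *m 'D_u mcform x =
  - ((u *m mcform x) *m ad C (v *m mcform x)).
Proof.
rewrite !derive_mcform opprK addrC -sumrB.
have := maurer_cartan nat_unit hC (- x) u v; rewrite linearN /= => <-.
by rewrite -[RHS]sumrN; apply: eq_bigr => k _; rewrite -scalerBr -scalerN opprB.
Qed.

Lemma polymx_bch y : polymx (bch mu y).
Proof.
apply: polymx_sum => k; apply: polymxZ; first exact: polyfun_cst.
rewrite /=; apply: polymx_sum => p; apply: polymxZ; first exact: polyfun_cst.
(* Words are recorded by booleans, so that their shape does not depend on the variable point. *)
pose bs := flatten [seq nseq q.1 true ++ nseq q.2 false | q : 'I_n.+1 * 'I_n.+1 <- p].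
have H (w : seq bool) : polymx (fun x : V => nested mu [seq if b then y else x | b <- w]).
  have pb (b : bool) : polymx (fun x : V => if b then y else x).
    by case: b; [apply: polymx_cst | apply: polymx_id].
  elim: w => [|a [|b w] IH]; [exact: polymx_cst | exact: pb |].
  under eq_fun do rewrite -[nested _ _]/(mu _ (nested mu [seq if b then y else _ | b <- b :: w])) muE.
  apply: polymxM => //; apply: polymx_sum => i; apply: polymxZ; last exact: polymx_cst.
  exact: pb.
rewrite (_ : (fun x => _) = fun x : V => nested mu [seq if b then y else x | b <- bs]) //.
apply/funext => x; congr nested; rewrite /bs map_flatten -map_comp; congr flatten.
by apply: eq_map => q /=; rewrite map_cat !map_nseq.
Qed.

Lemma bchNx x : bch mu (- x) x = 0.
Proof.
rewrite bchE -(at1_dynkin C) (dynkinN nat_unit hC).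
by apply/matrixP => i j; rewrite !mxE /horner_eval horner0.
Qed.

Let horner_deriv1 (q : {poly {poly R}}) : (map_poly (@deriv R) q).[1] = (q.[1])^`().
Proof.
rewrite (@horner_coef_wide _ (size q)) ?size_poly // horner_coef deriv_bigsum.
by apply: eq_bigr => i _; rewrite expr1n !mulr1 coef_map_id0 ?deriv0.
Qed.

(** [dynkin_invariant] is applied over [{poly R}], with [xe] the line through [x] in the direction
    [u] and the derivation d/d'X, which kills the constant [y]. The outer variable, the scaling
    parameter, is then set to 1, and the inner one to 0. *)
Lemma bch_jacobian (y x u : V) :
  u *m jacobian (bch mu y) x *m mcform (bch mu y x) = u *m mcform x.
Proof.
pose xe : 'rV[{poly R}]_n := cM x + 'X *: cM u.
pose p := bchs C1 (cM y) xe.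
have lifth h : lift_str (horner_eval h) C1 = C.
  by apply/funext => i; apply/matrixP => a b; rewrite /C1 /lift_str !mxE /= /horner_eval hornerC.
have evC h m k (A : 'M[R]_(m, k)) : map_mx (horner_eval h) (cM A) = A.
  by apply/matrixP => a b; rewrite !mxE /horner_eval hornerC.
have ph h : map_mx (horner_eval h) p = bch mu y (h *: u + x).
  rewrite /p (map_bchs (horner_eval h) C1 (poly_natU nat_unit)) lifth bchE evC; congr bchs.
  by rewrite map_mxD map_mxZ /= /horner_eval !evC hornerX addrC.
have Dp : 'D_u (bch mu y) x = map_mx (horner_eval 0) (dM p).
  apply/rowP => k; rewrite polymx_derive; last exact: polymx_bch.
  rewrite !mxE /horner_eval -[RHS](derive_val (is_derive := is_derive_poly (p 0 k) 0)).
  rewrite /derive; apply: (congr1 (fun F : R -> R => lim (F @ 0^')%classic)); apply/funext => h /=.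
  have e l : (p 0 k).[l] = bch mu y (l *: u + x) 0 k by rewrite -ph mxE.
  by rewrite /shift /= !e addr0 scale0r add0r [_ *: 1]mulr1.
have dC1 : derivation C1 (@deriv R) by exact: derivation_deriv.
have dy : map_mx (@deriv R) (cM y) = 0 by exact: dMC.
have := dynkin_invariant (poly_natU nat_unit) hC1 dC1 xe dy.
move=> /(congr1 (@at1 _ _ _)); rewrite !at1M.
rewrite !at1_phimN at1_dynkin -/p at1Z hornerX scale1r !at1C.
have -> : at1 (map_mx (map_poly (@deriv R)) (dynkin C1 (cM y) xe)) = dM p.
  by rewrite /p -at1_dynkin; apply/matrixP => i j; rewrite !mxE /horner_eval horner_deriv1.
have -> : map_mx (@deriv R) xe = cM u.
  by rewrite -/(dM xe) dMD dMC add0r dMZ dMC scaler0 addr0 derivX scale1r.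
have -> : at1 ('X *: cM xe) = xe by rewrite at1Z at1C hornerX scale1r.
move=> /(congr1 (map_mx (horner_eval 0))); rewrite !map_mxM.
rewrite !(map_phimN (horner_eval 0) C1 (poly_natU nat_unit)) lifth -Dp ph scale0r add0r evC.
rewrite -deriveEjacobian; last by apply: polymx_differentiable; exact: polymx_bch.
move=> ->; congr (_ *m phim (- ad _ _)).
by rewrite map_mxD map_mxZ /= /horner_eval !evC hornerX scale0r addr0.
Qed.

End Translation.

(** * Curvature in a left-invariant frame *)

Section MoreCalculus.
Variables (R : realType) (n : nat).
Local Notation V := 'rV[R]_n.

Lemma polymx_derive_poly m p (M : V -> 'M[R]_(m, p)) v : polymx M -> polymx (fun x => 'D_v M x).
Proof.
move=> pM i j; under eq_fun do rewrite (polymx_derive _ _ _ _ pM).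
exact: polyfun_derive.
Qed.

Lemma polymx_deriveT m p (M : V -> 'M[R]_(m, p)) x v : polymx M ->
  'D_v (fun x => (M x)^T) x = ('D_v M x)^T.
Proof.
move=> pM; apply/matrixP => i j; rewrite polymx_derive; last exact: polymxT.
by under eq_fun do rewrite mxE; rewrite mxE polymx_derive.
Qed.

Lemma polymx_deriveD m p (M N : V -> 'M[R]_(m, p)) x v : polymx M -> polymx N ->
  'D_v (fun x => M x + N x) x = 'D_v M x + 'D_v N x.
Proof. by move=> pM pN; rewrite -deriveD //; apply: polymx_derivable. Qed.

Lemma polyfun_deriveC f x u v : polyfun f ->
  'D_u (fun x : V => 'D_v f x) x = 'D_v (fun x : V => 'D_u f x) x.
Proof.
move=> pf; elim: pf x => {f} [c|k|f g pf IHf pg IHg|f g pf IHf pg IHg] x.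
- by rewrite (_ : (fun x => 'D_v _ x) = (fun x => 'D_u (fun=> c) x)) // ; apply/funext => y; rewrite !derive_cst.
- have h w w' : 'D_w (fun x : V => 'D_w' (fun x : V => x 0 k : R) x) x = 0.
    by under eq_fun do rewrite derive_coord; rewrite derive_cst.
  by rewrite !h.
- have pd (w : V) (h : V -> R) : polyfun h -> polyfun (fun x => 'D_w h x) by apply: polyfun_derive.
  under eq_fun do rewrite (polyfun_deriveD _ _ pf pg).
  under [in RHS]eq_fun do rewrite (polyfun_deriveD _ _ pf pg).
  rewrite (polyfun_deriveD x u (pd v f pf) (pd v g pg)).
  by rewrite (polyfun_deriveD x v (pd u f pf) (pd u g pg)) IHf IHg.
- have pd (w : V) (h : V -> R) : polyfun h -> polyfun (fun x => 'D_w h x) by apply: polyfun_derive.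
  have p1 w : polyfun (fun x => 'D_w f x * g x) := polyfunM (pd w f pf) pg.
  have p2 w : polyfun (fun x => f x * 'D_w g x) := polyfunM pf (pd w g pg).
  under eq_fun do rewrite (polyfun_deriveM _ _ pf pg).
  under [in RHS]eq_fun do rewrite (polyfun_deriveM _ _ pf pg).
  rewrite (polyfun_deriveD x u (p1 v) (p2 v)) (polyfun_deriveD x v (p1 u) (p2 u)).
  rewrite (polyfun_deriveM x u (pd v f pf) pg) (polyfun_deriveM x u pf (pd v g pg)).
  rewrite (polyfun_deriveM x v (pd u f pf) pg) (polyfun_deriveM x v pf (pd u g pg)).
  by rewrite (IHf x) (IHg x); apply: addrACA.
Qed.

Lemma polymx_deriveC m p (M : V -> 'M[R]_(m, p)) x u v : polymx M ->
  'D_u (fun x => 'D_v M x) x = 'D_v (fun x => 'D_u M x) x.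
Proof.
move=> pM; apply/matrixP => i j.
have h a b : ('D_a (fun y => 'D_b M y) x) i j = 'D_a (fun y => 'D_b (fun z => M z i j) y) x.
  rewrite [LHS](polymx_derive x a i j (polymx_derive_poly b pM)).
  by congr ('D_a _ x); apply/funext => y; apply: polymx_derive.
by rewrite [LHS]h [RHS]h; apply: polyfun_deriveC.
Qed.

Lemma polymx_derive_ad (B : 'I_n -> 'M[R]_n) (e : V -> V) x v : polymx e ->
  'D_v (fun x => ad B (e x)) x = ad B ('D_v e x).
Proof.
move=> pe; rewrite /ad.
have -> : (fun x => \sum_i e x 0 i *: B i) = fun x => \sum_i (fun x => e x 0 i *: B i) x by [].
apply/matrixP => a b; rewrite polymx_derive; last first.
  by apply: polymx_sum => i; apply: polymxZ; [exact: pe | exact: polymx_cst].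
under eq_fun do rewrite summxE.
rewrite polyfun_derive_sum; last first.
  by move=> i; under eq_fun do rewrite mxE; apply: polyfunM; [exact: pe | exact: polyfun_cst].
rewrite summxE; apply: eq_bigr => i _.
under eq_fun do rewrite mxE.
rewrite polyfun_deriveM; [|exact: pe|exact: polyfun_cst].
by rewrite derive_cst mulr0 addr0 mxE polymx_derive.
Qed.

End MoreCalculus.

(** The curvature of the gauge transform (dE + E w) F is the conjugate of the curvature of [w]. [D]
    and [D'] are the derivatives of [E] in two directions, [S] is its mixed second derivative, and
    [a], [a'] are the cross derivatives of [w'] and [w]. *)
Lemma gauge_curvature (R : comNzRingType) n (E F D D' S w w' a a' : 'M[R]_n) : F *m E = 1%:M ->
  (S + (D *m w' + E *m a)) *m F + (D' + E *m w') *m - (F *m D *m F)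
  - ((S + (D' *m w + E *m a')) *m F + (D + E *m w) *m - (F *m D' *m F))
  + ((D' + E *m w') *m F *m ((D + E *m w) *m F) - (D + E *m w) *m F *m ((D' + E *m w') *m F))
  = E *m (a - a' + (w' *m w - w *m w')) *m F.
Proof.
move=> FE; set P := D + E *m w; set P' := D' + E *m w'.
have h (Q B b : 'M[R]_n) : Q *m F *m ((B + E *m b) *m F) = Q *m (F *m B *m F) + Q *m b *m F.
  by rewrite mulmxDl mulmxDr !mulmxA -[Q *m F *m E]mulmxA FE mulmx1.
rewrite {2}/P {3}/P' !h !mulmxN.
transitivity ((S + (D *m w' + E *m a) - (S + (D' *m w + E *m a')) + (P' *m w - P *m w')) *m F).
  rewrite [RHS]mulmxDl [X in _ = X + _]mulmxBl [X in _ = _ + X]mulmxBl.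
  suff gen (x1 x2 x3 x4 x5 x6 : 'M[R]_n) :
     x1 - x2 - (x3 - x4) + (x2 + x5 - (x4 + x6)) = x1 - x3 + (x5 - x6) by exact: gen.
  by apply/matrixP => i j; rewrite !mxE; ring.
congr (_ *m F); rewrite /P /P' !mulmxDl mulmxDr mulmxBr mulmxBr !mulmxA.
suff gen (x1 x2 x3 x4 x5 x6 x7 : 'M[R]_n) :
   x1 + (x2 + x3) - (x1 + (x4 + x5)) + (x4 + x6 - (x2 + x7)) = x3 - x5 + (x6 - x7) by exact: gen.
by apply/matrixP => i j; rewrite !mxE; ring.
Qed.

Section Frame.
Variables (R : realType) (n : nat).
Local Notation V := 'rV[R]_n.
Variable C : 'I_n -> 'M[R]_n.
Hypothesis skewC : forall i j, row j (C i) = - row i (C j).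
Variables E F : V -> 'M[R]_n.
Hypotheses (pE : polymx E) (pF : polymx F).
Hypothesis EF : forall x, E x *m F x = 1%:M.
Hypothesis mcE : forall (x u v : V), u *m 'D_v E x - v *m 'D_u E x =
  - ((u *m E x) *m ad C (v *m E x)).

Let FE x : F x *m E x = 1%:M. Proof. exact: mulmx1C. Qed.
Local Notation c := (fun a b k => C a b k).
Let skc a b k : C a b k = - C b a k.
Proof. by have /rowP/(_ k) := skewC a b; rewrite !mxE. Qed.

(* Koszul's formula in a left-invariant orthonormal frame. *)
Definition koszul (a : 'I_n) : 'M[R]_n :=
  \matrix_(b, k) (2^-1 * (C a b k - C b k a + C k a b)).
Local Notation adG := (ad koszul).

(** The connection preserves the inner product of the frame. *)
Lemma koszul_skew u : (adG u)^T = - adG u.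
Proof.
rewrite /ad linear_sum -sumrN; apply: eq_bigr => a _; rewrite linearZ /= -scalerN; congr (_ *: _).
apply/matrixP => b k; rewrite !mxE -mulrN; congr (_ * _).
by rewrite (skc b a k) (skc k b a) (skc a k b); ring.
Qed.

(** The connection has no torsion, [v *m ad C u] being [u, v]. *)
Lemma koszul_torsion u v : v *m adG u - u *m adG v = v *m ad C u.
Proof.
rewrite !mul_ad [X in _ - X]exchange_big /= -sumrB; apply: eq_bigr => i _.
rewrite -sumrB; apply: eq_bigr => j _; rewrite [v 0 j * _]mulrC -scalerBr; congr (_ *: _).
apply/rowP => k; rewrite !mxE -mulrBr.
rewrite (skc j i k) (skc k j i) (skc i k j).
by apply: (mulfI (_ : 2 != 0 :> R)); rewrite ?pnatr_eq0 // mulVKf ?pnatr_eq0 //; ring.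
Qed.

(** R(u, v) on the invariant frame. Operators act on the right of row vectors, so nabla_u nabla_v is
    [adG v *m adG u]. *)
Definition curv_frame (u v : V) : 'M[R]_n :=
  - adG (v *m ad C u) + adG v *m adG u - adG u *m adG v.

Let e i : V := delta_mx 0 i.
Let G x := E x *m (E x)^T.
Let w i x : 'M[R]_n := adG (e i *m E x).
(** The rows of [E] are the coordinate fields in the invariant frame. [P i] holds their covariant
    derivatives along the i-th coordinate field, in that frame; [N i] expresses these in
    coordinates. *)
Let P i x : 'M[R]_n := 'D_(e i) E x + E x *m w i x.
Let N i x : 'M[R]_n := P i x *m F x.

Let pe i : polymx (fun x => e i *m E x).
Proof. by apply: polymxM => //; apply: polymx_cst. Qed.
Let pw i : polymx (w i).
Proof. by apply: polymx_sum => k; apply: polymxZ; [exact: pe | exact: polymx_cst]. Qed.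
Let pP i : polymx (P i).
Proof. by apply: polymxD; [exact: polymx_derive_poly | exact: polymxM]. Qed.
Let pN i : polymx (N i).
Proof. exact: polymxM. Qed.
Let pG : polymx G.
Proof. by apply: polymxM => //; apply: polymxT. Qed.

Lemma invmx_frame x : invmx (G x) = (F x)^T *m F x.
Proof.
have h : G x *m ((F x)^T *m F x) = 1%:M.
  by rewrite /G mulmxA -[_ *m (E x)^T *m _]mulmxA -trmx_mul FE trmx1 mulmx1 EF.
by have [u _] := mulmx1_unit h; rewrite -[RHS](mulKmx u) h mulmx1.
Qed.

Let NG i x : N i x *m G x = P i x *m (E x)^T.
Proof. by rewrite /N /G mulmxA -[_ *m F x *m _]mulmxA FE mulmx1. Qed.

Let dG i x : 'D_(e i) G x = N i x *m G x + (N i x *m G x)^T.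
Proof.
rewrite NG /G polymx_deriveM //; last exact: polymxT.
rewrite polymx_deriveT // trmx_mul trmxK /P linearD /= trmx_mul koszul_skew.
rewrite mulmxDl mulmxDr mulNmx mulmxN mulmxA -!addrA; congr (_ + _).
by rewrite addrCA subrr addr0.
Qed.

Let NGC i j l x : (N i x *m G x) j l = (N j x *m G x) i l.
Proof.
have rowij (A : 'M[R]_n) a b : row a A 0 b = A a b by rewrite mxE.
rewrite !NG; suff h : row j (P i x) = row i (P j x).
  by rewrite -!rowij !row_mul h.
rewrite !rowE -!/(e _) /P !mulmxDr !mulmxA /w.
apply/eqP; rewrite -subr_eq0 opprD addrACA mcE koszul_torsion.
by rewrite addNr.
Qed.

(** Uniqueness of the Levi-Civita connection: [N] is metric by [dG] and symmetric by [NGC], so the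
    combination of derivatives of [G] collapses to twice [N i x *m G x]. *)
Lemma christoffel_frame k i j x : christoffel G k i j x = N i x j k.
Proof.
have dGe a b l : partial a (fun z => G z b l) x = (N a x *m G x) b l + (N a x *m G x) l b.
  by rewrite /partial -polymx_derive // dG [LHS]mxE [X in _ + X]mxE.
rewrite /christoffel.
transitivity (2^-1 * \sum_(l < n) invmx (G x) k l * ((N i x *m G x) j l *+ 2)).
  congr (_ * _); apply: eq_bigr => l _; congr (_ * _); rewrite !dGe.
  suff gen (p q r p' q' r' : R) : p' = p -> q = q' -> r = r' ->
      p + q + (p' + r) - (q' + r') = p *+ 2 by apply: gen; apply: NGC.
  by move=> -> -> ->; rewrite mulr2n; ring.
have H : (invmx (G x))^T = invmx (G x) by rewrite invmx_frame trmx_mul trmxK.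
have -> : N i x j k = (N i x *m G x *m invmx (G x)) j k.
  congr (fun_of_matrix _ j k).
  rewrite invmx_frame NG /N mulmxA -[_ *m (E x)^T *m _]mulmxA -trmx_mul FE.
  by rewrite trmx1 mulmx1.
rewrite [RHS]mxE mulr_sumr; apply: eq_bigr => l _.
rewrite -[in RHS]H [X in _ = _ * X]mxE.
suff gen (a b : R) : 2^-1 * (b * (a *+ 2)) = a * b by exact: gen.
by rewrite -mulr_natr; field.
Qed.

Let dF i x : 'D_(e i) F x = - (F x *m 'D_(e i) E x *m F x).
Proof.
have := polymx_deriveM x (e i) pF pE.
rewrite (_ : (fun x => _) = fun=> 1%:M); last by apply/funext => y; rewrite FE.
rewrite derive_cst => /eqP; rewrite eq_sym addr_eq0 => /eqP h.
by rewrite -[LHS]mulmx1 -(EF x) mulmxA h mulNmx.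
Qed.

Lemma curvature_frame i j k l x :
  curvature G i j k l x = (E x *m curv_frame (e i *m E x) (e j *m E x) *m F x) k l.
Proof.
have pc a b d : partial a (christoffel G d b k) x = ('D_(e a) (N b) x) k d.
  rewrite /partial polymx_derive //; congr ('D__ _ x); apply/funext => y.
  exact: christoffel_frame.
rewrite /curvature !pc.
transitivity (('D_(e i) (N j) x - 'D_(e j) (N i) x + (N j x *m N i x - N i x *m N j x)) k l).
  rewrite !mxE -sumrB; congr (_ + _); apply: eq_bigr => m _.
  by rewrite !christoffel_frame.
congr (fun_of_matrix _ k l).
rewrite !polymx_deriveM // !dF.
have dP a b : 'D_(e a) (P b) x = 'D_(e a) (fun x => 'D_(e b) E x) x +
    ('D_(e a) E x *m w b x + E x *m adG (e b *m 'D_(e a) E x)).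
  rewrite /P polymx_deriveD ?polymx_deriveM //; [|exact: polymx_derive_poly|exact: polymxM].
  rewrite /w polymx_derive_ad // polymx_deriveM //; last exact: polymx_cst.
  by rewrite derive_cst mul0mx add0r.
have -> : curv_frame (e i *m E x) (e j *m E x) =
    adG (e j *m 'D_(e i) E x) - adG (e i *m 'D_(e j) E x) + (w j x *m w i x - w i x *m w j x).
  rewrite /curv_frame -/(w i x) -/(w j x) -[adG _ - adG _]linearB /= mcE linearN /=.
  by rewrite addrA.
rewrite (dP i j) (dP j i) [X in _ - ((X + _) *m _ + _)](polymx_deriveC x (e j) (e i) pE).
exact: gauge_curvature (FE x).
Qed.

End Frame.

Lemma exchange_big4 (R : nmodType) n (f : 'I_n -> 'I_n -> 'I_n -> 'I_n -> R) :
  \sum_k \sum_l \sum_a \sum_b f k l a b = \sum_a \sum_b \sum_k \sum_l f k l a b.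
Proof.
rewrite [LHS]pair_bigA [RHS]pair_bigA /=.
under eq_bigr => p _ do rewrite pair_bigA /=.
under [RHS]eq_bigr => p _ do rewrite pair_bigA /=.
exact: exchange_big.
Qed.

Lemma mxtrace_trmul (R : comNzRingType) m n (A B : 'M[R]_(m, n)) :
  \tr (A^T *m B) = \sum_i \sum_j A i j * B i j.
Proof.
rewrite exchange_big /mxtrace; apply: eq_bigr => j _; rewrite mxE.
by apply: eq_bigr => i _; rewrite mxE.
Qed.

(** [H] is the inverse of the metric E E^T, so raising indices with it undoes the passage from frame
    to coordinates. *)
Lemma contraction_invariant (R : comNzRingType) n (E F S T : 'M[R]_n) : F *m E = 1%:M ->
  let H := F^T *m F in
  \sum_i \sum_j \sum_a \sum_b H i a * H j b * ((E *m S *m E^T) i j * (E *m T *m E^T) a b)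
  = \sum_i \sum_j S i j * T i j.
Proof.
move=> FE H.
have HT : H^T = H by rewrite /H trmx_mul trmxK.
transitivity (\sum_i \sum_j (E *m S *m E^T) i j * (H *m (E *m T *m E^T) *m H) i j).
  apply: eq_bigr => i _; apply: eq_bigr => j _.
  rewrite [X in _ = _ * X]mxE mulr_sumr exchange_big /=; apply: eq_bigr => b _.
  rewrite [X in _ = _ * (X * _)]mxE mulr_suml mulr_sumr; apply: eq_bigr => a _.
  have -> : H b j = H j b by rewrite -{1}HT mxE.
  by move: (H j b) (H i a) (_ i j) (_ a b) => *; ring.
rewrite -!mxtrace_trmul.
have -> : H *m (E *m T *m E^T) *m H = F^T *m T *m F.
  rewrite /H !mulmxA -[_ *m F *m E]mulmxA FE mulmx1 -[_ *m E^T *m F^T]mulmxA -trmx_mul FE.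
  by rewrite trmx1 mulmx1.
rewrite !trmx_mul trmxK !mulmxA -[_ *m E^T *m F^T]mulmxA -trmx_mul FE trmx1 mulmx1.
by rewrite mxtrace_mulC !mulmxA FE mul1mx.
Qed.

Lemma linear_row_sum (R : comNzRingType) n m p (f : 'rV[R]_n -> 'M[R]_(m, p)) u : linear f ->
  f u = \sum_a u 0 a *: f (delta_mx 0 a).
Proof.
move=> fl; pose gM := GRing.isLinear.Build R 'rV[R]_n 'M[R]_(m, p) *:%R f fl.
pose g : {linear 'rV[R]_n -> 'M[R]_(m, p)} := HB.pack f gM.
rewrite -[f]/(g : _ -> _) {1}(row_sum_delta u) linear_sum.
by apply: eq_bigr => a _; rewrite linearZ.
Qed.

(** * Ricci tensor and curvature norm in the frame *)

Section FrameTensors.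
Variables (R : realType) (n : nat).
Local Notation V := 'rV[R]_n.
Variable C : 'I_n -> 'M[R]_n.
Local Notation e i := (delta_mx 0 i : V).

Lemma curv_frame_linearl v : linear (fun u => curv_frame C u v).
Proof.
move=> k u u'; rewrite /curv_frame [ad C (_ + _)]linearP /= mulmxDr -scalemxAr.
rewrite [ad (koszul C) (k *: u + u')]linearP [ad (koszul C) (_ + _)]linearP /=.
rewrite mulmxDr mulmxDl -scalemxAr -scalemxAl.
move: (ad _ (v *m ad C u)) (ad _ (v *m ad C u')) => x1 x2.
move: (_ *m _) (_ *m _) (_ *m _) (_ *m _) => x3 x4 x5 x6.
apply/matrixP => i j; rewrite !mxE. ring.
Qed.

Lemma curv_frame_linearr u : linear (curv_frame C u).
Proof.
move=> k v v'; rewrite /curv_frame mulmxDl -scalemxAl.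
rewrite [ad (koszul C) (k *: v + v')]linearP [ad (koszul C) (_ + _)]linearP /=.
rewrite mulmxDr mulmxDl -scalemxAr -scalemxAl.
move: (ad _ (v *m ad C u)) (ad _ (v' *m ad C u)) => x1 x2.
move: (_ *m _) (_ *m _) (_ *m _) (_ *m _) => x3 x4 x5 x6.
by apply/matrixP => i j; rewrite !mxE; ring.
Qed.

Definition ric_frame : 'M[R]_n :=
  \matrix_(b, k) \sum_a curv_frame C (e a) (e b) k a.

Hypothesis skewC : forall i j, row j (C i) = - row i (C j).
Variables E F : V -> 'M[R]_n.
Hypotheses (pE : polymx E) (pF : polymx F).
Hypothesis EF : forall x, E x *m F x = 1%:M.
Hypothesis mcE : forall (x u v : V), u *m 'D_v E x - v *m 'D_u E x =
  - ((u *m E x) *m ad C (v *m E x)).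
Local Notation G := (fun x => E x *m (E x)^T).
Let FE x : F x *m E x = 1%:M. Proof. exact: mulmx1C. Qed.

Lemma Rc_frame x : Rc G x = E x *m ric_frame *m (E x)^T.
Proof.
have eE i : e i *m E x = row i (E x) by rewrite rowE.
apply/matrixP => j k; rewrite mxE.
under eq_bigr => i _ do rewrite (curvature_frame skewC pE pF EF mcE) !eE.
transitivity (\sum_a (E x *m curv_frame C (e a) (row j (E x))) k a).
  transitivity (\sum_i \sum_a E x i a * (E x *m curv_frame C (e a) (row j (E x)) *m F x) k i).
    apply: eq_bigr => i _.
    rewrite [curv_frame _ _ _](linear_row_sum _ (curv_frame_linearl _)).
    rewrite mulmx_sumr mulmx_suml summxE; apply: eq_bigr => a _.
    by rewrite -scalemxAr -scalemxAl !mxE.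
  rewrite exchange_big; apply: eq_bigr => a _ /=.
  rewrite -[in RHS](mulmx1 (E x *m _)) -(FE x) mulmxA [RHS]mxE.
  by apply: eq_bigr => i _; rewrite mulrC.
rewrite [RHS]mxE.
transitivity (\sum_a \sum_c \sum_b E x j b * (E x k c * curv_frame C (e a) (e b) c a)).
  apply: eq_bigr => a _; rewrite mxE; apply: eq_bigr => c _.
  rewrite (linear_row_sum _ (curv_frame_linearr _)) summxE mulr_sumr.
  by apply: eq_bigr => b _; rewrite !mxE mulrCA.
rewrite exchange_big; apply: eq_bigr => c _ /=.
rewrite exchange_big [in RHS]mxE mulr_suml; apply: eq_bigr => b _ /=.
rewrite -!mulr_sumr [ric_frame b c]mxE [(E x)^T c k]mxE.
by rewrite -mulrA; congr (_ * _); rewrite mulrC.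
Qed.

Lemma Rm_frame i j k l x : Rm G i j k l x =
  (E x *m curv_frame C (row i (E x)) (row j (E x)) *m (E x)^T) k l.
Proof.
rewrite /Rm; under eq_bigr => m _ do rewrite (curvature_frame skewC pE pF EF mcE) -!rowE.
rewrite -[X in _ = (X *m _) k l]mulmx1 -(FE x) mulmxA -[in RHS](mulmxA _ (E x)).
by rewrite [RHS]mxE.
Qed.

Lemma norm_Rm_frame x : norm_Rm G x =
  Num.sqrt (\sum_k \sum_l \sum_p \sum_q curv_frame C (e p) (e q) k l ^+ 2).
Proof.
rewrite /norm_Rm (invmx_frame EF) //=; congr Num.sqrt.
set H := (F x)^T *m F x.
pose K i j := curv_frame C (row i (E x)) (row j (E x)).
transitivity (\sum_i \sum_j \sum_a \sum_b H i a * H j b *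
    (\sum_k \sum_l K i j k l * K a b k l)).
  apply: eq_bigr => i _; apply: eq_bigr => j _.
  rewrite exchange_big4; apply: eq_bigr => a _; apply: eq_bigr => b _.
  rewrite -(contraction_invariant (K i j) (K a b) (FE x)) -/H.
  rewrite !mulr_sumr; apply: eq_bigr => k _.
  rewrite !mulr_sumr; apply: eq_bigr => l _.
  rewrite !mulr_sumr; apply: eq_bigr => c _.
  rewrite !mulr_sumr; apply: eq_bigr => d _.
  by rewrite !Rm_frame -/(K i j) -/(K a b) !mulrA.
pose S k l : 'M[R]_n := \matrix_(p, q) curv_frame C (e p) (e q) k l.
have KE i j k l : K i j k l = (E x *m S k l *m (E x)^T) i j.
  rewrite /K (linear_row_sum _ (curv_frame_linearl _)) summxE [RHS]mxE.
  transitivity (\sum_a \sum_b E x i a * (E x j b * curv_frame C (e a) (e b) k l)).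
    apply: eq_bigr => a _; rewrite mxE (linear_row_sum _ (curv_frame_linearr _)) summxE mulr_sumr.
    by apply: eq_bigr => b _; rewrite !mxE.
  rewrite exchange_big; apply: eq_bigr => b _ /=; rewrite [in RHS]mxE mulr_suml.
  by apply: eq_bigr => a _; rewrite !mxE mulrA mulrAC.
transitivity (\sum_k \sum_l \sum_i \sum_j \sum_a \sum_b H i a * H j b *
    ((E x *m S k l *m (E x)^T) i j * (E x *m S k l *m (E x)^T) a b)); last first.
  apply: eq_bigr => k _; apply: eq_bigr => l _; rewrite (contraction_invariant _ _ (FE x)).
  by apply: eq_bigr => p _; apply: eq_bigr => q _; rewrite mxE expr2.
rewrite [RHS]exchange_big4; apply: eq_bigr => i _; apply: eq_bigr => j _.
rewrite [RHS]exchange_big4; apply: eq_bigr => a _; apply: eq_bigr => b _.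
rewrite mulr_sumr; apply: eq_bigr => k _; rewrite mulr_sumr; apply: eq_bigr => l _.
by rewrite !KE.
Qed.

End FrameTensors.

(** As [A ^+ k = 0], the matrix 'X - A divides 'X^k. Taking determinants, [char_poly A] divides a
    power of ['X], so it is a power of ['X] and its trace coefficient is 0. *)
Lemma mxtrace_nilpotent (F : fieldType) n (A : 'M[F]_n) k : A ^+ k = 0 -> \tr A = 0.
Proof.
case: n A => [|n] A Ak; first by rewrite /mxtrace big_ord0.
have [q qE] : exists q, 'X^(n.+1 * k) = char_poly A * q.
  pose B : 'M[{poly F}]_n.+1 := map_mx (@polyC F) A.
  have comm : GRing.comm ('X%:M : 'M[{poly F}]_n.+1) B.
    by apply/matrixP => i j; rewrite -!mulmxE scalar_mxC.
  have := subrXX_comm k comm; rewrite -rmorphXn /= -[B ^+ k]rmorphXn /= Ak map_mx0 subr0.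
  move=> /(congr1 determinant); rewrite -mulmxE det_mulmx.
  by rewrite det_scalar -exprM mulnC => ->; eexists.
have : char_poly A %| ('X - 0%:P) ^+ (n.+1 * k) by rewrite subr0 qE dvdp_mulIl.
case/dvdp_exp_XsubCP => m _; rewrite subr0 => eq.
have cX : char_poly A = 'X^m.
  apply/eqP; rewrite -eqp_monic ?char_poly_monic ?monicXn //.
have sz : m = n.+1 by have := size_char_poly A; rewrite cX size_polyXn => -[].
have := char_poly_trace A (ltn0Sn n); rewrite cX coefXn sz /= => /eqP.
by rewrite eqn_leq ltnn andbF eq_sym oppr_eq0 => /eqP.
Qed.

Lemma curv_frame_entry (R : realType) n (C : 'I_n -> 'M[R]_n) p q k l :
  curv_frame C (delta_mx 0 p) (delta_mx 0 q) k l =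
   - (\sum_m C p q m * koszul C m k l) + \sum_m koszul C q k m * koszul C p m l
   - \sum_m koszul C p k m * koszul C q m l.
Proof.
rewrite /curv_frame !ad_delta -rowE !mxE; congr (- _ + _ - _).
by rewrite /ad summxE; apply: eq_bigr => m _; rewrite !mxE.
Qed.

(** * Ricci curvature of a nilpotent bracket *)

Section Ricci.
Variables (R : realType) (n : nat).
Local Notation V := 'rV[R]_n.
Variable C : 'I_n -> 'M[R]_n.
Hypothesis hC : nil_lie C.

Let skc a b k : C a b k = - C b a k.
Proof. by have [h _ _] := hC; have /rowP/(_ k) := h a b; rewrite !mxE. Qed.

Lemma trace_str a : \sum_i C a i i = 0.
Proof.
by apply: (@mxtrace_nilpotent _ _ _ n); rewrite -(ad_delta C a); apply: ad_expn_eq0.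
Qed.

(** Powers of [C a *m C b] are words in the adjoint operators, so this product is nilpotent. *)
Lemma killing_str a b : \sum_i \sum_m C a i m * C b m i = 0.
Proof.
transitivity (\tr (C a *m C b)).
  by apply: eq_bigr => i _; rewrite mxE.
pose w k := flatten (nseq k [:: (delta_mx 0 a : V); delta_mx 0 b]).
have h k : (C a *m C b) ^+ k = foldr (fun z M => ad C z *m M) 1%:M (w k).
  elim: k => [|k IH]; first by rewrite expr0.
  by rewrite exprS IH -mulmxE /= !ad_delta mulmxA.
apply: (@mxtrace_nilpotent _ _ _ n); rewrite h; apply: (ad_word_eq0 hC).
by rewrite size_flatten /shape map_nseq sumn_nseq /= mul2n -addnn leq_addr.
Qed.

Definition ric_nil (b k : 'I_n) : R :=
  - 2^-1 * (\sum_i \sum_m C b i m * C k i m) + 4^-1 * (\sum_i \sum_m C i m b * C i m k).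

Lemma ric_frameE b k : ric_frame C b k = ric_nil b k.
Proof.
rewrite mxE.
under eq_bigr => i _ do rewrite curv_frame_entry.
rewrite 2!big_split /= sumrN.
have -> : \sum_i \sum_m koszul C b k m * koszul C i m i = 0.
  rewrite exchange_big big1 // => m _; rewrite -mulr_sumr.
  suff -> : \sum_i koszul C i m i = - \sum_i C m i i by rewrite trace_str oppr0 mulr0.
  rewrite -sumrN; apply: eq_bigr => i _; rewrite mxE (skc i m i).
  have -> : C i i m = 0.
    by have /eqP := skc i i m; rewrite -addr_eq0 -mulr2n mulrn_eq0 => /eqP.
  by field.
rewrite addr0 sumrN -opprD -big_split /=.
pose s i m := C b i m * C k m i.
(* [s] sums to the Killing form; the terms [h m i - h i m] cancel after exchanging the two summation
   indices. *)
pose h i m := 4^-1 * (C k i m * C i m b - C k i m * C b i m + C i m k * C b i m - s i m).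
have tE i m : C i b m * koszul C m k i + koszul C i k m * koszul C b m i =
   2^-1 * (C b i m * C k i m) - 4^-1 * (C i m b * C i m k) + 2^-1 * s i m + (h m i - h i m).
  rewrite !mxE /h /s (skc i b m) (skc m k i) (skc i k m) (skc m i k) (skc m i b).
  by field.
under eq_bigr => i _ do (rewrite -big_split /=; under eq_bigr => m _ do rewrite tE).
have S4 (f1 f2 f3 f4 : 'I_n -> 'I_n -> R) :
  \sum_i \sum_m (2^-1 * f1 i m - 4^-1 * f2 i m + 2^-1 * f3 i m + f4 i m) =
  2^-1 * (\sum_i \sum_m f1 i m) - 4^-1 * (\sum_i \sum_m f2 i m) + 2^-1 * (\sum_i \sum_m f3 i m)
   + \sum_i \sum_m f4 i m.
  rewrite !mulr_sumr -sumrN -!big_split; apply: eq_bigr => i _ /=.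
  by rewrite !mulr_sumr -sumrN -!big_split.
rewrite S4 (killing_str b k) mulr0 addr0.
have -> : \sum_i \sum_m (h m i - h i m) = 0.
  rewrite -[RHS](subrr (\sum_i \sum_m h i m)) [X in _ = X - _]exchange_big -sumrB.
  by apply: eq_bigr => i _; rewrite -sumrB.
by rewrite addr0 opprB /ric_nil mulNr addrC.
Qed.

End Ricci.

(** * Orthonormal frames for arbitrary invariant metrics *)

Section ChangeOfBasis.
Variables (R : realType) (n : nat).
Local Notation V := 'rV[R]_n.

(* The structure matrices, in the basis formed by the rows of Q = P^-1, of the bracket C. *)
Definition tr_str (P Q : 'M[R]_n) (C : 'I_n -> 'M[R]_n) : 'I_n -> 'M[R]_n :=
  fun a => Q *m ad C (row a Q) *m P.

Variables P Q : 'M[R]_n.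
Variable C : 'I_n -> 'M[R]_n.

Lemma ad_tr_str u : ad (tr_str P Q C) u = Q *m ad C (u *m Q) *m P.
Proof.
rewrite [LHS]/ad mulmx_sum_row [ad C _]linear_sum mulmx_sumr mulmx_suml.
by apply: eq_bigr => a _; rewrite linearZ /= -scalemxAr -scalemxAl.
Qed.

Hypothesis PQ : P *m Q = 1%:M.
Hypothesis hC : nil_lie C.

Lemma nil_lie_tr : nil_lie (tr_str P Q C).
Proof.
have QP := mulmx1C PQ.
have adP u v : ad (tr_str P Q C) u *m ad (tr_str P Q C) v = Q *m (ad C (u *m Q) *m ad C (v *m Q)) *m P.
  by rewrite !ad_tr_str !mulmxA -[_ *m P *m Q]mulmxA PQ mulmx1.
split => [i j|i j|s ss].
- rewrite /tr_str !row_mul -mulNmx; congr (_ *m _); exact: ad_skew.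
- rewrite -[tr_str P Q C i](ad_delta (tr_str P Q C)) -[tr_str P Q C j](ad_delta (tr_str P Q C)) !adP.
  rewrite -mulmxBl -mulmxBr -(ad_bracket hC) ad_tr_str; congr (_ *m ad C _ *m _).
  by rewrite ad_tr_str !row_mul -!mulmxA PQ mulmx1 -rowE rowE mulmxA -!rowE.
- have H (t : seq 'I_n) : foldr (fun i M => tr_str P Q C i *m M) 1%:M t =
      Q *m foldr (fun z M => ad C z *m M) 1%:M [seq row i Q | i <- t] *m P.
    elim: t => [|i t IH] /=; first by rewrite mulmx1 QP.
    by rewrite IH /tr_str !mulmxA -[_ *m P *m Q]mulmxA PQ mulmx1.
  by rewrite H (ad_word_eq0 hC) ?mulmx0 ?mul0mx // size_map ss.
Qed.

Variables E F : V -> 'M[R]_n.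
Hypotheses (pE : polymx E) (pF : polymx F).
Hypothesis EF : forall x, E x *m F x = 1%:M.
Hypothesis mcE : forall (x u v : V), u *m 'D_v E x - v *m 'D_u E x =
  - ((u *m E x) *m ad C (v *m E x)).

Let E' x := E x *m P.
Let F' x := Q *m F x.
Let pE' : polymx E'. Proof. by apply: polymxM => //; apply: polymx_cst. Qed.
Let pF' : polymx F'. Proof. by apply: polymxM => //; apply: polymx_cst. Qed.
Let EF' x : E' x *m F' x = 1%:M.
Proof. by rewrite /E' /F' mulmxA -[_ *m P *m Q]mulmxA PQ mulmx1. Qed.
Let mcE' (x u v : V) : u *m 'D_v E' x - v *m 'D_u E' x =
  - ((u *m E' x) *m ad (tr_str P Q C) (v *m E' x)).
Proof.
have dE' w : 'D_w E' x = 'D_w E x *m P.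
  rewrite /E' polymx_deriveM //; last exact: polymx_cst.
  by rewrite derive_cst mulmx0 addr0.
rewrite !dE' !mulmxA -mulmxBl mcE mulNmx; congr (- _).
by rewrite ad_tr_str /E' !mulmxA -![_ *m P *m Q]mulmxA PQ !mulmx1.
Qed.

Let metricE : (fun x => E x *m (P *m P^T) *m (E x)^T) = (fun x => E' x *m (E' x)^T).
Proof. by apply/funext => x; rewrite /E' trmx_mul !mulmxA. Qed.

Definition ric_mx (D : 'I_n -> 'M[R]_n) : 'M[R]_n := \matrix_(b, k) ric_nil D b k.

Lemma Rc_metric x : Rc (fun x => E x *m (P *m P^T) *m (E x)^T) x =
  E x *m (P *m ric_mx (tr_str P Q C) *m P^T) *m (E x)^T.
Proof.
have hT := nil_lie_tr; have [sk _ _] := hT.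
rewrite metricE (Rc_frame sk pE' pF' EF' mcE').
have -> : ric_frame (tr_str P Q C) = ric_mx (tr_str P Q C).
  by apply/matrixP => b k; rewrite (ric_frameE hT) [RHS]mxE.
by rewrite /E' trmx_mul !mulmxA.
Qed.

Lemma norm_Rm_metric x : norm_Rm (fun x => E x *m (P *m P^T) *m (E x)^T) x =
  Num.sqrt (\sum_k \sum_l \sum_p \sum_q
    curv_frame (tr_str P Q C) (delta_mx 0 p) (delta_mx 0 q) k l ^+ 2).
Proof.
have hT := nil_lie_tr; have [sk _ _] := hT.
by rewrite metricE (norm_Rm_frame sk pE' pF' EF' mcE').
Qed.

End ChangeOfBasis.

(** * Curvature bounded by the bracket *)

Section Bounds.
Variables (R : realType) (n : nat).
Variable C : 'I_n -> 'M[R]_n.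

Definition str_norm2 : R := \sum_a \sum_b \sum_k C a b k ^+ 2.

Lemma str_norm2_ge0 : 0 <= str_norm2.
Proof. by do 3!apply: sumr_ge0 => ? _; rewrite sqr_ge0. Qed.

Lemma str_le a b k : C a b k ^+ 2 <= str_norm2.
Proof.
rewrite /str_norm2 (bigD1 a) //= (bigD1 b) //= (bigD1 k) //= -!addrA lerDl.
by rewrite !addr_ge0 //; do ?[apply: sumr_ge0 => ? _]; rewrite ?sqr_ge0.
Qed.

(** With r the norm of the bracket, entries of [C] are at most r and those of [koszul] at most 2 r.
    The three sums contribute 2 + 4 + 4 = 10 times n r^2. *)
Lemma curv_frame_bound p q k l :
  `|curv_frame C (delta_mx 0 p) (delta_mx 0 q) k l| <= 10 * n%:R * str_norm2.
Proof.
set r := Num.sqrt str_norm2.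
have r2 : r ^+ 2 = str_norm2 by rewrite sqr_sqrtr // str_norm2_ge0.
have r0 : 0 <= r by exact: sqrtr_ge0.
have Cr a b d : `|C a b d| <= r by rewrite -sqrtr_sqr ler_wsqrtr // str_le.
have Kr a b d : `|koszul C a b d| <= 2 * r.
  rewrite mxE normrM ger0_norm ?invr_ge0 //.
  have : `|C a b d - C b d a + C d a b| <= 3 * r.
    apply: (le_trans (ler_normD _ _)); apply: (le_trans (lerD (ler_normB _ _) (lexx _))).
    by have := Cr a b d; have := Cr b d a; have := Cr d a b; lra.
  lra.
have sumB (F : 'I_n -> R) b : (forall m, `|F m| <= b) -> `|\sum_m F m| <= n%:R * b.
  move=> h; apply: (le_trans (ler_norm_sum _ _ _)).
  apply: (le_trans (ler_sum _ (fun m _ => h m))).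
  by rewrite sumr_const card_ord mulr_natl.
have prodB x y bx b : `|x| <= bx -> `|y| <= b -> `|x * y| <= bx * b :> R.
  by move=> hx hy; rewrite normrM ler_pM.
rewrite curv_frame_entry -r2.
apply: (le_trans (ler_normB _ _)); apply: (le_trans (lerD (ler_normD _ _) (lexx _))); rewrite normrN.
have s1 := sumB _ _ (fun m => prodB _ _ _ _ (Cr p q m) (Kr m k l)).
have s2 := sumB _ _ (fun m => prodB _ _ _ _ (Kr q k m) (Kr p m l)).
have s3 := sumB _ _ (fun m => prodB _ _ _ _ (Kr p k m) (Kr q m l)).
apply: (le_trans (lerD (lerD s1 s2) s3)).
by rewrite le_eqVlt; apply/orP; left; apply/eqP; ring.
Qed.

(** The four free indices give n^4 squared entries, hence a factor n^2 besides the n of the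
    entrywise bound. *)
Lemma norm_curv_frame_le :
  Num.sqrt (\sum_k \sum_l \sum_p \sum_q curv_frame C (delta_mx 0 p) (delta_mx 0 q) k l ^+ 2)
  <= 10 * n%:R ^+ 3 * str_norm2.
Proof.
set b := 10 * n%:R * str_norm2.
have b0 : 0 <= b by rewrite /b !mulr_ge0 ?str_norm2_ge0.
have -> : 10 * n%:R ^+ 3 * str_norm2 = Num.sqrt (n%:R ^+ 4 * b ^+ 2).
  have -> : n%:R ^+ 4 * b ^+ 2 = (n%:R ^+ 2 * b) ^+ 2 by ring.
  have nb0 : 0 <= n%:R ^+ 2 * b by rewrite mulr_ge0 // exprn_ge0.
  by rewrite sqrtr_sqr (ger0_norm nb0) /b; ring.
rewrite ler_wsqrtr //.
have h (F : 'I_n -> R) x : (forall i, F i <= x) -> \sum_i F i <= n%:R * x.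
  move=> Fx; apply: (le_trans (ler_sum _ (fun i _ => Fx i))).
  by rewrite sumr_const card_ord mulr_natl.
rewrite [leRHS](_ : _ = n%:R * (n%:R * (n%:R * (n%:R * b ^+ 2)))); last by ring.
do 4!(apply: (h _ _) => ?).
by rewrite -real_normK ?num_real // lerXn2r ?nnegrE // curv_frame_bound.
Qed.

End Bounds.

(** * Calculus of curves of matrices *)

Section OneVariable.
Variable R : realType.
Implicit Types (f g : R -> R) (t d : R).
Local Notation rder t f d := (is_derive (t : R) (1 : R) (f : R -> R) (d : R)).

Lemma rderC t c : rder t (fun=> c) 0.
Proof. exact: is_derive_cst. Qed.

Lemma rderD t f g d d' : rder t f d -> rder t g d' -> rder t (fun s => f s + g s) (d + d').
Proof. by move=> df dg; exact: is_deriveD. Qed.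

Lemma rderN t f d : rder t f d -> rder t (fun s => - f s) (- d).
Proof. by move=> df; exact: is_deriveN. Qed.

Lemma rderM t f g d d' : rder t f d -> rder t g d' ->
  rder t (fun s => f s * g s) (d * g t + f t * d').
Proof.
move=> df dg; apply: (is_derive_eq (is_deriveM df dg)).
by rewrite addrC; congr (_ + _); rewrite -[LHS]/(g t * d) mulrC.
Qed.

Lemma rderV t f d : f t != 0 -> rder t f d -> rder t (fun s => (f s)^-1) (- (f t ^- 2) * d).
Proof.
move=> ft [df <-]; apply: DeriveDef; first exact: derivableV.
exact: deriveV.
Qed.

Lemma rder_sum t (I : Type) (r : seq I) (P : pred I) (f : I -> R -> R) (d : I -> R) :
  (forall i, rder t (f i) (d i)) ->
  rder t (fun s => \sum_(i <- r | P i) f i s) (\sum_(i <- r | P i) d i).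
Proof.
move=> h; elim: r => [|i r IH].
  by under eq_fun do rewrite big_nil; rewrite big_nil; apply: rderC.
under eq_fun do rewrite big_cons; rewrite big_cons.
by case: (P i) => //; apply: rderD.
Qed.

Lemma derivable_prodr t (I : Type) (r : seq I) (f : I -> R -> R) :
  (forall i, derivable (f i) t 1) -> derivable (fun s => \prod_(i <- r) f i s) t 1.
Proof.
move=> h; elim: r => [|i r IH].
  by under eq_fun do rewrite big_nil; apply: derivable_cst.
by under eq_fun do rewrite big_cons; exact: (derivableM (h i) IH).
Qed.

Lemma derivable_sumr t (I : Type) (r : seq I) (f : I -> R -> R) :
  (forall i, derivable (f i) t 1) -> derivable (fun s => \sum_(i <- r) f i s) t 1.
Proof.
move=> h; elim: r => [|i r IH].
  by under eq_fun do rewrite big_nil; apply: derivable_cst.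
by under eq_fun do rewrite big_cons; exact: (derivableD (h i) IH).
Qed.

Definition mder t m p (A : R -> 'M[R]_(m, p)) (D : 'M[R]_(m, p)) :=
  forall i j, rder t (fun s => A s i j) (D i j).

Lemma mderC t m p (A : 'M[R]_(m, p)) : mder t (fun=> A) 0.
Proof. by move=> i j; rewrite mxE; apply: rderC. Qed.

Lemma mderM t m p q (A : R -> 'M[R]_(m, p)) (B : R -> 'M[R]_(p, q)) D D' :
  mder t A D -> mder t B D' -> mder t (fun s => A s *m B s) (D *m B t + A t *m D').
Proof.
move=> dA dB i j; under eq_fun do rewrite mxE.
rewrite !mxE -big_split /=; apply: rder_sum => k.
exact: (rderM (dA i k) (dB k j)).
Qed.

Lemma mder_uniq t m p (A : R -> 'M[R]_(m, p)) D D' : mder t A D -> mder t A D' -> D = D'.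
Proof.
move=> h h'; apply/matrixP => i j.
by rewrite -(@derive_val _ _ _ _ _ _ _ (h i j)) -(@derive_val _ _ _ _ _ _ _ (h' i j)).
Qed.

Lemma derivable_det t n (A : R -> 'M[R]_n) :
  (forall i j, derivable (fun s => A s i j) t 1) -> derivable (fun s => \det (A s)) t 1.
Proof.
move=> h; apply: derivable_sumr => s; apply: derivableM; first exact: derivable_cst.
by apply: derivable_prodr => i; apply: h.
Qed.

(** Cramer's rule gives differentiability, all matrices near [t] being invertible as [t] is
    positive. The value then comes from differentiating [invmx (A s) *m A s], which is locally
    constant. *)
Lemma mder_invmx t n (A : R -> 'M[R]_n) D : (forall s, 0 < s -> A s \in unitmx) -> 0 < t ->
  mder t A D -> mder t (fun s => invmx (A s)) (- (invmx (A t) *m D *m invmx (A t))).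
Proof.
move=> uA t0 dA.
have dAij i j : derivable (fun s => A s i j) t 1 by have [] := dA i j.
have dI i j : derivable (fun s => (\det (A s))^-1 * (\adj (A s)) i j) t 1.
  apply: derivableM.
    apply: derivableV; last exact: derivable_det.
    by have := uA t t0; rewrite unitmxE unitfE.
  under eq_fun do rewrite mxE; apply: derivableM; first exact: derivable_cst.
  by apply: derivable_det => a b; under eq_fun do rewrite !mxE; apply: dAij.
have near_eq i j : \forall s \near t, (\det (A s))^-1 * (\adj (A s)) i j = invmx (A s) i j.
  near=> s; rewrite /invmx uA ?mxE //; near: s; exact: lt_nbhsr.
have [H dH] : exists H, mder t (fun s => invmx (A s)) H.
  exists (\matrix_(i, j) 'D_1 (fun s => (\det (A s))^-1 * (\adj (A s)) i j) t) => i j.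
  rewrite mxE; apply: (near_eq_is_derive (near_eq i j)).
  exact: derivableP.
suff <- : H = - (invmx (A t) *m D *m invmx (A t)) by [].
have uAt := uA t t0.
have prod := mderM dH dA.
have prod0 : mder t (fun s => invmx (A s) *m A s) 0.
  move=> i j; apply: (near_eq_is_derive (f := fun=> (1%:M : 'M[R]_n) i j)).
  - by near=> s; rewrite mulVmx // uA //; near: s; exact: lt_nbhsr.
  - by rewrite [X in is_derive _ _ _ X]mxE; apply: rderC.
have /eqP := mder_uniq prod prod0; rewrite addr_eq0 => /eqP h.
by rewrite -[H](mulmxK uAt) h mulNmx.
Unshelve. all: by end_near. Qed.

Lemma rder_continuous t f d : rder t f d -> {for t, continuous f}.
Proof. by case=> df _; apply/differentiable_continuous/derivable1_diffP. Qed.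

Lemma rder_MVT f (df : R -> R) s t : s < t ->
  (forall u, s <= u <= t -> rder u f (df u)) ->
  exists2 u, s < u < t & f t - f s = df u * (t - s).
Proof.
move=> st fd; have [x|x|x xst ->] := @MVT R f df s t st.
- by rewrite in_itv /= => /andP[sx xt]; apply: fd; rewrite !ltW.
- apply: continuous_in_subspaceT => {}x; rewrite inE /= in_itv /= => sxt.
  exact: (rder_continuous (fd x sxt)).
- by exists x => //; move: xst; rewrite in_itv.
Qed.

(* If f' <= - f^2 / c then 1 / f increases at rate at least 1 / c. *)
Lemma riccati_bound f (df : R -> R) c : 0 < c -> (forall t, 0 < t -> 0 <= f t) ->
  (forall t, 0 < t -> rder t f (df t)) -> (forall t, 0 < t -> df t <= - (f t ^+ 2 / c)) ->
  forall t, 0 < t -> f t <= c / t.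
Proof.
move=> c0 f0 fd dfle t t0; rewrite leNgt; apply/negP => lt.
have ft0 : 0 < f t by apply: le_lt_trans lt; rewrite divr_ge0 // ltW.
have cft : c / f t < t by rewrite ltr_pdivrMr // mulrC -ltr_pdivrMr.
(* This [s] is positive, so the hypotheses hold on all of [s, t], and [t - s] still exceeds
   [c / f t]: growth of 1 / f at rate 1 / c over that time would carry it past its value at [t]. *)
pose s := (t - c / f t) / 2.
have cf0 : 0 < c / f t by rewrite divr_gt0.
have s0 : 0 < s by rewrite /s; lra.
have st : s < t by rewrite /s; lra.
have dfle0 u : 0 < u -> df u <= 0.
  by move=> u0; apply: (le_trans (dfle u u0)); rewrite oppr_le0 divr_ge0 ?sqr_ge0 // ltW.
have fge u : s <= u -> u <= t -> f t <= f u.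
  move=> su; rewrite le_eqVlt => /orP[/eqP->//|ut].
  have [x /andP[sx xt]] := @rder_MVT f df u t ut (fun x h => fd x (lt_le_trans s0 (le_trans su (proj1 (andP h))))).
  have x0 : 0 < x by apply: lt_trans sx; apply: lt_le_trans su.
  have := dfle0 x x0 => d0 e; rewrite -subr_le0 e.
  by rewrite mulr_le0_ge0 // subr_ge0 ltW.
have fpos u : s <= u <= t -> 0 < f u by move=> /andP[su ut]; apply: lt_le_trans (fge u su ut).
have [|x sxt] := @rder_MVT (fun u => (f u)^-1) (fun u => - (f u ^- 2) * df u) s t st.
  move=> u sut; have u0 : 0 < u by case/andP: sut => su _; apply: lt_le_trans su.
  by apply: rderV; [rewrite gt_eqF // fpos | apply: fd].
have /andP[sx xt] := sxt.
have fx : 0 < f x by apply: fpos; rewrite !ltW.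
have x0 : 0 < x by apply: lt_trans sx.
have low : c^-1 <= - (f x ^- 2) * df x.
  rewrite mulNr -mulrN -(ler_pM2l (x := f x ^+ 2)) ?exprn_gt0 // mulrA divff ?expf_neq0 ?gt_eqF // mul1r.
  by rewrite lerNr; apply: dfle.
have fs : 0 < (f s)^-1 by rewrite invr_gt0 fpos // lexx ltW.
move=> e; have h1 : c^-1 * (t - s) <= (f t)^-1 - (f s)^-1.
  by rewrite e ler_pM2r // subr_gt0.
have h2 : t - s < c / f t.
  have : c^-1 * (t - s) < (f t)^-1 by lra.
  by rewrite mulrC ltr_pdivrMr // mulrC.
by move: h2; rewrite /s; lra.
Qed.

End OneVariable.

(** * The energy identity *)

(** Block elimination: the first pivot [s] is positive, and the Schur complement [S] at [v] is the
    value of the form at the extension of [v] whose first coordinate cancels the mixed terms. *)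
Lemma cholesky (R : rcfType) n (A : 'M[R]_n) : A^T = A ->
  (forall v : 'rV[R]_n, v != 0 -> 0 < (v *m A *m v^T) 0 0) ->
  exists P : 'M[R]_n, P *m P^T = A.
Proof.
elim: n A => [|n IH] A; first by exists 0; rewrite [LHS]flatmx0 [RHS]flatmx0.
rewrite -[n.+1]/(1 + n)%N in A *; move=> sA pA.
pose a := ulsubmx A; pose b := ursubmx A; pose D := drsubmx A.
have dl : dlsubmx A = b^T by rewrite -[in LHS]sA /b trmx_ursub.
have AE : A = block_mx a b b^T D by rewrite -dl submxK.
have aT : a = (a 0 0)%:M by rewrite [LHS]mx11_scalar.
set s := a 0 0 in aT.
have s0 : 0 < s.
  have := pA (row_mx 1%:M 0); rewrite AE mul_row_block !mul1mx !mul0mx !addr0.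
  rewrite tr_row_mx trmx1 trmx0 mul_row_col mulmx1 mulmx0 addr0; apply.
  apply/eqP => /(congr1 lsubmx); rewrite row_mxKl -(row_mx0 _ 1 1 n) row_mxKl.
  by move=> /matrixP/(_ 0 0); rewrite !mxE => /eqP; rewrite oner_eq0.
have DT : D^T = D by rewrite /D trmx_drsub sA.
pose S := D - s^-1 *: (b^T *m b).
have [||L LE] := IH S.
- by rewrite /S linearB linearZ /= trmx_mul trmxK DT.
- move=> v v0; have := pA (row_mx (- s^-1 *: (v *m b^T)) v).
  rewrite AE aT mul_row_block tr_row_mx mul_row_col mul_mx_scalar scalerA mulrN divff ?gt_eqF //.
  rewrite scaleN1r addNr mul0mx add0r => /(_ _)/lt_le_trans; apply.
    apply/negP => /eqP /(congr1 rsubmx); rewrite row_mxKr -(row_mx0 _ 1 1 n) row_mxKr.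
    by move=> e; rewrite e eqxx in v0.
  rewrite /S mulmxBr -scalemxAr -!scalemxAl scaleNr addrC mulmxA.
  exact: lexx.
exists (block_mx (Num.sqrt s)%:M 0 ((Num.sqrt s)^-1 *: b^T) L).
rewrite AE tr_block_mx mulmx_block !trmx0 !mul0mx !mulmx0 !addr0 LE tr_scalar_mx.
have sq : Num.sqrt s * Num.sqrt s = s by rewrite -expr2 sqr_sqrtr // ltW.
have sn : Num.sqrt s != 0 by rewrite gt_eqF // sqrtr_gt0.
rewrite linearZ /= trmxK -scalar_mxM sq -aT mul_scalar_mx scalerA divff // scale1r.
rewrite mul_mx_scalar scalerA divff // scale1r -scalemxAl -scalemxAr scalerA -invfM sq.
by rewrite /S addrC subrK.
Qed.

(** * The polarized norm of the bracket and the Ricci form *)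

Section Quad.
Variables (R : realType) (n : nat).
Implicit Type C : 'I_n -> 'M[R]_n.

(* The square norm of the bracket C, polarized in the (inverse) metrics H1 and H2
   on the arguments and the metric A on the values. *)
Definition quad3 C (H1 H2 A : 'M[R]_n) : R :=
  \sum_a \sum_a' \sum_k \sum_k' \sum_b' \sum_b
    (C a b k * C a' b' k') * (H1 a a' * (H2 b b' * A k k')).

Lemma quad3_tr C H1 H2 A : quad3 C H1 H2 A =
  \sum_a \sum_a' H1 a a' * \tr ((C a)^T *m H2 *m C a' *m A^T).
Proof.
apply: eq_bigr => a _; apply: eq_bigr => a' _.
rewrite /mxtrace mulr_sumr; apply: eq_bigr => k _.
rewrite [X in _ = _ * X]mxE mulr_sumr; apply: eq_bigr => k' _.
rewrite [X in _ = _ * (X * _)]mxE mulr_suml mulr_sumr; apply: eq_bigr => b' _.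
rewrite [X in _ = _ * (X * _ * _)]mxE !mulr_suml mulr_sumr; apply: eq_bigr => b _.
rewrite [(C a)^T _ _]mxE [A^T _ _]mxE.
by move: (C a b k) (C a' b' k') (H1 a a') (H2 b b') (A k k') => *; ring.
Qed.

(** This allows computing in a basis where the metric is the identity. *)
Lemma quad3_change C (P Q H1 H2 A : 'M[R]_n) : P *m Q = 1%:M ->
  quad3 (tr_str P Q C) (P^T *m H1 *m P) (P^T *m H2 *m P) (Q *m A *m Q^T) = quad3 C H1 H2 A.
Proof.
move=> PQ; have QP := mulmx1C PQ; rewrite !quad3_tr.
have PQT : Q^T *m P^T = 1%:M by rewrite -trmx_mul PQ trmx1.
have QPT : P^T *m Q^T = 1%:M by rewrite -trmx_mul QP trmx1.
pose X : 'M[R]_n := \matrix_(c, c') \tr ((C c)^T *m H2 *m C c' *m A^T).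
have fE u v : \tr ((ad C u)^T *m H2 *m ad C v *m A^T) = \sum_c \sum_c' u 0 c * v 0 c' * X c c'.
  have -> : (ad C u)^T = \sum_c u 0 c *: (C c)^T.
    by rewrite /ad linear_sum; apply: eq_bigr => c _; rewrite linearZ.
  rewrite !mulmx_suml linear_sum; apply: eq_bigr => c _ /=.
  rewrite -!scalemxAl linearZ /= (_ : ad C v = \sum_c v 0 c *: C c) //.
  rewrite mulmx_sumr mulmx_suml linear_sum mulr_sumr.
  by apply: eq_bigr => c' _ /=; rewrite -scalemxAr -scalemxAl linearZ /= mulrA mxE.
transitivity (\sum_a \sum_a' (P^T *m H1 *m P) a a' * (Q *m X *m Q^T) a a').
  apply: eq_bigr => a _; apply: eq_bigr => a' _; congr (_ * _).
  have -> : \tr ((tr_str P Q C a)^T *m (P^T *m H2 *m P) *m tr_str P Q C a' *m (Q *m A *m Q^T)^T)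
     = \tr ((ad C (row a Q))^T *m H2 *m ad C (row a' Q) *m A^T).
    rewrite /tr_str !trmx_mul !trmxK !mulmxA.
    rewrite -[_ *m Q^T *m P^T]mulmxA PQT mulmx1 -![_ *m P *m Q]mulmxA PQ !mulmx1.
    by rewrite -!mulmxA mxtrace_mulC -!mulmxA PQT mulmx1 !mulmxA.
  rewrite fE [RHS]mxE exchange_big; apply: eq_bigr => c' _ /=.
  rewrite [X in _ = X * _]mxE mulr_suml; apply: eq_bigr => c _.
  by rewrite !mxE; move: (\tr _) => x; ring.
rewrite -mxtrace_trmul.
have -> : (P^T *m H1 *m P)^T *m (Q *m X *m Q^T) = P^T *m (H1^T *m X *m Q^T).
  by rewrite !trmx_mul trmxK !mulmxA -[_ *m P *m Q]mulmxA PQ mulmx1.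
rewrite mxtrace_mulC -[_ *m Q^T *m P^T]mulmxA PQT mulmx1.
by rewrite mxtrace_trmul; apply: eq_bigr => c _; apply: eq_bigr => c' _; rewrite mxE.
Qed.

Lemma quad3_deriv C (H A : R -> 'M[R]_n) t H' A' : mder t H H' -> mder t A A' ->
  is_derive t 1 (fun s => quad3 C (H s) (H s) (A s))
    (quad3 C H' (H t) (A t) + quad3 C (H t) H' (A t) + quad3 C (H t) (H t) A').
Proof.
move=> dH dA; rewrite /quad3 -!big_split /=; apply: rder_sum => a.
rewrite -!big_split /=; apply: rder_sum => a'.
rewrite -!big_split /=; apply: rder_sum => k.
rewrite -!big_split /=; apply: rder_sum => k'.
rewrite -!big_split /=; apply: rder_sum => b'.
rewrite -!big_split /=; apply: rder_sum => b.
apply: (is_derive_eq (rderM (rderC t (C a b k * C a' b' k')) (rderM (dH a a') (rderM (dH b b') (dA k k'))))).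
by ring.
Qed.

(** For a skew bracket the first two summands coincide and this is [ric_nil]. The split form has one
    summand for each slot of [quad3]: up to sign and the factor 1/4, it collects the gradients of
    the norm in its three metric arguments. *)
Definition ric_sym C : 'M[R]_n := - 4^-1 *: ((\matrix_(b, c) \tr ((C b)^T *m C c))
  + \sum_i C i *m (C i)^T) + 4^-1 *: \sum_i (C i)^T *m C i.

Lemma ric_sym_tr C : (ric_sym C)^T = ric_sym C.
Proof.
apply/matrixP => b c; rewrite [LHS]mxE /ric_sym !mxE !summxE.
have -> : \tr ((C c)^T *m C b) = \tr ((C b)^T *m C c) by rewrite -mxtrace_tr trmx_mul trmxK.
have symm (F : 'I_n -> 'M[R]_n) : (forall i, (F i)^T = F i) -> \sum_i F i c b = \sum_i F i b c.
  by move=> FT; apply: eq_bigr => i _; rewrite -[in LHS]FT mxE.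
by rewrite !symm // => i; rewrite trmx_mul trmxK.
Qed.

Lemma ric_nil_sym C : nil_lie C -> ric_mx C = ric_sym C.
Proof.
case=> sk _ _; have skc a b k : C a b k = - C b a k.
  by have /rowP/(_ k) := sk a b; rewrite !mxE.
apply/matrixP => b c; rewrite mxE /ric_nil /ric_sym !mxE mxtrace_trmul !summxE.
have -> : \sum_i (C i *m (C i)^T) b c = \sum_i \sum_m C b i m * C c i m.
  apply: eq_bigr => i _; rewrite mxE; apply: eq_bigr => m _.
  by rewrite mxE (skc i b) (skc i c) mulrNN.
have -> : \sum_i ((C i)^T *m C i) b c = \sum_i \sum_m C i m b * C i m c.
  by apply: eq_bigr => i _; rewrite mxE; apply: eq_bigr => m _; rewrite mxE.
by field.
Qed.

Lemma quad3_id C : quad3 C 1%:M 1%:M 1%:M = str_norm2 C.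
Proof.
rewrite quad3_tr /str_norm2; apply: eq_bigr => a _.
rewrite (bigD1 a) //= big1 ?addr0 => [|i ia]; last by rewrite mxE eq_sym (negPf ia) mul0r.
rewrite mxE eqxx mul1r trmx1 !mulmx1 mxtrace_trmul.
by apply: eq_bigr => b _; apply: eq_bigr => k _; rewrite expr2.
Qed.

Lemma sum_id_l (r : 'I_n -> 'I_n -> R) : \sum_a \sum_b (1%:M : 'M[R]_n) a b * r a b = \sum_a r a a.
Proof.
apply: eq_bigr => a _; rewrite (bigD1 a) //= big1 ?addr0 => [|i ia].
  by rewrite mxE eqxx mul1r.
by rewrite mxE eq_sym (negPf ia) mul0r.
Qed.

(** The three terms pair 2 r, 2 r and - 2 r with the three summands of [r], whose signed sum is - 4
    r; this is the origin of the 8. *)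
Lemma quad3_ric C (r := ric_sym C) :
  quad3 C (2 *: r) 1%:M 1%:M + quad3 C 1%:M (2 *: r) 1%:M + quad3 C 1%:M 1%:M (- 2 *: r)
  = - 8 * \tr (r^T *m r).
Proof.
rewrite !quad3_tr !sum_id_l.
pose M1 : 'M[R]_n := \matrix_(b, c) \tr ((C b)^T *m C c).
have rT : r^T = r := ric_sym_tr C.
have -> : \sum_a \sum_a' (2 *: r) a a' * \tr ((C a)^T *m 1%:M *m C a' *m 1%:M^T) = 2 * \tr (r^T *m M1).
  rewrite mxtrace_trmul mulr_sumr; apply: eq_bigr => a _; rewrite mulr_sumr; apply: eq_bigr => b _.
  by rewrite trmx1 !mulmx1 !mxE mulrA.
have -> : \sum_a \tr ((C a)^T *m (2 *: r) *m C a *m 1%:M^T) = 2 * \tr (r^T *m \sum_i C i *m (C i)^T).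
  rewrite mulmx_sumr linear_sum mulr_sumr; apply: eq_bigr => a _ /=.
  rewrite trmx1 mulmx1 -scalemxAr -scalemxAl linearZ /= rT; congr (_ * _).
  by rewrite -mulmxA mxtrace_mulC mulmxA.
have -> : \sum_a \tr ((C a)^T *m 1%:M *m C a *m (- 2 *: r)^T) = - 2 * \tr (r^T *m \sum_i (C i)^T *m C i).
  rewrite mulmx_sumr linear_sum mulr_sumr; apply: eq_bigr => a _ /=.
  rewrite mulmx1 linearZ /= -scalemxAr linearZ /=; congr (_ * _).
  by rewrite mxtrace_mulC.
have -> : \tr (r^T *m r) = - 4^-1 * (\tr (r^T *m M1) + \tr (r^T *m \sum_i C i *m (C i)^T))
    + 4^-1 * \tr (r^T *m \sum_i (C i)^T *m C i).
  by rewrite {2}/r /ric_sym -/M1 mulmxDr -!scalemxAr linearD /= !linearZ /= mulmxDr linearD.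
by field.
Qed.

Lemma trace_ric_sym C : \tr (ric_sym C) = - 4^-1 * str_norm2 C.
Proof.
have trE (X : 'M[R]_n) : \tr (X^T *m X) = \sum_b \sum_k X b k ^+ 2.
  by rewrite mxtrace_trmul; apply: eq_bigr => b _; apply: eq_bigr => k _; rewrite expr2.
rewrite /ric_sym linearD /= !linearZ /= linearD /= !linear_sum /=.
have -> : \tr (\matrix_(b, c) \tr ((C b)^T *m C c)) = str_norm2 C.
  by apply: eq_bigr => a _; rewrite mxE trE.
have -> : \sum_i \tr (C i *m (C i)^T) = str_norm2 C.
  by apply: eq_bigr => a _; rewrite mxtrace_mulC trE.
have -> : \sum_i \tr ((C i)^T *m C i) = str_norm2 C.
  by apply: eq_bigr => a _; rewrite trE.
by field.
Qed.

(** Cauchy-Schwarz on the diagonal, weakened from n to n + 1 so that the denominator is nonzero in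
    dimension 0. The proof expands the sum of squared deviations from [l]. *)
Lemma mxtrace_sqr_le (r : 'M[R]_n) : \tr r ^+ 2 / n.+1%:R <= \tr (r^T *m r).
Proof.
pose l := \tr r / n.+1%:R.
have n0 : 0 < n.+1%:R :> R by rewrite ltr0n.
have h1 : 0 <= \sum_i (r i i - l) ^+ 2 by apply: sumr_ge0 => i _; apply: sqr_ge0.
have h2 : \sum_i r i i ^+ 2 <= \tr (r^T *m r).
  rewrite mxtrace_trmul; apply: ler_sum => i _; rewrite (bigD1 i) //= expr2 lerDl.
  by apply: sumr_ge0 => j _; rewrite -expr2 sqr_ge0.
have h3 : \sum_i (r i i - l) ^+ 2 = \sum_i r i i ^+ 2 - 2 * l * \tr r + n%:R * l ^+ 2.
  have -> : n%:R * l ^+ 2 = \sum_(i < n) l ^+ 2 by rewrite sumr_const card_ord mulr_natl.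
  rewrite /mxtrace mulr_sumr -sumrN -!big_split /=.
  by apply: eq_bigr => i _; ring.
have h4 : \tr r = l * n.+1%:R by rewrite /l divfK // gt_eqF.
have h5 : \tr r ^+ 2 / n.+1%:R = l * \tr r by rewrite /l expr2 mulrAC.
have h6 : 0 <= l ^+ 2 by apply: sqr_ge0.
move: h1; rewrite h3 h5 => h1.
have h7 : n%:R * l ^+ 2 = l * \tr r - l ^+ 2 by rewrite h4 -[n.+1]addn1 natrD; ring.
by move: h1 h2 h6 h7; lra.
Qed.

Lemma energy_decay C : quad3 C (2 *: ric_sym C) 1%:M 1%:M + quad3 C 1%:M (2 *: ric_sym C) 1%:M
  + quad3 C 1%:M 1%:M (- 2 *: ric_sym C) <= - (str_norm2 C ^+ 2 / (2 * n.+1%:R)).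
Proof.
rewrite quad3_ric; have := mxtrace_sqr_le (ric_sym C); rewrite trace_ric_sym => h.
have n0 : n.+1%:R != 0 :> R by rewrite pnatr_eq0.
have e : (- 4^-1 * str_norm2 C) ^+ 2 / n.+1%:R = (str_norm2 C ^+ 2 / (2 * n.+1%:R)) / 8 by field.
by move: h; rewrite e; move: (_ / (2 * _)) (\tr _) => x y; lra.
Qed.

End Quad.

(** * Invariant solutions of the Ricci flow *)

Section DifferenceQuotients.
Variable R : realType.
Local Open Scope classical_set_scope.

Lemma rder_quotP (f : R -> R) (t d : R) : is_derive t (1 : R) f d <->
  forall e, 0 < e -> exists2 r, 0 < r &
    forall s, s != t -> `|s - t| < r -> `|d - (s - t)^-1 * (f s - f t)| <= e.
Proof.
split=> [[df <-] e e0|h].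
  have /cvgrPdist_le/(_ e e0) : (fun h => h^-1 *: ((f \o shift t) (h *: 1) - f t)) @ 0^' --> 'D_1 f t by [].
  case=> r /= r0 h; exists r => // s st sr.
  have := h (s - t); rewrite /= sub0r normrN => /(_ sr).
  rewrite subr_eq0 st => /(_ isT).
  by rewrite [_ *: 1]mulr1 subrK.
have c : (fun h => h^-1 *: ((f \o shift t) (h *: 1) - f t)) @ 0^' --> d.
  apply/cvgrPdist_le => e e0; have [r r0 hr] := h e e0.
  exists r => //= x; rewrite /= sub0r normrN => xr x0.
  have := hr (x + t); rewrite addrK => /(_ _ xr).
  rewrite -subr_eq0 addrK => /(_ x0).
  by rewrite [_ *: 1]mulr1.
apply: DeriveDef; first by apply/cvg_ex; exists d.
exact: cvg_lim c.
Qed.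

Lemma mx_norm_leP m n (A : 'M[R]_(m, n)) e : 0 <= e ->
  `|A| <= e <-> forall i j, `|A i j| <= e.
Proof.
move=> e0; rewrite [`|A|]mx_normrE; split=> [h i j|h].
  apply: le_trans h; exact: (le_bigmax _ (fun ij : 'I_m * 'I_n => `|A ij.1 ij.2|) (i, j)).
by apply: bigmax_le => // -[i j] _; apply: h.
Qed.

Lemma one_sided_quotP m n (F : R -> 'M[R]_(m, n)) t (D : 'M[R]_(m, n)) :
  ((s - t)^-1 *: (F s - F t) @[s --> within [set s | 0 <= s] t^'] --> D) <->
  forall e, 0 < e -> exists2 r, 0 < r & forall s, 0 <= s -> s != t -> `|s - t| < r ->
    forall i j, `|D i j - (s - t)^-1 * (F s i j - F t i j)| <= e.
Proof.
split=> [/cvgrPdist_le h e e0|h].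
  have [r /= r0 hr] := h e e0; exists r => // s s0 st sr i j.
  have := hr s; rewrite /= distrC => /(_ sr st s0).
  by move/(mx_norm_leP _ (ltW e0))/(_ i j); rewrite !mxE.
apply/cvgrPdist_le => e e0; have [r r0 hr] := h e e0.
exists r => //= s; rewrite /= distrC => sr st s0.
by apply/(mx_norm_leP _ (ltW e0)) => i j; rewrite !mxE; apply: hr.
Qed.

Lemma one_sided_mder m n (F : R -> 'M[R]_(m, n)) t D : 0 < t ->
  ((s - t)^-1 *: (F s - F t) @[s --> within [set s | 0 <= s] t^'] --> D) -> mder t F D.
Proof.
move=> t0 /one_sided_quotP h i j; apply/rder_quotP => e e0.
have [r r0 hr] := h e e0; exists (Num.min r t); first by rewrite lt_min r0.
move=> s st; rewrite lt_min => /andP[sr slt]; apply: hr => //.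
by move: slt; rewrite ltr_distl => /andP[]; rewrite subrr => /ltW.
Qed.

Lemma mder_one_sided m n (F : R -> 'M[R]_(m, n)) t D : mder t F D ->
  ((s - t)^-1 *: (F s - F t) @[s --> within [set s | 0 <= s] t^'] --> D).
Proof.
move=> h; apply/one_sided_quotP => e e0.
have hij (ij : 'I_m * 'I_n) : exists r : R, 0 < r /\ forall s, s != t -> `|s - t| < r ->
   `|D ij.1 ij.2 - (s - t)^-1 * (F s ij.1 ij.2 - F t ij.1 ij.2)| <= e.
  by have [r r0 hr] := (rder_quotP _ _ _).1 (h ij.1 ij.2) e e0; exists r.
have [r hr] := choice hij.
exists (\big[Num.min/1]_ij r ij).
  by apply: (big_ind (fun x : R => 0 < x)) => [|x y x0 y0|ij _]; rewrite ?lt_min ?x0 ?ltr01 //; have [] := hr ij.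
move=> s s0 st lt i j; have [_ H] := hr (i, j); apply: H => //.
by apply: (lt_le_trans lt); exact: (bigmin_le 1 (i, j) r).
Qed.

End DifferenceQuotients.

(** * Left-invariant metrics and the decay estimate *)

Section InvariantMetrics.
Variables (R : realType) (n : nat).
Local Notation V := 'rV[R]_n.
Variable mu : {bilinear V -> V -> V}.
Hypothesis hmu : nilpotent_bracket mu.
Local Notation C := (str mu).
Local Notation E := (mcform mu).
Let hC := nil_lie_str hmu.

Definition mcform_inv (x : V) : 'M[R]_n := psim (expm (- ad C x)).

Lemma polymx_mcform_inv : polymx mcform_inv.
Proof.
apply: polymx_sum => k; apply: polymxZ; first exact: polyfun_cst.
apply: polymxX; apply: polymxD; last exact: polymx_cst.
apply: polymx_sum => j; apply: polymxZ; first exact: polyfun_cst.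
by apply: polymxX; apply: polymxN; apply: polymx_ad.
Qed.

Lemma mcform_invP x : E x *m mcform_inv x = 1%:M.
Proof.
apply: mulmx1C; rewrite /mcform_inv /mcform psim_phim //; first exact: nat_unit.
by rewrite -linearN /=; apply: ad_expn_eq0.
Qed.

Lemma mcform_unit x : E x \in unitmx.
Proof. by have [] := mulmx1_unit (mcform_invP x). Qed.

Lemma jacobian_bchN (x : V) : jacobian (bch mu (- x)) x = E x.
Proof.
apply/row_matrixP => i; rewrite !rowE -(bch_jacobian hmu (- x) x (delta_mx 0 i)).
by rewrite bchNx // mcform0 mulmx1.
Qed.

Lemma left_invariantE (G : V -> 'M[R]_n) : left_invariant mu G ->
  G = fun x => E x *m G 0 *m (E x)^T.
Proof.
move=> h; apply/funext => x; have /(congr1 (fun H => H x)) := h (- x).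
by rewrite /pullback bchNx // jacobian_bchN => <-.
Qed.

Lemma left_invariant_frame A : left_invariant mu (fun x => E x *m A *m (E x)^T).
Proof.
move=> y; apply/funext => x; rewrite /pullback.
have -> : E x = jacobian (bch mu y) x *m E (bch mu y x).
  by apply/row_matrixP => i; rewrite !rowE mulmxA bch_jacobian.
by rewrite trmx_mul !mulmxA.
Qed.

Lemma nil_metricE : nil_metric mu = fun x => E x *m 1%:M *m (E x)^T.
Proof. by apply/funext => x; rewrite /nil_metric /pullback jacobian_bchN. Qed.

Lemma frame_metric (P : 'M[R]_n) : P \in unitmx ->
  is_metric (fun x => E x *m (P *m P^T) *m (E x)^T).
Proof.
move=> uP; split.
- move=> i j; apply: polyfun_smooth.
  have pE := polymx_mcform mu.
  suff : polymx (fun x => E x *m (P *m P^T) *m (E x)^T) by apply.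
  by apply: polymxM; [apply: polymxM => //; apply: polymx_cst | apply: polymxT].
- by move=> x; rewrite !trmx_mul !trmxK !mulmxA.
- move=> x v v0; have -> : v *m (E x *m (P *m P^T) *m (E x)^T) *m v^T =
      (v *m (E x *m P)) *m (v *m (E x *m P))^T by rewrite !trmx_mul !mulmxA.
  have w0 : v *m (E x *m P) != 0.
    apply: contra_neq v0 => /(congr1 (mulmx^~ (invmx (E x *m P)))).
    by rewrite mul0mx mulmxK // unitmx_mul mcform_unit.
  move: (v *m _) w0 => w w0; rewrite mxE.
  have ge0 i : true -> 0 <= w 0 i * w^T i 0 by rewrite mxE -expr2 sqr_ge0.
  rewrite lt_def sumr_ge0 // andbT; apply: contra_neq w0 => s0.
  apply/rowP => i; have /eqP := s0; rewrite psumr_eq0 // => /allP/(_ i (mem_index_enum _)).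
  by rewrite /= !mxE mulf_eq0 orbb => /eqP.
Qed.

Lemma Rc_left_invariant P Q x : P *m Q = 1%:M ->
  Rc (fun x => E x *m (P *m P^T) *m (E x)^T) x =
  E x *m (P *m ric_sym (tr_str P Q C) *m P^T) *m (E x)^T.
Proof.
move=> PQ; rewrite (Rc_metric PQ hC (polymx_mcform mu) polymx_mcform_inv mcform_invP (mcform_structure hmu)).
by rewrite ric_nil_sym //; apply: nil_lie_tr.
Qed.

Lemma norm_Rm_left_invariant P Q x : P *m Q = 1%:M ->
  norm_Rm (fun x => E x *m (P *m P^T) *m (E x)^T) x <= 10 * n%:R ^+ 3 * str_norm2 (tr_str P Q C).
Proof.
move=> PQ; rewrite (norm_Rm_metric PQ hC (polymx_mcform mu) polymx_mcform_inv mcform_invP (mcform_structure hmu)).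
exact: norm_curv_frame_le.
Qed.

Theorem type_III_bound (g : R -> V -> 'M[R]_n) : invariant_ricci_flow_from mu g ->
  forall t, 0 < t -> forall x, norm_Rm (g t) x <= 10 * n%:R ^+ 3 * (2 * n.+1%:R) / t.
Proof.
case=> flow _ inv.
pose A t := g t 0.
have gE t : 0 <= t -> g t = fun x => E x *m A t *m (E x)^T.
  by move=> t0; apply: left_invariantE; apply: inv.
have chol t : 0 <= t -> exists PQ : 'M[R]_n * 'M[R]_n, PQ.1 *m PQ.2 = 1%:M /\ PQ.1 *m PQ.1^T = A t.
  move=> t0; have [[_ sym pos] _] := flow t t0.
  have [P PE] := cholesky (sym 0) (pos 0).
  have uP : P \in unitmx.
    rewrite -row_free_unit -kermx_eq0; apply/negPn/negP => /rowV0Pn[v /sub_kermxP vP v0].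
    by have := pos 0 v v0; rewrite -PE mulmxA vP !mul0mx mxE ltxx.
  by exists (P, invmx P); rewrite mulmxV.
have uA t : 0 < t -> A t \in unitmx.
  move=> t0; have [[P Q] /= [PQ <-]] := chol t (ltW t0).
  by rewrite unitmx_mul unitmx_tr andbb; case: (mulmx1_unit PQ).
(* The energy is expressed by [A t] and its inverse, whose derivatives are known. A factorization of
   [A t] at one fixed time then identifies it with [str_norm2] and its derivative with the left side
   of [energy_decay]. *)
pose f t := quad3 C (invmx (A t)) (invmx (A t)) (A t).
have invA (P Q : 'M[R]_n) : P *m Q = 1%:M -> invmx (P *m P^T) = Q^T *m Q.
  move=> PQ; have QP := mulmx1C PQ.
  have h : P *m P^T *m (Q^T *m Q) = 1%:M.
    by rewrite mulmxA -[P *m P^T *m Q^T]mulmxA -trmx_mul QP trmx1 mulmx1.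
  by have [u _] := mulmx1_unit h; rewrite -[RHS](mulKmx u) h mulmx1.
have fE t (P Q : 'M[R]_n) : P *m Q = 1%:M -> P *m P^T = A t -> f t = str_norm2 (tr_str P Q C).
  move=> PQ PA; have QP := mulmx1C PQ.
  rewrite /f -(quad3_change _ _ _ _ PQ) -quad3_id -PA (invA P Q PQ).
  have -> : P^T *m (Q^T *m Q) *m P = 1%:M.
    by rewrite mulmxA -trmx_mul QP trmx1 mul1mx.
  by rewrite !mulmxA QP mul1mx -trmx_mul QP trmx1.
have dA t : 0 < t -> mder t A (- 2 *: Rc (g t) 0).
  by move=> t0; apply: one_sided_mder => //; have [_ h] := flow t (ltW t0); apply: h.
pose df t := let D := - 2 *: Rc (g t) 0 in let D' := - (invmx (A t) *m D *m invmx (A t)) in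
  quad3 C D' (invmx (A t)) (A t) + quad3 C (invmx (A t)) D' (A t) + quad3 C (invmx (A t)) (invmx (A t)) D.
have df_le t : 0 < t -> df t <= - (f t ^+ 2 / (2 * n.+1%:R)).
  move=> t0; have [[P Q] /= [PQ PA]] := chol t (ltW t0); have QP := mulmx1C PQ.
  rewrite (fE t P Q PQ PA); apply: le_trans (energy_decay _).
  rewrite /df -PA (gE t (ltW t0)) -PA (Rc_left_invariant _ PQ) mcform0 mul1mx trmx1 mulmx1 (invA P Q PQ).
  set r := ric_sym _; set D := -2 *: _; set D' := - _.
  rewrite -(quad3_change C D' (Q^T *m Q) (P *m P^T) PQ) -(quad3_change C (Q^T *m Q) D' (P *m P^T) PQ).
  rewrite -(quad3_change C (Q^T *m Q) (Q^T *m Q) D PQ) /D' /D {D' D}.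
  have -> : P^T *m (Q^T *m Q) *m P = 1%:M.
    by rewrite mulmxA -trmx_mul QP trmx1 mul1mx.
  have -> : Q *m (P *m P^T) *m Q^T = 1%:M by rewrite !mulmxA QP mul1mx -trmx_mul QP trmx1.
  have -> : Q *m (- 2 *: (P *m r *m P^T)) *m Q^T = - 2 *: r.
    by rewrite -scalemxAr -scalemxAl !mulmxA QP mul1mx -mulmxA -trmx_mul QP trmx1 mulmx1.
  have -> : P^T *m - (Q^T *m Q *m (- 2 *: (P *m r *m P^T)) *m (Q^T *m Q)) *m P = 2 *: r.
    rewrite -scalemxAr -scalemxAl scaleNr opprK -scalemxAr -scalemxAl; congr (_ *: _).
    rewrite !mulmxA -trmx_mul QP trmx1 mul1mx QP mul1mx.
    by rewrite -[r *m P^T *m Q^T]mulmxA -trmx_mul QP trmx1 mulmx1 -mulmxA QP mulmx1.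
  exact: lexx.
have bound := @riccati_bound R f df (2 * n.+1%:R).
move=> t t0 x; have [[P Q] /= [PQ PA]] := chol t (ltW t0).
rewrite (gE t (ltW t0)) -PA; apply: (le_trans (norm_Rm_left_invariant _ PQ)).
rewrite -(fE t P Q PQ PA) -[leRHS]mulrA ler_wpM2l ?mulr_ge0 ?exprn_ge0 //; apply: bound => //.
- move=> s s0; have [[P' Q'] /= [PQ' PA']] := chol s (ltW s0).
  by rewrite (fE s P' Q' PQ' PA') str_norm2_ge0.
- move=> s s0; apply: quad3_deriv; last exact: dA.
  exact: mder_invmx uA s0 (dA s s0).
Qed.

End InvariantMetrics.

(** * Ordinary differential equations *)

Section Antiderivative.
Variable R : realType.
Implicit Types (f g : R -> R) (t d : R).
Local Notation rder t f d := (is_derive (t : R) (1 : R) (f : R -> R) (d : R)).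

Lemma rder0_eq f s t : (forall u, Num.min s t <= u <= Num.max s t -> rder u f 0) -> f s = f t.
Proof.
wlog st : s t / s < t.
  move=> h fd; have [st|ts|->//] := ltgtP s t; first exact: h.
  by apply/esym; apply: h => //; rewrite minC maxC.
rewrite min_l ?max_r ?ltW // => fd.
have [u _] := @rder_MVT R f (fun=> 0) s t st fd.
by rewrite mul0r => /eqP; rewrite subr_eq0 => /eqP ->.
Qed.

Lemma antiderivative_right g a : continuous g -> a < 0 ->
  exists G, G 0 = 0 /\ forall t, a < t -> rder t G (g t).
Proof.
move=> cg a0.
pose F x := (\int[lebesgue_measure]_(t in `[a, x]%classic) (g t))%R.
exists (fun x => F x - F 0); split; first by rewrite subrr.
move=> t at_; have tu : t < t + 1 by rewrite ltrDl.
have ig : lebesgue_measure.-integrable `[a, (t + 1)]%classic (EFin \o g).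
  apply: continuous_compact_integrable; first exact: segment_compact.
  exact: continuous_subspaceT.
have [dF dFE] := continuous_FTC1_closed tu ig at_ (cg t).
have dF' : rder t F (g t) by apply: DeriveDef; [exact: dF | rewrite -derive1E; exact: dFE].
by rewrite -[g t]addr0; exact: (rderD dF' (rderC t (- F 0))).
Qed.

(** An integral from a fixed lower end is an antiderivative only to the right of that end. The
    antiderivatives [G N], all normalized at 0, agree where two of them are defined and are glued
    along the integer part of [|t|]. *)
Lemma antiderivative g : continuous g -> exists G, G 0 = 0 /\ forall t, rder t G (g t).
Proof.
move=> cg.
have ex (N : nat) : exists G, G 0 = 0 /\ forall t, - N.+1%:R < t -> rder t G (g t).
  by apply: antiderivative_right; rewrite // oppr_lt0 ltr0n.
have [G hG] := choice ex.
have agree N M t : - N.+1%:R < t -> - M.+1%:R < t -> G N t = G M t.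
  have [GN0 dN] := hG N; have [GM0 dM] := hG M => tN tM.
  have e : G N t - G M t = G N 0 - G M 0.
    apply: (@rder0_eq (fun s => G N s - G M s) t 0) => u /andP[mu _].
    have [lN lM] : - N.+1%:R < u /\ - M.+1%:R < u.
      by split; apply: lt_le_trans mu; rewrite lt_min ?tN ?tM oppr_lt0 ltr0n.
    rewrite -(subrr (g u)); exact: (rderD (dN u lN) (rderN (dM u lM))).
  by apply/eqP; rewrite -subr_eq0 e GN0 GM0 subrr.
pose N t := Num.Def.trunc `|t|.
have hN t : - (N t).+1%:R < t.
  have := truncnS_gt `|t|; rewrite -/(N t) => h.
  by rewrite ltrNl (le_lt_trans _ h) // -normrN ler_norm.
exists (fun t => G (N t) t); split; first by case: (hG (N 0)).
move=> t; have [_ dN] := hG (N t).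
apply: (near_eq_is_derive (f := G (N t))); last exact: dN.
near=> s; apply: agree; last exact: hN.
by near: s; apply: lt_nbhsr; exact: hN.
Unshelve. all: by end_near. Qed.

(* Halving the weight is the contraction step of the Picard iteration. *)
Lemma exp_comparison u du K l : 0 < l -> 0 <= K -> u 0 = 0 -> (forall t, rder t u (du t)) ->
  (forall t, `|du t| <= K * expR (l * `|t|)) -> forall t, `|u t| <= K / l * expR (l * `|t|).
Proof.
move=> l0 K0 u0 dd dle.
have pos v dv : v 0 = 0 -> (forall t, rder t v (dv t)) ->
    (forall t, 0 <= t -> `|dv t| <= K * expR (l * t)) -> forall t, 0 <= t -> v t <= K / l * expR (l * t).
  move=> v0 vd vle t; rewrite le_eqVlt => /orP[/eqP<-|t0].
    by rewrite v0 mulr_ge0 ?expR_ge0 // divr_ge0 // ltW.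
  pose h s := K / l * expR (l * s) + - v s.
  have dh s : rder s h (K * expR (l * s) + - dv s).
    have de : rder s (fun s => expR (l * s)) (l * expR (l * s)).
      have dl : rder s (fun s => l * s) l.
        by apply: (is_derive_eq (rderM (rderC s l) (is_derive_id s (1 : R)))); rewrite mul0r add0r mulr1.
      by apply: (is_derive_eq (is_derive1_comp (is_derive_expR _) dl)); rewrite mulrC.
    have dk : rder s (fun s => K / l * expR (l * s)) (K * expR (l * s)).
      apply: (is_derive_eq (rderM (rderC s (K / l)) de)).
      by rewrite mul0r add0r mulrA divfK // gt_eqF.
    exact: (rderD dk (rderN (vd s))).
  have [w /andP[w0 _] e] := @rder_MVT R h _ 0 t t0 (fun u _ => dh u).
  have h0 : 0 <= h t - h 0.
    rewrite e subr0 mulr_ge0 ?(ltW t0) // subr_ge0.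
    by apply: le_trans (vle w (ltW w0)); apply: ler_norm.
  have hz : 0 <= h 0 by rewrite /h v0 subr0 mulr_ge0 ?expR_ge0 // divr_ge0 // ltW.
  by have := addr_ge0 h0 hz; rewrite subrK /h subr_ge0.
have both v dv : v 0 = 0 -> (forall t, rder t v (dv t)) ->
    (forall t, 0 <= t -> `|dv t| <= K * expR (l * t)) -> forall t, 0 <= t -> `|v t| <= K / l * expR (l * t).
  move=> v0 vd vle t t0; rewrite ler_norml; apply/andP; split; last exact: (pos v dv).
  rewrite lerNl; apply: (pos (fun s => - v s) (fun s => - dv s)) => //.
  - by rewrite v0 oppr0.
  - by move=> s s0; rewrite normrN vle.
move=> t; have [t0|t0] := leP 0 t.
  rewrite (ger0_norm t0); apply: (both u du) => // s s0.
  by rewrite -{2}(ger0_norm s0).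
rewrite (ltr0_norm t0); have -> : u t = u (- - t) by rewrite opprK.
apply: (both (fun s => u (- s)) (fun s => - du (- s))).
- by rewrite oppr0.
- move=> s; have dn : rder s (fun s => - s) (-1) by exact: (rderN (is_derive_id s (1 : R))).
  apply: (is_derive_eq (is_derive1_comp (dd (- s)) dn)).
  by rewrite mulrN1.
- by move=> s s0; rewrite normrN; have := dle (- s); rewrite normrN (ger0_norm s0).
- by rewrite oppr_ge0 ltW.
Qed.

End Antiderivative.

(** * Global Picard iteration in a weighted norm *)

Section Picard.
Variable R : realType.
Local Notation rder t f d := (is_derive (t : R) (1 : R) (f : R -> R) (d : R)).
Local Notation half := (2^-1 : R).

Lemma half_small (c e : R) : 0 < e -> exists k, c * half ^+ k < e.
Proof.
move=> e0; have := truncnS_gt (`|c| / e); set k := _.+1 => h; exists k.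
have h2 : k%:R <= 2 ^+ k :> R by rewrite -natrX ler_nat ltnW // ltn_expl.
have p0 : 0 < 2 ^+ k :> R by rewrite exprn_gt0.
rewrite exprVn ltr_pdivrMr //; apply: le_lt_trans (ler_norm c) _.
by rewrite mulrC -ltr_pdivrMr // (lt_le_trans h).
Qed.

Lemma geometric_limit (y : nat -> R) (b : R) : 0 <= b ->
  (forall k, `|y k.+1 - y k| <= b * half ^+ k) ->
  exists l, forall k, `|l - y k| <= 2 * b * half ^+ k.
Proof.
move=> b0 h; pose bk k := 2 * b * half ^+ k.
have bS k : bk k.+1 + b * half ^+ k = bk k by rewrite /bk exprS; field.
have step k : - (b * half ^+ k) <= y k.+1 - y k <= b * half ^+ k by rewrite -ler_norml.
have lowS k j : y k - bk k <= y (k + j)%N - bk (k + j)%N.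
  elim: j => [|j IH]; first by rewrite addn0.
  apply: (le_trans IH); rewrite addnS -(bS (k + j)%N).
  by have /andP[] := step (k + j)%N; lra.
have upS k j : y (k + j)%N + bk (k + j)%N <= y k + bk k.
  elim: j => [|j IH]; first by rewrite addn0.
  apply: le_trans IH; rewrite addnS -(bS (k + j)%N).
  by have /andP[] := step (k + j)%N; lra.
have bk0 k : 0 <= bk k by rewrite /bk mulr_ge0 ?exprn_ge0 ?mulr_ge0 // invr_ge0.
have cross j k : y j - bk j <= y k + bk k.
  apply: (le_trans (lowS j k)); apply: le_trans (upS k j); rewrite addnC.
  by have := bk0 (k + j)%N; lra.
pose A := (range (fun k => y k - bk k))%classic.
have supA : has_sup A.
  by split; [exists (y 0%N - bk 0%N); exists 0%N | exists (y 0%N + bk 0%N) => _ [k _ <-]; apply: cross].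
exists (sup A) => k; rewrite ler_norml; apply/andP; split.
  have : y k - bk k <= sup A by apply: sup_ubound; [case: supA | exists k].
  by rewrite -/(bk k); lra.
have : sup A <= y k + bk k.
  by apply: sup_le_ub; [case: supA | move=> _ [j _ <-]; apply: cross].
by rewrite -/(bk k); lra.
Qed.

Variable I : finType.
Variable f : R -> (I -> R) -> I -> R.
Variables L M : R.
Hypotheses (L0 : 0 <= L) (M0 : 0 <= M).
Variable y0 : I -> R.
Hypothesis lip : forall t y z i, `|f t y i - f t z i| <= L * \sum_j `|y j - z j|.
Hypothesis bnd : forall t i, `|f t y0 i| <= M.
Hypothesis cont : forall y : R -> I -> R, (forall i, continuous (fun s => y s i)) ->
  forall i, continuous (fun s => f s (y s) i).

Let N := #|I|%:R : R.
(** Rate of the weight exp (l |t|). Integration divides by [l], so one step multiplies weighted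
    distances by N L / l, at most 1/2, on the whole line at once. The summand 1 keeps [l] positive
    when N L = 0. *)
Let l := 2 * (N * L) + 1.
Let l0 : 0 < l.
Proof. by rewrite /l ltr_pwDr // !mulr_ge0. Qed.
Let w (t : R) := expR (l * `|t|).
Let w1 (t : R) : 1 <= w t.
Proof. by rewrite /w -expR0 ler_expR mulr_ge0 // ltW. Qed.
Let B := M / l.
Let B0 : 0 <= B. Proof. by rewrite /B divr_ge0 // ltW. Qed.

Let lipw (t : R) (y z : I -> R) (c : R) : (forall i, `|y i - z i| <= c * w t) -> forall i, `|f t y i - f t z i| <= (N * L * c) * w t.
Proof.
move=> h i; apply: (le_trans (lip _ _ _ _)).
have : \sum_j `|y j - z j| <= N * (c * w t).
  apply: (le_trans (ler_sum _ (fun j _ => h j))).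
  by rewrite sumr_const mulr_natl.
move=> /(ler_wpM2l L0) h1; apply: (le_trans h1).
by rewrite le_eqVlt; apply/orP; left; apply/eqP; ring.
Qed.

Let NLl (c : R) : 0 <= c -> N * L * c / l <= c / 2.
Proof.
move=> c0; rewrite ler_pdivrMr // /l.
have : 0 <= N * L * c by rewrite !mulr_ge0.
have -> : c / 2 * (2 * (N * L) + 1) = N * L * c + c / 2 by field.
by move=> _; rewrite lerDl divr_ge0.
Qed.

Theorem picard : exists y : R -> I -> R, (forall i, y 0 i = y0 i) /\
  forall t i, rder t (fun s => y s i) (f t (y t) i).
Proof.
(* Stated for every [g], with an arbitrary value on discontinuous ones, so that choice yields a
   total operator [Phi]. *)
have anti (g : R -> R) : exists G : R -> R, continuous g -> G 0 = 0 /\ forall t, rder t G (g t).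
  have [cg|ncg] := pselect (continuous g); last by exists g.
  by have [G hG] := antiderivative cg; exists G.
have [Phi hPhi] := choice anti.
pose step (y : R -> I -> R) : R -> I -> R := fun t i => y0 i + Phi (fun s => f s (y s) i) t.
have stepP y : (forall i, continuous (fun s => y s i)) -> (forall i, step y 0 i = y0 i) /\
    forall t i, rder t (fun s => step y s i) (f t (y t) i).
  move=> cy; have h i := hPhi _ (@cont _ cy i); split=> [i|t i].
    by have [P0 _] := h i; rewrite /step P0 addr0.
  by have [_ Pd] := h i; rewrite -[f t _ i]add0r; exact: (rderD (rderC t (y0 i)) (Pd t)).
have step_cont y : (forall i, continuous (fun s => y s i)) -> forall i, continuous (fun s => step y s i).
  by move=> cy i t; have [_ h] := stepP y cy; apply: rder_continuous (h t i).
pose Y := fix Y k := if k is k'.+1 then step (Y k') else fun=> y0.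
have Yc k i : continuous (fun s => Y k s i).
  by elim: k i => [|k IH] i; [move=> ?; apply: cvg_cst | apply: step_cont].
have Yd k t i : `|Y k.+1 t i - Y k t i| <= B * half ^+ k * w t.
  elim: k t i => [|k IH] t i.
    rewrite expr0 mulr1.
    have [z d] := stepP _ (Yc 0%N).
    apply: (@exp_comparison R (fun s => Y 1%N s i - Y 0%N s i) (fun s => f s y0 i - 0)) => //.
    - by rewrite /= z subrr.
    - by move=> s; exact: (rderD (d s i) (rderN (rderC s (y0 i)))).
    - by move=> s; rewrite subr0; apply: (le_trans (bnd _ _)); rewrite ler_peMr // w1.
  have [z1 d1] := stepP _ (Yc k.+1); have [z2 d2] := stepP _ (Yc k).
  have c0 : 0 <= B * half ^+ k by rewrite mulr_ge0 ?exprn_ge0 // invr_ge0.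
  have h : forall s, `|Y k.+2 s i - Y k.+1 s i| <= N * L * (B * half ^+ k) / l * w s.
    apply: (@exp_comparison R (fun s => Y k.+2 s i - Y k.+1 s i) (fun s => f s (Y k.+1 s) i - f s (Y k s) i)) => //.
    - by apply: mulr_ge0 => //; apply: mulr_ge0.
    - by apply/eqP; rewrite subr_eq0; apply/eqP; exact: (etrans (z1 i) (esym (z2 i))).
    - by move=> s; apply: lipw => j; apply: IH.
  apply: (le_trans (h t)); rewrite ler_wpM2r ?(le_trans ler01 (w1 t)) //.
  by apply: (le_trans (NLl c0)); rewrite exprSr mulrA.
have lim (ti : R * I) : exists a, forall k, `|a - Y k ti.1 ti.2| <= 2 * (B * w ti.1) * half ^+ k.
  apply: geometric_limit; first by rewrite mulr_ge0 // (le_trans ler01 (w1 _)).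
  by move=> k; rewrite mulrAC; apply: Yd.
have [y' hy'] := choice lim; pose y t i := y' (t, i).
have yY t i k : `|y t i - Y k t i| <= 2 * B * half ^+ k * w t.
  by have := hy' (t, i) k; rewrite /= mulrA mulrAC.
have yc i : continuous (fun s => y s i).
  move=> t; apply/cvgrPdist_le => e e0.
  pose W := expR (l * (`|t| + 1)).
  have e3 : 0 < e / 3 by rewrite divr_gt0.
  have [k hk] := half_small (2 * B * W) e3.
  have near3 s : `|s - t| < 1 -> `|y s i - Y k s i| <= e / 3.
    move=> st; apply: (le_trans (yY s i k)); apply: le_trans (ltW hk).
    rewrite mulrAC; apply: ler_wpM2r; first by rewrite exprn_ge0 ?invr_ge0.
    apply: ler_wpM2l; first by rewrite mulr_ge0.
    rewrite /w /W ler_expR; apply: ler_wpM2l; first exact: ltW.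
    have := ler_normD t (s - t); rewrite addrC subrK => h.
    by apply: (le_trans h); rewrite lerD2l ltW.
  have /cvgrPdist_le/(_ _ e3) hY := Yc k i t.
  near=> s.
  have s1 : `|s - t| < 1 by rewrite distrC; near: s; exact: cvgr_dist_lt.
  have h1 := near3 s s1; have h2 : `|y t i - Y k t i| <= e / 3 by apply: near3; rewrite subrr normr0.
  have h3 : `|Y k t i - Y k s i| <= e / 3 by near: s.
  have -> : y t i - y s i = (y t i - Y k t i) + (Y k t i - Y k s i) - (y s i - Y k s i) by ring.
  apply: (le_trans (ler_normB _ _)); apply: (le_trans (lerD (ler_normD _ _) (lexx _))).
  by lra.
have [z d] := stepP y yc.
(* Both [y] and [step y] are within a multiple of 2^-k of the iterate [Y k.+1], so the limit is a
   fixed point. *)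
have ys t i : y t i = step y t i.
  apply/eqP; rewrite -subr_eq0 -normr_le0; apply/ler_addgt0Pl => e e0; rewrite addr0.
  have [k hk] := half_small (2 * B * w t) e0.
  have c0 : 0 <= 2 * B * half ^+ k by apply: mulr_ge0; [apply: mulr_ge0 | rewrite exprn_ge0 ?invr_ge0].
  have [z2 d2] := stepP _ (Yc k).
  have h : forall s, `|step y s i - Y k.+1 s i| <= N * L * (2 * B * half ^+ k) / l * w s.
    apply: (@exp_comparison R (fun s => step y s i - Y k.+1 s i) (fun s => f s (y s) i - f s (Y k s) i)) => //.
    - by apply: mulr_ge0 => //; apply: mulr_ge0.
    - by apply/eqP; rewrite subr_eq0; apply/eqP; exact: (etrans (z i) (esym (z2 i))).
    - by move=> s; apply: lipw => j; apply: yY.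
  have h1 := h t; have h2 := yY t i k.+1.
  have h3 := ler_wpM2r (le_trans ler01 (w1 t)) (NLl c0).
  have -> : y t i - step y t i = (y t i - Y k.+1 t i) - (step y t i - Y k.+1 t i) by ring.
  apply: (le_trans (ler_normB _ _)).
  move: h2 hk; rewrite exprS => h2 hk.
  have e1 : 2 * B * (half * half ^+ k) * w t = (2 * B * half ^+ k) / 2 * w t by field.
  have e2 : (2 * B * half ^+ k) / 2 * w t + (2 * B * half ^+ k) / 2 * w t = 2 * B * w t * half ^+ k by field.
  by move: h1 h2 h3 hk; rewrite e1 -e2; lra.
exists y; split=> [i|t i]; first by rewrite ys z.
rewrite (_ : (fun s => y s i) = fun s => step y s i) //.
by apply/funext => s; rewrite ys.
Unshelve. all: by end_near. Qed.

End Picard.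

(** * Bounded Lipschitz fields and the radial cut-off *)

Section BoundedLipschitz.
Variables (R : realType) (I : finType).
Local Notation X := (I -> R).
Local Notation rder t f d := (is_derive (t : R) (1 : R) (f : R -> R) (d : R)).

Definition dist1 (y z : X) : R := \sum_j `|y j - z j|.

Lemma dist1_ge0 y z : 0 <= dist1 y z.
Proof. by apply: sumr_ge0 => j _. Qed.

Lemma coord_dist1 y z j : `|y j - z j| <= dist1 y z.
Proof. by rewrite /dist1 (bigD1 j) //= lerDl sumr_ge0. Qed.

(** Boundedness is included because products of merely Lipschitz functions need not be Lipschitz;
    with it, polynomials in the cut-off coordinates stay in the class. *)
Definition bounded_lip (g : X -> R) := exists2 K, 0 <= K &
  forall y z, `|g y| <= K /\ `|g y - g z| <= K * dist1 y z.

Lemma bounded_lipC (c : R) : bounded_lip (fun=> c).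
Proof. by exists `|c| => // y z; rewrite subrr normr0 mulr_ge0 ?dist1_ge0. Qed.

Lemma bounded_lipD g h : bounded_lip g -> bounded_lip h -> bounded_lip (fun y => g y + h y).
Proof.
case=> K K0 hg [K' K'0 hh]; exists (K + K'); first exact: addr_ge0.
move=> y z; have [g1 g2] := hg y z; have [h1 h2] := hh y z; split.
  by apply: (le_trans (ler_normD _ _)); apply: lerD.
rewrite [X in `|X|](_ : _ = (g y - g z) + (h y - h z)); last by ring.
by apply: (le_trans (ler_normD _ _)); rewrite mulrDl; apply: lerD.
Qed.

Lemma bounded_lipM g h : bounded_lip g -> bounded_lip h -> bounded_lip (fun y => g y * h y).
Proof.
case=> K K0 hg [K' K'0 hh]; exists (K * K' + K * K'); first by rewrite addr_ge0 ?mulr_ge0.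
move=> y z; have [g1 g2] := hg y z; have [h1 h2] := hh y z.
have [h3 _] := hh z y; split.
  rewrite normrM; apply: (@le_trans _ _ (K * K')); first exact: ler_pM.
  by rewrite lerDl mulr_ge0.
rewrite [X in `|X|](_ : _ = g y * (h y - h z) + (g y - g z) * h z); last by ring.
apply: (le_trans (ler_normD _ _)); rewrite !normrM mulrDl; apply: lerD.
  by rewrite -mulrA; apply: ler_pM.
by rewrite mulrAC; apply: ler_pM.
Qed.

Lemma bounded_lipZ (c : R) g : bounded_lip g -> bounded_lip (fun y => c * g y).
Proof. by apply: bounded_lipM; apply: bounded_lipC. Qed.

Lemma bounded_lipN g : bounded_lip g -> bounded_lip (fun y => - g y).
Proof.
move=> /(bounded_lipZ (-1)); congr bounded_lip.
by apply/funext => y; rewrite mulN1r.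
Qed.

Lemma bounded_lip_sum (J : Type) (s : seq J) (g : J -> X -> R) :
  (forall j, bounded_lip (g j)) -> bounded_lip (fun y => \sum_(j <- s) g j y).
Proof.
move=> h; elim: s => [|j s IH].
  by under eq_fun do rewrite big_nil; apply: bounded_lipC.
by under eq_fun do rewrite big_cons; apply: bounded_lipD.
Qed.

Lemma bounded_lip_uniform (J : finType) (g : J -> X -> R) : (forall j, bounded_lip (g j)) ->
  exists2 K, 0 <= K & forall j y z, `|g j y| <= K /\ `|g j y - g j z| <= K * dist1 y z.
Proof.
move=> h.
have ex j : exists K, 0 <= K /\ forall y z, `|g j y| <= K /\ `|g j y - g j z| <= K * dist1 y z.
  by have [K K0 hK] := h j; exists K.
have [K hK] := choice ex; have K0 j : 0 <= K j by have [] := hK j.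
have leK j : K j <= \sum_j K j by rewrite (bigD1 j) //= lerDl sumr_ge0.
exists (\sum_j K j) => [|j y z]; first by apply: sumr_ge0.
have [_ /(_ y z) [h1 h2]] := hK j; split; first exact: le_trans (leK j).
by apply: (le_trans h2); rewrite ler_wpM2r ?dist1_ge0.
Qed.

Lemma bounded_lip_continuous g (y : R -> X) : bounded_lip g -> (forall i, continuous (fun s => y s i)) ->
  continuous (fun s => g (y s)).
Proof.
case=> K K0 hg cy t; apply/cvgrPdist_le => e e0.
have d0 : 0 < e / ((K + 1) * (#|I|%:R + 1)) by rewrite divr_gt0 // mulr_gt0 // ltr_pwDr.
have near_all (r : seq I) : \forall s \near t, forall j, j \in r ->
    `|y t j - y s j| <= e / ((K + 1) * (#|I|%:R + 1)).
  elim: r => [|j r IH]; first by near=> s => j.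
  have /cvgrPdist_le/(_ _ d0) h := cy j t.
  near=> s => i; rewrite inE => /orP[/eqP->|]; first by near: s.
  by move: i; near: s.
near=> s; have [_ h] := hg (y t) (y s); apply: (le_trans h).
have : dist1 (y t) (y s) <= \sum_(j in I) e / ((K + 1) * (#|I|%:R + 1)).
  apply: ler_sum => j _; have := mem_index_enum j; move: j; near: s; exact: near_all.
rewrite sumr_const -[leRHS]mulr_natl => hd.
apply: (le_trans (ler_wpM2l K0 hd)); have N0 : 0 <= #|I|%:R :> R by [].
move: (#|I|%:R : R) N0 => N N0; rewrite !mulrA ler_pdivrMr; last by rewrite mulr_gt0 // ltr_pwDr.
rewrite -subr_ge0 (_ : _ - _ = e * (K + N + 1)); last by ring.
by rewrite mulr_ge0 ?(ltW e0) // !addr_ge0.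
Unshelve. all: by end_near. Qed.

Theorem bounded_lipschitz_ode (g : I -> X -> R) (y0 : X) : (forall i, bounded_lip (g i)) ->
  exists y : R -> X, (forall i, y 0 i = y0 i) /\ forall t i, rder t (fun s => y s i) (g i (y t)).
Proof.
move=> lg; have [K K0 hK] := bounded_lip_uniform lg.
apply: (@picard R I (fun _ y i => g i y) K K K0 K0 y0).
- by move=> _ y z i; case: (hK i y z).
- by move=> _ i; case: (hK i y0 y0).
- by move=> y cy i; apply: bounded_lip_continuous.
Qed.

(* The cut-off is radial so that the energy identity of the bracket flow survives it. *)
Definition l1norm (y : X) : R := \sum_j `|y j|.
Definition retract (r : R) (y : X) : X := fun i => r / Num.max r (l1norm y) * y i.

Lemma l1norm_lip y z : `|l1norm y - l1norm z| <= dist1 y z.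
Proof.
rewrite /l1norm -sumrB; apply: (le_trans (ler_norm_sum _ _ _)).
by apply: ler_sum => j _; apply: ler_dist_dist.
Qed.

Lemma retract_id r y : 0 < r -> l1norm y <= r -> retract r y = y.
Proof. by move=> r0 yr; apply/funext => i; rewrite /retract max_l // divff ?mul1r // gt_eqF. Qed.

(** The cut-off is bounded by [r] and has Lipschitz constant 2, one unit from the change of [y i]
    and one from that of [m]; [r + 2] covers both. *)
Lemma bounded_lip_retract r i : 0 < r -> bounded_lip (fun y => retract r y i).
Proof.
move=> r0; pose m y := Num.max r (l1norm y).
have mr y : r <= m y by rewrite /m le_max lexx.
have m0 y : 0 < m y by exact: lt_le_trans (mr y).
have my y : `|y i| <= m y.
  rewrite /m le_max; apply/orP; right; rewrite /l1norm (bigD1 i) //= lerDl.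
  by apply: sumr_ge0.
have mlip y z : `|m y - m z| <= dist1 y z.
  have := l1norm_lip y z; rewrite !ler_norml /m => /andP[h1 h2].
  have d0 := dist1_ge0 y z.
  by rewrite /Num.max; case: ifP => [|/negbT] => c1; case: ifP => [|/negbT] c2; apply/andP; split; move: c1 c2; rewrite -?leNgt; lra.
exists (r + 2); first by rewrite addr_ge0 ?(ltW r0).
move=> y z; rewrite /retract -!/(m _); split.
  rewrite normrM ger0_norm ?divr_ge0 ?(ltW r0) ?(ltW (m0 y)) // mulrAC ler_pdivrMr //.
  have := my y; have := m0 y; have := normr_ge0 (y i) => h1 h2 h3.
  by apply: (le_trans (ler_wpM2l (ltW r0) h3)); rewrite ler_wpM2r ?(ltW h2) // lerDl.
have ym := m0 y; have zm := m0 z.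
rewrite (_ : _ - _ = r / m y * ((y i - z i) + z i / m z * (m z - m y))); last first.
  by field; rewrite !gt_eqF.
rewrite normrM ger0_norm ?divr_ge0 ?(ltW r0) ?(ltW ym) //.
have h1 : r / m y <= 1 by rewrite ler_pdivrMr // mul1r.
have d0 := dist1_ge0 y z.
have h2 : `|y i - z i + z i / m z * (m z - m y)| <= 2 * dist1 y z.
  apply: (le_trans (ler_normD _ _)); have -> : 2 * dist1 y z = dist1 y z + 1 * dist1 y z by ring.
  apply: lerD; first exact: coord_dist1.
  rewrite normrM distrC; apply: ler_pM => //.
  by rewrite normrM [`|(m z)^-1|]ger0_norm ?invr_ge0 ?(ltW zm) // ler_pdivrMr // mul1r.
have h3 : r / m y * `|y i - z i + z i / m z * (m z - m y)| <= 1 * (2 * dist1 y z).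
  by apply: ler_pM => //; rewrite divr_ge0 ?(ltW r0) ?(ltW ym).
apply: (le_trans h3); rewrite mul1r ler_wpM2r // lerDr; exact: ltW.
Qed.

End BoundedLipschitz.

(** * The bracket flow *)

Section BracketFlow.
Variables (R : realType) (n : nat).
Local Notation I3 := ('I_n * 'I_n * 'I_n)%type.
Implicit Type C : 'I_n -> 'M[R]_n.

(** The derivative of [tr_str P Q C0], written in terms of its value [C], when P' = - P r and Q' = r
    Q with r the form [ric_sym C]. *)
Definition flow_field C (a : 'I_n) : 'M[R]_n :=
  ad C (row a (ric_sym C)) + ric_sym C *m C a - C a *m ric_sym C.

Lemma flow_field_energy C :
  \sum_a \sum_b \sum_k 2 * (C a b k * flow_field C a b k) = - 8 * \tr ((ric_sym C)^T *m ric_sym C).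
Proof.
rewrite -quad3_ric; set r := ric_sym C; have rT : r^T = r := ric_sym_tr C.
rewrite !quad3_tr !sum_id_l -!big_split /=; apply: eq_bigr => a _.
transitivity (2 * \tr ((C a)^T *m flow_field C a)).
  rewrite mxtrace_trmul mulr_sumr; apply: eq_bigr => b _; rewrite mulr_sumr.
  by apply: eq_bigr => k _.
rewrite /flow_field -/r mulmxBr mulmxDr linearB linearD /= mulrBr mulrDr; congr (_ + _ + _).
- rewrite [ad C _]/ad mulmx_sumr linear_sum mulr_sumr; apply: eq_bigr => c _ /=.
  by rewrite -scalemxAr linearZ /= trmx1 !mulmx1 !mxE mulrA.
- by rewrite trmx1 mulmx1 -scalemxAr -scalemxAl linearZ /= mulmxA.
- have -> : (- 2 *: r)^T = - 2 *: r by rewrite [LHS]linearZ /= rT.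
  by rewrite mulmx1 -scalemxAr mulmxA [RHS]linearZ /= mulNr.
Qed.

Lemma mxtrace_sqr_ge0 (r : 'M[R]_n) : 0 <= \tr (r^T *m r).
Proof. by apply: le_trans (mxtrace_sqr_le r); rewrite divr_ge0 ?sqr_ge0. Qed.

Section BoundedLipschitzMatrices.
Variable I : finType.
Local Notation X := (I -> R).

Definition bounded_lip_mx m p (A : X -> 'M[R]_(m, p)) := forall i j, bounded_lip (fun y => A y i j).

Lemma bounded_lip_mxD m p (A B : X -> 'M[R]_(m, p)) : bounded_lip_mx A -> bounded_lip_mx B ->
  bounded_lip_mx (fun y => A y + B y).
Proof. by move=> hA hB i j; under eq_fun do rewrite mxE; apply: bounded_lipD. Qed.

Lemma bounded_lip_mxN m p (A : X -> 'M[R]_(m, p)) : bounded_lip_mx A -> bounded_lip_mx (fun y => - A y).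
Proof. by move=> hA i j; under eq_fun do rewrite mxE; apply: bounded_lipN. Qed.

Lemma bounded_lip_mxZ m p c (A : X -> 'M[R]_(m, p)) : bounded_lip_mx A -> bounded_lip_mx (fun y => c *: A y).
Proof. by move=> hA i j; under eq_fun do rewrite mxE; apply: bounded_lipZ. Qed.

Lemma bounded_lip_mxT m p (A : X -> 'M[R]_(m, p)) : bounded_lip_mx A -> bounded_lip_mx (fun y => (A y)^T).
Proof. by move=> hA i j; under eq_fun do rewrite mxE; apply: hA. Qed.

Lemma bounded_lip_mxM m p q (A : X -> 'M[R]_(m, p)) (B : X -> 'M[R]_(p, q)) :
  bounded_lip_mx A -> bounded_lip_mx B -> bounded_lip_mx (fun y => A y *m B y).
Proof.
move=> hA hB i j; under eq_fun do rewrite mxE.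
by apply: bounded_lip_sum => k; apply: bounded_lipM.
Qed.

Lemma bounded_lip_mx_sum m p (J : Type) (s : seq J) (A : J -> X -> 'M[R]_(m, p)) :
  (forall k, bounded_lip_mx (A k)) -> bounded_lip_mx (fun y => \sum_(k <- s) A k y).
Proof. by move=> hA i j; under eq_fun do rewrite summxE; apply: bounded_lip_sum => k; apply: hA. Qed.

Variable S : X -> 'I_n -> 'M[R]_n.
Hypothesis hS : forall a, bounded_lip_mx (fun y => S y a).

Lemma bounded_lip_ric : bounded_lip_mx (fun y => ric_sym (S y)).
Proof.
apply: bounded_lip_mxD; apply: bounded_lip_mxZ; [apply: bounded_lip_mxD|].
- move=> b c; under eq_fun do rewrite mxE.
  apply: bounded_lip_sum => k; apply: bounded_lip_mxM => //; exact: bounded_lip_mxT.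
- by apply: bounded_lip_mx_sum => k; apply: bounded_lip_mxM => //; apply: bounded_lip_mxT.
- by apply: bounded_lip_mx_sum => k; apply: bounded_lip_mxM => //; apply: bounded_lip_mxT.
Qed.

Lemma bounded_lip_flow_field a : bounded_lip_mx (fun y => flow_field (S y) a).
Proof.
have hr := bounded_lip_ric.
apply: bounded_lip_mxD; last by apply: bounded_lip_mxN; apply: bounded_lip_mxM.
apply: bounded_lip_mxD; last exact: bounded_lip_mxM.
apply: bounded_lip_mx_sum => k i j; under eq_fun do rewrite mxE.
by apply: bounded_lipM; [under eq_fun do rewrite mxE; apply: hr | apply: hS].
Qed.

End BoundedLipschitzMatrices.

Definition str_of (y : I3 -> R) : 'I_n -> 'M[R]_n := fun a => \matrix_(b, k) y (a, b, k).

(** The cut-off field rescales the energy identity by a positive factor only, so the norm does not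
    grow for [0 <= t] and the cut-off stays inactive there. [rho] is the Ricci form of the cut-off
    bracket: bounded for all times, as the linear equation for [P] requires, and equal to the true
    one for [0 <= t]. *)
Theorem bracket_flow C : exists (nu : R -> 'I_n -> 'M[R]_n) (rho : R -> 'M[R]_n) (K : R),
  [/\ nu 0 = C,
      forall t a, 0 <= t -> mder t (fun s => nu s a) (flow_field (nu t) a),
      forall t, 0 <= t -> rho t = ric_sym (nu t),
      forall t, (rho t)^T = rho t
    & forall i j, continuous (fun s => rho s i j) /\ forall s, `|rho s i j| <= K].
Proof.
pose y0 : I3 -> R := fun x => C x.1.1 x.1.2 x.2.
(* Each coordinate is at most the Euclidean norm, so this radius bounds the l1 norm of every bracket
   of norm at most that of [C]; the 1 keeps it positive. *)
pose r := #|{: I3}|%:R * Num.sqrt (str_norm2 C) + 1.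
have r0 : 0 < r by rewrite ltr_pwDr // mulr_ge0 // sqrtr_ge0.
pose S y := str_of (retract r y).
have hS a : bounded_lip_mx (fun y => S y a).
  by move=> b k; under eq_fun do rewrite mxE; apply: bounded_lip_retract.
have hF (x : I3) : bounded_lip (fun y => flow_field (S y) x.1.1 x.1.2 x.2).
  exact: bounded_lip_flow_field.
have [y [yi yd]] := bounded_lipschitz_ode y0 hF.
have y0C : str_of (y 0) = C by apply/funext => a; apply/matrixP => b k; rewrite mxE yi.
have yc i : continuous (fun s => y s i) by move=> t; apply: rder_continuous (yd t i).
have hR := bounded_lip_ric hS.
have [K _ hK] := bounded_lip_uniform (fun ij : 'I_n * 'I_n => hR ij.1 ij.2).
have sumE (g : I3 -> R) : \sum_a \sum_b \sum_k g (a, b, k) = \sum_x g x.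
  rewrite pair_bigA pair_bigA /=; apply: eq_bigr => -[[a b] k] _ //.
have mono t : 0 <= t -> str_norm2 (str_of (y t)) <= str_norm2 C.
  rewrite le_eqVlt => /orP[/eqP <-|t0].
    by rewrite y0C.
  pose d s := \sum_(x : I3) 2 * (y s x * flow_field (S (y s)) x.1.1 x.1.2 x.2).
  have dd s : is_derive s (1 : R) (fun s => \sum_(x : I3) y s x ^+ 2) (d s).
    apply: rder_sum => x; apply: (is_derive_eq (rderM (yd s x) (yd s x))); ring.
  have d0 s : d s <= 0.
    pose m := Num.max r (l1norm (y s)).
    have m0 : 0 < m by rewrite lt_max r0.
    (* The cut-off is radial: [y s] is [m / r] times the cut-off bracket, and [flow_field_energy]
       applies to the latter. *)
    have -> : d s = m / r * (- 8 * \tr ((ric_sym (S (y s)))^T *m ric_sym (S (y s)))).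
      rewrite -flow_field_energy (sumE (fun x => 2 * (S (y s) x.1.1 x.1.2 x.2 * flow_field (S (y s)) x.1.1 x.1.2 x.2))).
      rewrite mulr_sumr; apply: eq_bigr => -[[a b] k] _ /=.
      rewrite [S (y s) a b k]mxE /retract -/m; move: (flow_field _ _ _ _) => F.
      by field; rewrite !gt_eqF.
    apply: mulr_ge0_le0; first by rewrite divr_ge0 // ltW.
    by have := mxtrace_sqr_ge0 (ric_sym (S (y s))); lra.
  have SE s : str_norm2 (str_of (y s)) = \sum_(x : I3) y s x ^+ 2.
    rewrite -sumE; do 3!(apply: eq_bigr => ? _); by rewrite mxE.
  have [u _] := @rder_MVT R _ d 0 t t0 (fun u _ => dd u).
  rewrite -[X in _ <= str_norm2 X]y0C !SE -subr_le0 subr0 => ->.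
  by rewrite mulr_le0_ge0 ?d0 // ltW.
have SE t : 0 <= t -> S (y t) = str_of (y t).
  move=> t0; rewrite /S retract_id //; apply: (@le_trans _ _ (\sum_(x : I3) Num.sqrt (str_norm2 C))).
    apply: ler_sum => -[[a b] k] _; rewrite -sqrtr_sqr ler_wsqrtr //.
    by apply: le_trans (mono t t0); have := str_le (str_of (y t)) a b k; rewrite mxE.
  by rewrite sumr_const -[leLHS]mulr_natl lerDl.
exists (fun t => str_of (y t)), (fun t => ric_sym (S (y t))), K; split=> //.
- move=> t a t0 b k; under eq_fun do rewrite mxE.
  by rewrite -SE //; exact: (yd t (a, b, k)).
- by move=> t t0; rewrite SE.
- by move=> t; apply: ric_sym_tr.
- move=> i j; split; first exact: (bounded_lip_continuous (hR i j) yc).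
  by move=> s; case: (hK (i, j) (y s) (y s)).
Qed.

Lemma continuous_sumr (J : Type) (s : seq J) (g : J -> R -> R) : (forall k, continuous (g k)) ->
  continuous (fun t => \sum_(k <- s) g k t).
Proof.
move=> h; elim: s => [|k s IH].
  by under eq_fun do rewrite big_nil; move=> ?; apply: cvg_cst.
by under eq_fun do rewrite big_cons; move=> t; apply: cvgD; [apply: h | apply: IH].
Qed.

Lemma linear_ode (rho : R -> 'M[R]_n) (K : R) :
  (forall i j, continuous (fun s => rho s i j) /\ forall s, `|rho s i j| <= K) ->
  exists P : R -> 'M[R]_n, P 0 = 1%:M /\ forall t, mder t P (P t *m rho t).
Proof.
move=> hrho.
pose f t (y : 'I_n * 'I_n -> R) (x : 'I_n * 'I_n) := \sum_k y (x.1, k) * rho t k x.2.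
pose y0 (x : 'I_n * 'I_n) : R := (1%:M : 'M[R]_n) x.1 x.2.
(* In dimension 0 the hypothesis says nothing about the sign of [K]. *)
pose L := `|K|.
have rL t i j : `|rho t i j| <= L by have [_ h] := hrho i j; apply: le_trans (h t) (ler_norm K).
have le_f t y z x : `|f t y x - f t z x| <= L * \sum_j `|y j - z j|.
  rewrite /f -sumrB; apply: (le_trans (ler_norm_sum _ _ _)).
  apply: (@le_trans _ _ (\sum_k L * `|y (x.1, k) - z (x.1, k)|)).
    by apply: ler_sum => k _; rewrite -mulrBl normrM mulrC ler_wpM2r.
  rewrite -mulr_sumr ler_wpM2l ?normr_ge0 //.
  have -> : \sum_j `|y j - z j| = \sum_i \sum_k `|y (i, k) - z (i, k)|.
    by rewrite pair_bigA; apply: eq_bigr => -[].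
  rewrite [leRHS](bigD1 x.1) //= lerDl.
  by apply: sumr_ge0 => i _; apply: sumr_ge0.
have [|||y [yi yd]] := @picard R _ f L (L * \sum_j `|y0 j - 0|) (normr_ge0 K) _ y0 le_f.
- by rewrite mulr_ge0 ?normr_ge0 // sumr_ge0.
- move=> t x; have := le_f t y0 (fun=> 0) x.
  by rewrite {2}/f big1 ?subr0 // => k _; rewrite mul0r.
- move=> y cy x t; apply: continuous_sumr => k {}t.
  by apply: cvgM; [apply: cy | have [c _] := hrho k x.2; apply: c].
exists (fun t => \matrix_(i, j) y t (i, j)); split.
  by apply/matrixP => i j; rewrite mxE yi.
move=> t i j; under eq_fun do rewrite mxE.
have -> : ((\matrix_(i, j) y t (i, j)) *m rho t) i j = f t (y t) (i, j).
  by rewrite mxE; apply: eq_bigr => k _; rewrite mxE.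
exact: yd.
Qed.

End BracketFlow.

(** * From the bracket flow to the Ricci flow *)

Section Existence.
Variables (R : realType) (n : nat).

Lemma mderT t m p (A : R -> 'M[R]_(m, p)) D : mder t A D -> mder t (fun s => (A s)^T) D^T.
Proof. by move=> dA i j; under eq_fun do rewrite mxE; rewrite mxE; apply: dA. Qed.

Lemma mder0_eq m p (A : R -> 'M[R]_(m, p)) s t :
  (forall u, Num.min s t <= u <= Num.max s t -> mder u A 0) -> A s = A t.
Proof.
move=> h; apply/matrixP => i j; apply: (@rder0_eq R (fun s => A s i j)) => u hu.
by have := h u hu i j; rewrite mxE.
Qed.

Lemma tr_strK (P Q : 'M[R]_n) C : P *m Q = 1%:M -> tr_str Q P (tr_str P Q C) = C.
Proof.
move=> PQ; apply/funext => a; rewrite [LHS]/tr_str ad_tr_str -row_mul PQ.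
by rewrite !mulmxA PQ mul1mx -mulmxA PQ mulmx1 row1 ad_delta.
Qed.

Lemma flow_field_lin C (u : 'rV[R]_n) (r := ric_sym C) :
  \sum_c u 0 c *: flow_field C c = ad C (u *m r) + (r *m ad C u - ad C u *m r).
Proof.
rewrite [ad C u]/ad mulmx_sumr mulmx_suml -sumrB mulmx_sum_row [ad C _]linear_sum -big_split /=.
apply: eq_bigr => c _; rewrite linearZ /= -scalemxAr -scalemxAl -scalerBr -scalerDr.
by rewrite /flow_field addrA.
Qed.

(* Transporting the solution of the bracket flow back by P gives a constant bracket. *)
Lemma bracket_flow_frame (C : 'I_n -> 'M[R]_n) : exists (P Q : R -> 'M[R]_n),
  [/\ P 0 = 1%:M, forall t, P t *m Q t = 1%:M
    & forall t, 0 <= t -> mder t P (- (P t *m ric_sym (tr_str (P t) (Q t) C)))].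
Proof.
have [nu [rho [K [nu0 dnu rhoE rhoT hrho]]]] := bracket_flow C.
have [P [P0 dP]] : exists P : R -> 'M[R]_n, P 0 = 1%:M /\ forall t, mder t P (P t *m - rho t).
  apply: (@linear_ode R n (fun t => - rho t) K) => i j; have [c b] := hrho i j; split.
    by under eq_fun do rewrite mxE; move=> t; apply: cvgN; apply: c.
  by move=> s; rewrite mxE normrN.
(* [Q] gets its own linear equation instead of being an inverse. The product [P t *m Q t] has zero
   derivative, which proves invertibility at all times. *)
have [QT [Q0 dQT]] := linear_ode hrho.
pose Q t := (QT t)^T.
have dQ t : mder t Q (rho t *m Q t) by have := mderT (dQT t); rewrite trmx_mul rhoT.
have PQ t : P t *m Q t = 1%:M.
  have -> : P t *m Q t = P 0 *m Q 0.
    apply: (@mder0_eq _ _ (fun s => P s *m Q s)) => u _.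
    have := mderM (dP u) (dQ u); congr mder.
    by rewrite mulmxN mulNmx !mulmxA addNr.
  by rewrite P0 /Q Q0 trmx1 mulmx1.
have QP t := mulmx1C (PQ t).
have const t a : 0 <= t -> tr_str (Q t) (P t) (nu t) a = C a.
  move=> t0; have -> : tr_str (Q t) (P t) (nu t) a = tr_str (Q 0) (P 0) (nu 0) a.
    apply: (@mder0_eq _ _ (fun s => tr_str (Q s) (P s) (nu s) a)) => u.
    rewrite min_r // => /andP[u0 _].
    (* The variation of [P] in the row cancels the first term of [flow_field], leaving a commutator
       with [rho u]; conjugation by [P] and [Q] removes it. *)
    pose X s := ad (nu s) (row a (P s)).
    have dX : mder u X (rho u *m X u - X u *m rho u).
      move=> i j; rewrite /X.
      have XE s : ad (nu s) (row a (P s)) i j = \sum_c P s a c * nu s c i j.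
        by rewrite /ad summxE; apply: eq_bigr => c _; rewrite !mxE.
      under eq_fun do rewrite XE.
      apply: (is_derive_eq (rder_sum _ _ (fun c => rderM (dP u a c) (dnu u c u0 i j)))).
      have -> : \sum_c ((P u *m - rho u) a c * nu u c i j + P u a c * flow_field (nu u) c i j) =
          (ad (nu u) (row a (P u *m - rho u)) + \sum_c (row a (P u)) 0 c *: flow_field (nu u) c) i j.
        rewrite big_split [RHS]mxE /ad !summxE; congr (_ + _); apply: eq_bigr => c _;
          by rewrite [RHS]mxE [in RHS]mxE.
      rewrite flow_field_lin -rhoE // -!row_mul mulmxN -/(X u).
      have -> : ad (nu u) (row a (- (P u *m rho u))) = - ad (nu u) (row a (P u *m rho u)).
        rewrite (_ : row a (- (P u *m rho u)) = - row a (P u *m rho u)); first by rewrite [LHS]linearN.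
        by apply/rowP => k; rewrite !mxE.
      by rewrite addKr.
    have := mderM (mderM (dP u) dX) (dQ u); congr mder.
    rewrite mulmxN mulNmx; move: (P u) (X u) (Q u) (rho u) => p x q r.
    rewrite mulmxBr mulmxDl mulmxBl !mulNmx !mulmxA.
    by rewrite addrA addNr add0r addNr.
  by rewrite nu0 P0 /Q Q0 trmx1 /tr_str mulmx1 mul1mx rowE mulmx1 ad_delta.
exists P, Q; split=> // t t0.
have -> : tr_str (P t) (Q t) C = nu t.
  have -> : C = tr_str (Q t) (P t) (nu t) by apply/funext => a; rewrite const.
  exact: tr_strK.
by rewrite -rhoE // -mulmxN.
Qed.

Variable mu : {bilinear 'rV[R]_n -> 'rV[R]_n -> 'rV[R]_n}.
Hypothesis hmu : nilpotent_bracket mu.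
Local Notation E := (mcform mu).

Theorem invariant_ricci_flow_exists : exists g, invariant_ricci_flow_from mu g.
Proof.
have [P [Q [P0 PQ dP]]] := bracket_flow_frame (str mu).
exists (fun t x => E x *m (P t *m (P t)^T) *m (E x)^T); split.
- move=> t t0; split; first by apply: frame_metric => //; case: (mulmx1_unit (PQ t)).
  move=> x; rewrite (Rc_left_invariant hmu x (PQ t)); apply: mder_one_sided.
  have dA := mderM (dP t t0) (mderT (dP t t0)).
  have := mderM (mderM (mderC t (E x)) dA) (mderC t (E x)^T); congr mder.
  rewrite mul0mx add0r mulmx0 addr0.
  set r := ric_sym _; have rT : r^T = r := ric_sym_tr _.
  move: (P t) => p; have -> : (- (p *m r))^T = - (r *m p^T).
    by rewrite [LHS]linearN /= trmx_mul rT.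
  have -> : - (p *m r) *m p^T + p *m - (r *m p^T) = - 2 *: (p *m r *m p^T).
    by rewrite mulNmx mulmxN mulmxA -opprD scaleNr scaler_nat mulr2n.
  by rewrite -scalemxAr -scalemxAl.
- by rewrite nil_metricE //; apply/funext => x; rewrite P0 trmx1 mulmx1.
- by move=> t t0; apply: left_invariant_frame.
Qed.

End Existence.

Theorem theorem6p6 (R : realType) (n : nat) :
  exists C : R,
    forall mu0 : {bilinear 'rV[R]_n -> 'rV[R]_n -> 'rV[R]_n},
      nilpotent_bracket mu0 ->
      (exists g : R -> 'rV[R]_n -> 'M[R]_n, invariant_ricci_flow_from mu0 g) /\
      (forall g : R -> 'rV[R]_n -> 'M[R]_n, invariant_ricci_flow_from mu0 g ->
         forall t : R, 0 < t -> forall x : 'rV[R]_n, norm_Rm (g t) x <= C / t).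
Proof.
exists (10 * n%:R ^+ 3 * (2 * n.+1%:R)) => mu hmu.
by split=> [|g hg]; [exact: invariant_ricci_flow_exists | exact: (type_III_bound hmu)].
Qed.
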